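(* Let $\mathscr{L}_\bullet$ be the algebra generated by the non-commutative coordinates $X_i^{\pm1},Y_i^{\pm1},Z^{\pm1}$ ($1\le i\le n$) of the pentagram network, with its induced bracket $\langle-,-\rangle$, and let $\mathscr{L}_\bullet^{(1)}=\mathscr{L}_\bullet/\langle Z-1\rangle$. (a) In $\mathscr{L}_\bullet^{(1)}$, the induced bracket $\langle-,-\rangle$ is invariant under the pentagram map $T$. (b) In $\mathscr{L}_\bullet$, the induced bracket is invariant under $S^2\circ T$, where $S$ is the shift of indices by one. Here invariance of the induced bracket under a map $\varphi$ means $\langle\varphi(u),\varphi(v)\rangle=\varphi(\langle u,v\rangle)$ modulo commutators for all elements $u,v$.
   Context: Double brackets. A double bracket on an associative algebra $A$ over a field $\mathbb{K}$ is a $\mathbb{K}$-bilinear map $\{\!\{-,-\}\!\}:A\times A\to A\otimes A$ with $\{\!\{a,bc\}\!\}=\{\!\{a,b\}\!\}(1\otimes c)+(b\otimes 1)\{\!\{a,c\}\!\}$ and $\{\!\{b,a\}\!\}=-\{\!\{a,b\}\!\}^\tau$, $(x\otimes y)^\tau=y\otimes x$. Put $\{a,b\}=\mu(\{\!\{a,b\}\!\})$ with $\mu$ the multiplication. With $A^\natural=A/[A,A]$ (quotient by the linear span of commutators), the induced bracket $\langle a^\natural,b^\natural\rangle:=\{a,b\}^\natural$ is well defined on $A^\natural$; one writes $\langle a,b\rangle$. Setup. $\mathcal{F}$ is the free skew field over $\mathbb{Q}$ on generators $a_i,b_i,c_i,d_i$, $1\le i\le n$ (indices mod $n$, with representatives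 $1,\dots,n$), with double bracket determined by $\{\!\{b_i,a_i\}\!\}=\tfrac12 b_i\otimes a_i$, $\{\!\{b_i,c_i\}\!\}=\tfrac12 c_i\otimes b_i$, $\{\!\{a_i,d_i\}\!\}=\tfrac12\,1\otimes a_id_i$, $\{\!\{c_i,d_i\}\!\}=\tfrac12\, d_ic_i\otimes1$, all other double brackets of generators not following by skew-symmetry being $0$. Put $z_k=d_1c_1\cdots d_{k-1}c_{k-1}d_k$ for $1\le k\le n$, and $$x_i=a_ic_{i-1}^{-1}d_{i-1}^{-1}c_{i-2}^{-1},\quad y_i=b_ic_i^{-1}d_i^{-1}c_{i-1}^{-1}d_{i-1}^{-1}c_{i-2}^{-1},$$ $$X_i=z_{i-2}x_iz_{i-2}^{-1},\quad Y_i=z_{i-2}y_iz_{i-2}^{-1},\quad Z=z_nc_n=d_1c_1\cdots d_nc_n$$ (subscripts of $z$ read mod $n$ in $\{1,\dots,n\}$). $\mathscr{L}_\bullet\subset\mathcal{F}$ is the subalgebra generated by $X_i^{\pm1},Y_i^{\pm1},Z^{\pm1}$; it is the group algebra of a free group on $X_i,Y_i,Z$. The element $Z$ is a Casimir, so the bracket descends to the quotient $\mathscr{L}_\bullet^{(1)}$ where $Z=1$ (and extends to the free skew field on $X_i,Y_i$). The pentagram map $T$. Put $\widetilde b_i=b_i+a_id_ic_i$, $\widetilde a_i=d_ic_i\widetilde b_i^{-1}$, $\widetilde c_i=\widetilde b_i^{-1}a_id_i$, $\widetilde d_i=\widetilde a_ib_ic_i^{-1}$, and $\xi_k=\widetilde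 a_1\widetilde b_1\cdots\widetilde a_k\widetilde b_k$. Then $T(X_i)=\widetilde X_i$, $T(Y_i)=\widetilde Y_i$, $T(Z)=Z$, where for $1\le i\le n$ $$\widetilde X_i=\xi_i\,\widetilde c_i\,\widetilde a_{i+2}^{-1}\widetilde b_{i+1}^{-1}\widetilde a_{i+1}^{-1}\,\xi_i^{-1},\qquad \widetilde Y_i=\xi_i\,\widetilde d_{i+1}\widetilde a_{i+3}^{-1}\widetilde b_{i+2}^{-1}\widetilde a_{i+2}^{-1}\widetilde b_{i+1}^{-1}\widetilde a_{i+1}^{-1}\,\xi_i^{-1}.$$ Modulo $Z=1$ this is $X_i\mapsto(X_i+Y_i)^{-1}X_i(X_{i+2}+Y_{i+2})$, $Y_i\mapsto(X_{i+1}+Y_{i+1})^{-1}Y_{i+1}(X_{i+3}+Y_{i+3})$ with indices mod $n$. The images lie in the ambient skew field, where the induced bracket is also defined. The map $S$ shifts all indices, $X_i\mapsto X_{i-1}$, $Y_i\mapsto Y_{i-1}$ with indices read cyclically; $S^2\circ T$ is the map sending $X_i\mapsto\widetilde X_{i-2}$, $Y_i\mapsto\widetilde Y_{i-2}$, $Z\mapsto Z$ (indices mod $n$ in $\{1,\dots,n\}$). *)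

(* Defs.v *)
From HB Require Import structures.
From mathcomp Require Import all_boot all_order all_algebra.
From mathcomp Require Import boolp.
Set Implicit Arguments.
Unset Strict Implicit.
Unset Printing Implicit Defensive.
Import GRing.Theory.
Local Open Scope ring_scope.
Local Open Scope quotient_scope.

(* The tensor product A ⊗_k B.  Its elements are classes of lists of pairs
   (x, y), a list standing for the sum of the x ⊗ y (scalars are absorbed in
   the first component); two lists are identified when no bilinear map
   separates the sums they denote. *)
Section Tensor.
Variables (k : fieldType) (A B : lmodType k).
Implicit Type s : seq (A * B).

Definition tensor_rel s s' : bool :=
  `[< forall (V : lmodType k) (f : A -> B -> V), bilinear_for *:%R *:%R f ->
        \sum_(p <- s) f p.1 p.2 = \sum_(p <- s') f p.1 p.2 >].

Lemma tensor_rel_refl : reflexive tensor_rel.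
Proof. by move=> s; apply/asboolP. Qed.

Lemma tensor_rel_sym : symmetric tensor_rel.
Proof.
by move=> s t; apply/asboolP/asboolP => h V f hf; rewrite h.
Qed.

Lemma tensor_rel_trans : transitive tensor_rel.
Proof.
move=> t s u /asboolP h1 /asboolP h2; apply/asboolP => V f hf.
by rewrite h1 // h2.
Qed.

Canonical tensor_equiv :=
  EquivRel tensor_rel tensor_rel_refl tensor_rel_sym tensor_rel_trans.

Definition tensor := {eq_quot tensor_equiv}.

HB.instance Definition _ := Choice.on tensor.
HB.instance Definition _ := EqQuotient.on tensor.

Implicit Types t u v : tensor.

Definition tens (x : A) (y : B) : tensor := \pi_tensor [:: (x, y)].

(* The linear map on A ⊗ B induced by f, provided f is bilinear. *)
Definition tensor_lift (V : lmodType k) (f : A -> B -> V) (t : tensor) : V :=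
  \sum_(p <- repr t) f p.1 p.2.

Lemma tensor_lift_pi (V : lmodType k) (f : A -> B -> V) s :
  bilinear_for *:%R *:%R f ->
  tensor_lift f (\pi_tensor s) = \sum_(p <- s) f p.1 p.2.
Proof.
move=> hf; have /eqmodP /asboolP h : repr (\pi_tensor s) = s %[mod tensor].
  by rewrite reprK.
exact: h.
Qed.

Lemma tensor_ext (t u : tensor) :
  (forall (V : lmodType k) (f : A -> B -> V), bilinear_for *:%R *:%R f ->
     tensor_lift f t = tensor_lift f u) -> t = u.
Proof.
move=> h; rewrite -[t]reprK -[u]reprK; apply/eqmodP/asboolP => V f hf.
exact: h.
Qed.

Lemma tensor_lift_tens (V : lmodType k) (f : A -> B -> V) x y :
  bilinear_for *:%R *:%R f -> tensor_lift f (tens x y) = f x y.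
Proof. by move=> hf; rewrite tensor_lift_pi // big_seq1. Qed.

Let zero : tensor := \pi_tensor [::].
Let opp (t : tensor) : tensor := \pi_tensor [seq (- p.1, p.2) | p <- repr t].
Let add (t u : tensor) : tensor := \pi_tensor (repr t ++ repr u).
Let scale (a : k) (t : tensor) : tensor :=
  \pi_tensor [seq (a *: p.1, p.2) | p <- repr t].

Let bilinDl (V : lmodType k) (f : A -> B -> V) x x' y :
  bilinear_for *:%R *:%R f -> f (x + x') y = f x y + f x' y.
Proof. by case=> h _; have := h y 1 x x'; rewrite /= !scale1r. Qed.

Let bilin0l (V : lmodType k) (f : A -> B -> V) y :
  bilinear_for *:%R *:%R f -> f 0 y = 0.
Proof.
by move=> hf; apply: (addrI (f 0 y)); rewrite -(bilinDl 0 0 y hf) !addr0.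
Qed.

Let bilinZl (V : lmodType k) (f : A -> B -> V) a x y :
  bilinear_for *:%R *:%R f -> f (a *: x) y = a *: f x y.
Proof.
by move=> hf; have := hf.1 y a x 0; rewrite /= bilin0l // !addr0.
Qed.

Let bilinNl (V : lmodType k) (f : A -> B -> V) x y :
  bilinear_for *:%R *:%R f -> f (- x) y = - f x y.
Proof. by move=> hf; rewrite -scaleN1r bilinZl // scaleN1r. Qed.

Let lift0 (V : lmodType k) (f : A -> B -> V) :
  bilinear_for *:%R *:%R f -> tensor_lift f zero = 0.
Proof. by move=> hf; rewrite tensor_lift_pi // big_nil. Qed.

Let liftN (V : lmodType k) (f : A -> B -> V) t :
  bilinear_for *:%R *:%R f -> tensor_lift f (opp t) = - tensor_lift f t.
Proof.
move=> hf; rewrite tensor_lift_pi // big_map /= -sumrN.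
by apply: eq_bigr => p _; rewrite bilinNl.
Qed.

Let liftD (V : lmodType k) (f : A -> B -> V) t u :
  bilinear_for *:%R *:%R f ->
  tensor_lift f (add t u) = tensor_lift f t + tensor_lift f u.
Proof. by move=> hf; rewrite tensor_lift_pi // big_cat. Qed.

Let liftZ (V : lmodType k) (f : A -> B -> V) a t :
  bilinear_for *:%R *:%R f ->
  tensor_lift f (scale a t) = a *: tensor_lift f t.
Proof.
move=> hf; rewrite tensor_lift_pi // big_map /= scaler_sumr.
by apply: eq_bigr => p _; rewrite bilinZl.
Qed.

Let addA : associative add.
Proof. by move=> t u v; apply: tensor_ext => V f hf; rewrite !liftD ?addrA. Qed.
Let addC : commutative add.
Proof. by move=> t u; apply: tensor_ext => V f hf; rewrite !liftD // addrC. Qed.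
Let add0 : left_id zero add.
Proof. by move=> t; apply: tensor_ext => V f hf; rewrite liftD // lift0 ?add0r. Qed.
Let addN : left_inverse zero opp add.
Proof.
by move=> t; apply: tensor_ext => V f hf; rewrite liftD // liftN // lift0 // addNr.
Qed.

HB.instance Definition _ := GRing.isZmodule.Build tensor addA addC add0 addN.

Let scaleA a b (t : tensor) : scale a (scale b t) = scale (a * b) t.
Proof. by apply: tensor_ext => V f hf; rewrite !liftZ // scalerA. Qed.
Let scale1 : left_id 1 scale.
Proof. by move=> t; apply: tensor_ext => V f hf; rewrite liftZ // scale1r. Qed.
Let scaleDr : right_distributive scale +%R.
Proof.
move=> a t u; apply: tensor_ext => V f hf.
by rewrite liftZ // !liftD // !liftZ // scalerDr.
Qed.
Let scaleDl (t : tensor) : {morph scale^~ t : a b / a + b}.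
Proof.
move=> a b; apply: tensor_ext => V f hf.
by rewrite liftZ // liftD // !liftZ // scalerDl.
Qed.

HB.instance Definition _ :=
  GRing.Zmodule_isLmodule.Build k tensor scaleA scale1 scaleDr scaleDl.

Lemma tensor_lift_linear (V : lmodType k) (f : A -> B -> V) :
  bilinear_for *:%R *:%R f -> linear (tensor_lift f).
Proof. by move=> hf a t u; rewrite liftD // liftZ. Qed.

Lemma tens_bilinear : bilinear_for *:%R *:%R tens.
Proof.
split=> [y a x x'|x a y y']; apply: tensor_ext => V f hf.
  rewrite tensor_lift_linear // !tensor_lift_tens //.
  exact: hf.1.
rewrite tensor_lift_linear // !tensor_lift_tens //.
exact: hf.2.
Qed.

Lemma tensorE (t : tensor) : t = \sum_(p <- repr t) tens p.1 p.2.
Proof.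
apply: tensor_ext => V f hf.
have -> : \sum_(p <- repr t) tens p.1 p.2 = \pi_tensor (repr t).
  elim: (repr t) => [|p s IHs]; first by rewrite big_nil.
  rewrite big_cons IHs; apply: tensor_ext => W g hg.
  by rewrite liftD // tensor_lift_tens // !tensor_lift_pi // big_cons.
by rewrite tensor_lift_pi.
Qed.

End Tensor.

Reserved Notation "x ⊗ y" (at level 40, left associativity).
Notation "x ⊗ y" := (tens x y) : ring_scope.

Section TensorRing.
Variables (k : fieldType) (A B : algType k).
Implicit Types t u v : tensor A B.

Let mul_inner (V : lmodType k) (f : A -> B -> V) u (x : A) (y : B) : V :=
  tensor_lift (fun x' y' => f (x * x') (y * y')) u.

Let bilin_shift (V : lmodType k) (f : A -> B -> V) x y :
  bilinear_for *:%R *:%R f ->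
  bilinear_for *:%R *:%R (fun x' y' => f (x * x') (y * y')).
Proof.
move=> hf; split=> [y' a x' x''|x' a y' y''].
  by rewrite mulrDr -scalerAr hf.1.
by rewrite mulrDr -scalerAr hf.2.
Qed.

Let bilin_inner (V : lmodType k) (f : A -> B -> V) u :
  bilinear_for *:%R *:%R f -> bilinear_for *:%R *:%R (mul_inner f u).
Proof.
move=> hf; split=> [y a x x'|x a y y']; rewrite /mul_inner /tensor_lift.
  rewrite /= scaler_sumr -big_split /=; apply: eq_bigr => p _.
  by rewrite mulrDl -scalerAl; apply: hf.1.
rewrite /= scaler_sumr -big_split /=; apply: eq_bigr => p _.
by rewrite mulrDl -scalerAl; apply: hf.2.
Qed.

Let one : tensor A B := 1 ⊗ 1.
Let mul t u : tensor A B :=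
  \sum_(p <- repr t) \sum_(q <- repr u) (p.1 * q.1) ⊗ (p.2 * q.2).

Let lift_sum (V : lmodType k) (f : A -> B -> V) (I : Type) (r : seq I)
    (F : I -> tensor A B) : bilinear_for *:%R *:%R f ->
  tensor_lift f (\sum_(i <- r) F i) = \sum_(i <- r) tensor_lift f (F i).
Proof.
move=> hf; have hl := tensor_lift_linear hf.
elim: r => [|i r IHr].
  rewrite !big_nil; apply: (addrI (tensor_lift f 0)).
  by have := hl 1 0 0; rewrite !scale1r !addr0.
by rewrite !big_cons -IHr; have := hl 1 (F i); rewrite !scale1r => ->.
Qed.

Let lift_add (V : lmodType k) (f : A -> B -> V) t u :
  bilinear_for *:%R *:%R f ->
  tensor_lift f (t + u) = tensor_lift f t + tensor_lift f u.
Proof. by move=> hf; have := tensor_lift_linear hf 1 t u; rewrite !scale1r. Qed.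

Let lift_mul (V : lmodType k) (f : A -> B -> V) t u :
  bilinear_for *:%R *:%R f ->
  tensor_lift f (mul t u) = tensor_lift (mul_inner f u) t.
Proof.
move=> hf; rewrite lift_sum //; apply: eq_bigr => p _.
rewrite lift_sum //; apply: eq_bigr => q _.
by rewrite tensor_lift_tens.
Qed.

Let mulA : associative mul.
Proof.
move=> t u v; apply: tensor_ext => V f hf.
rewrite !lift_mul //; last exact: bilin_inner.
apply: eq_bigr => p _; rewrite /mul_inner lift_mul; last exact: bilin_shift.
apply: eq_bigr => q _; apply: eq_bigr => r _.
by rewrite !mulrA.
Qed.

Let mul1 : left_id one mul.
Proof.
move=> t; apply: tensor_ext => V f hf.
rewrite lift_mul // tensor_lift_tens; last exact: bilin_inner.
by apply: eq_bigr => p _; rewrite !mul1r.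
Qed.

Let mulr_one : right_id one mul.
Proof.
move=> t; apply: tensor_ext => V f hf; rewrite lift_mul //.
apply: eq_bigr => p _; rewrite /mul_inner tensor_lift_tens ?mulr1 //.
exact: bilin_shift.
Qed.

Let mulDl : left_distributive mul +%R.
Proof.
move=> t u v; apply: tensor_ext => V f hf.
by rewrite lift_mul // !lift_add ?lift_mul //; apply: bilin_inner.
Qed.

Let mulDr : right_distributive mul +%R.
Proof.
move=> t u v; apply: tensor_ext => V f hf.
rewrite lift_add // !lift_mul // -big_split /=.
by apply: eq_bigr => p _; rewrite /mul_inner lift_add //; apply: bilin_shift.
Qed.

HB.instance Definition _ :=
  GRing.Zmodule_isPzRing.Build (tensor A B) mulA mul1 mulr_one mulDl mulDr.

Lemma tens_mul (x x' : A) (y y' : B) : (x ⊗ y) * (x' ⊗ y') = (x * x') ⊗ (y * y').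
Proof.
apply: tensor_ext => V f hf.
rewrite lift_mul // tensor_lift_tens; last exact: bilin_inner.
by rewrite /mul_inner !tensor_lift_tens //; apply: bilin_shift.
Qed.

End TensorRing.

Definition tensor_map (k : fieldType) (A B C D : lmodType k)
    (f : {linear A -> C}) (g : {linear B -> D}) : tensor A B -> tensor C D :=
  tensor_lift (fun x y => f x ⊗ g y).

Definition tensor_swap (k : fieldType) (A B : lmodType k) :
    tensor A B -> tensor B A :=
  tensor_lift (fun x y => y ⊗ x).

Definition tensor_mult (k : fieldType) (A : algType k) : tensor A A -> A :=
  tensor_lift (fun x y => x * y).

Record double_bracket (k : fieldType) (A : algType k)
    (db : {bilinear A -> A -> tensor A A}) : Prop := DoubleBracket {
  double_bracket_leibniz : forall a b c : A,
    db a (b * c) = db a b * (1 ⊗ c) + (b ⊗ 1) * db a c;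
  double_bracket_skew : forall a b : A, db b a = - tensor_swap (db a b)
}.

Definition bracket (k : fieldType) (A : algType k)
    (db : {bilinear A -> A -> tensor A A}) (a b : A) : A :=
  tensor_mult (db a b).

(* Equality of the classes of x and y in A / [A, A]; coefficients of the
   linear combination of commutators are absorbed in p.1. *)
Definition eq_mod_comm (A : nzRingType) (x y : A) : Prop :=
  exists s : seq (A * A), x - y = \sum_(p <- s) (p.1 * p.2 - p.2 * p.1).

Definition in_ideal (A : nzRingType) (z x : A) : Prop :=
  exists s : seq (A * A), x = \sum_(p <- s) p.1 * z * p.2.

Section Subalgebra.
Variables (k : fieldType) (A : algType k).

Inductive alg_span (G : A -> Prop) : A -> Prop :=
| alg_span_gen x of G x : alg_span G x
| alg_span_1 : alg_span G 1
| alg_span_lin (a : k) x y of alg_span G x & alg_span G y :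
    alg_span G (a *: x + y)
| alg_span_mul x y of alg_span G x & alg_span G y : alg_span G (x * y).

Definition alg_span_pred (G : A -> Prop) : {pred A} :=
  fun x => `[< alg_span G x >].

Lemma alg_span_closed G : subalg_closed (alg_span_pred G).
Proof.
split=> [|a x y /asboolP hx /asboolP hy|x y /asboolP hx /asboolP hy].
- exact/asboolP/alg_span_1.
- exact/asboolP/alg_span_lin.
- exact/asboolP/alg_span_mul.
Qed.

HB.instance Definition _ G :=
  GRing.isSubalgClosed.Build k A (alg_span_pred G) (alg_span_closed G).

Definition subalg (G : A -> Prop) := {x : A | x \in alg_span_pred G}.

HB.instance Definition _ G := SubChoice.on (subalg G).
HB.instance Definition _ G := [SubChoice_isSubAlgebra of subalg G by <:].

End Subalgebra.

Section FreeSkewField.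
Variables (k : fieldType) (I : Type).

Definition skew_field (F : unitAlgType k) : Prop :=
  forall x : F, x != 0 -> x \is a GRing.unit.

Inductive skew_span (F : unitAlgType k) (g : I -> F) : F -> Prop :=
| skew_span_gen i : skew_span g (g i)
| skew_span_1 : skew_span g 1
| skew_span_lin (a : k) x y of skew_span g x & skew_span g y :
    skew_span g (a *: x + y)
| skew_span_mul x y of skew_span g x & skew_span g y : skew_span g (x * y)
| skew_span_inv x of skew_span g x : skew_span g x^-1.

(* A specialization (in the sense of Cohn) from (F, g) to (D, h): a
   homomorphism s to D from a subalgebra R of F (embedded by iota) that
   contains the g i, with s (g i) = h i, such that every element of R outside
   the kernel of s is invertible in R. *)
Definition specializes (F D : unitAlgType k) (g : I -> F) (h : I -> D) : Prop :=
  exists (R : algType k) (iota : {lrmorphism R -> F}) (s : {lrmorphism R -> D}),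
    [/\ injective iota,
        forall i, exists2 r, iota r = g i & s r = h i
      & forall r, s r != 0 -> exists r', iota r' = (iota r)^-1].

(* (F, g) is the free skew field on I, i.e. the universal field of fractions
   of the free algebra k<I>: it is generated by g as a skew field, and every
   skew field over k with an I-indexed family is a specialization of it.
   This determines (F, g) up to a unique isomorphism. *)
Definition free_skew_field (F : unitAlgType k) (g : I -> F) : Prop :=
  [/\ skew_field F,
      forall x, skew_span g x
    & forall (D : unitAlgType k) (h : I -> D), skew_field D -> specializes g h].

End FreeSkewField.

Inductive letter := La | Lb | Lc | Ld.

(* Indices 1, ..., n are represented by the ordinals 0, ..., n - 1:
   index_mod i is the ordinal representing the residue of i modulo n, and
   index_rep i is the representative of i in {1, ..., n}. *)
Section Pentagram.
Variables (n : nat) (n_gt0 : (0 < n)%N).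

Lemma index_mod_subproof (i : int) : (`|((i - 1) %% n%:Z)%Z| < n)%N.
Proof.
have n0 : n%:Z != 0 by rewrite -lt0n.
by rewrite -ltz_nat gez0_abs ?modz_ge0 // ltz_mod.
Qed.

Definition index_mod (i : int) : 'I_n := Ordinal (index_mod_subproof i).
Definition index_rep (i : int) : nat := (index_mod i).+1.

Variables (F : unitAlgType rat) (g : letter * 'I_n -> F).

Definition pent_bracket_gens (db : {bilinear F -> F -> tensor F F}) : Prop :=
  let a i := g (La, i) in let b i := g (Lb, i) in
  let c i := g (Lc, i) in let d i := g (Ld, i) in
  let half : rat := 2^-1 in
  [/\ forall i, [/\ db (b i) (a i) = half *: (b i ⊗ a i),
                    db (b i) (c i) = half *: (c i ⊗ b i),
                    db (a i) (d i) = half *: (1 ⊗ (a i * d i))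
                  & db (c i) (d i) = half *: ((d i * c i) ⊗ 1)],
      forall i j, i != j -> [/\ db (b i) (a j) = 0, db (b i) (c j) = 0,
                                db (a i) (d j) = 0 & db (c i) (d j) = 0],
      forall i j, db (a i) (c j) = 0 /\ db (b i) (d j) = 0
    & forall i j, [/\ db (a i) (a j) = 0, db (b i) (b j) = 0,
                      db (c i) (c j) = 0 & db (d i) (d j) = 0]].

Definition ga (i : int) : F := g (La, index_mod i).
Definition gb (i : int) : F := g (Lb, index_mod i).
Definition gc (i : int) : F := g (Lc, index_mod i).
Definition gd (i : int) : F := g (Ld, index_mod i).

Definition pz (k : nat) : F :=
  (\prod_(1 <= j < k) (gd j%:Z * gc j%:Z)) * gd k%:Z.

Definition px (i : int) : F :=
  ga i * (gc (i - 1))^-1 * (gd (i - 1))^-1 * (gc (i - 2))^-1.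
Definition py (i : int) : F :=
  gb i * (gc i)^-1 * (gd i)^-1 * (gc (i - 1))^-1 * (gd (i - 1))^-1
    * (gc (i - 2))^-1.

Definition pX (i : int) : F :=
  pz (index_rep (i - 2)) * px i * (pz (index_rep (i - 2)))^-1.
Definition pY (i : int) : F :=
  pz (index_rep (i - 2)) * py i * (pz (index_rep (i - 2)))^-1.
Definition pZ : F := pz n * gc n%:Z.

Inductive pent_gen : F -> Prop :=
| pent_gen_X i : pent_gen (pX i)
| pent_gen_XV i : pent_gen (pX i)^-1
| pent_gen_Y i : pent_gen (pY i)
| pent_gen_YV i : pent_gen (pY i)^-1
| pent_gen_Z : pent_gen pZ
| pent_gen_ZV : pent_gen pZ^-1.

(* The algebra L_•. *)
Definition pentL := subalg pent_gen.
HB.instance Definition _ := GRing.SubAlgebra.on pentL.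

Lemma pent_gen_mem x : pent_gen x -> x \in alg_span_pred pent_gen.
Proof. by move=> hx; apply/asboolP/alg_span_gen. Qed.

Definition LX (i : int) : pentL := Sub (pX i) (pent_gen_mem (pent_gen_X i)).
Definition LY (i : int) : pentL := Sub (pY i) (pent_gen_mem (pent_gen_Y i)).
Definition LZ : pentL := Sub pZ (pent_gen_mem pent_gen_Z).

(* LXY (true, i) runs through X_1, ..., X_n and LXY (false, i) through
   Y_1, ..., Y_n. *)
Definition LXY (p : bool * 'I_n) : pentL :=
  if p.1 then LX p.2.+1%:Z else LY p.2.+1%:Z.

Definition tb (i : int) : F := gb i + ga i * gd i * gc i.
Definition ta (i : int) : F := gd i * gc i * (tb i)^-1.
Definition tc (i : int) : F := (tb i)^-1 * ga i * gd i.
Definition td (i : int) : F := ta i * gb i * (gc i)^-1.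

Definition txi (k : nat) : F := \prod_(1 <= j < k.+1) (ta j%:Z * tb j%:Z).

Definition tX (i : int) : F :=
  txi (index_rep i) * tc i * (ta (i + 2))^-1 * (tb (i + 1))^-1
    * (ta (i + 1))^-1 * (txi (index_rep i))^-1.
Definition tY (i : int) : F :=
  txi (index_rep i) * td (i + 1) * (ta (i + 3))^-1 * (tb (i + 2))^-1
    * (ta (i + 2))^-1 * (tb (i + 1))^-1 * (ta (i + 1))^-1
    * (txi (index_rep i))^-1.

(* K is the free skew field on the images of X_1, ..., Y_n under an algebra
   morphism f sending Z to 1 (through L_• / (Z - 1)).  Z is a Casimir for the
   induced bracket only: {{u, Z}} is congruent to (1 ⊗ u - u ⊗ 1) / 2 modulo
   Z = 1, so db itself does not pass to the quotient.  The induced bracket of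
   the quotient, and its extension to K, come from the double bracket of K
   whose values on the X_i, Y_i are those of db with Z put to 1.  Below, t is
   the element of L_• ⊗ L_• equal to {{P, Q}}; it exists and is unique. *)
Definition reduced_bracket (db : {bilinear F -> F -> tensor F F})
    (K : unitAlgType rat) (f : {lrmorphism pentL -> K})
    (dbK : {bilinear K -> K -> tensor K K}) : Prop :=
  double_bracket dbK /\
  forall (p p' : bool * 'I_n) (t : tensor pentL pentL),
    tensor_map (\val : {linear pentL -> F}) (\val : {linear pentL -> F}) t
      = db (\val (LXY p)) (\val (LXY p')) ->
    dbK (f (LXY p)) (f (LXY p')) = tensor_map f f t.

End Pentagram.

Arguments reduced_bracket {n} n_gt0 {F} g db {K} f dbK.
Arguments pentL {n} n_gt0 {F} g.
Arguments LX {n} n_gt0 {F} g i.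
Arguments LY {n} n_gt0 {F} g i.
Arguments LZ {n} n_gt0 {F} g.
Arguments LXY {n} n_gt0 {F} g p.
Arguments tX {n} n_gt0 {F} g i.
Arguments tY {n} n_gt0 {F} g i.
Arguments pZ {n} n_gt0 {F} g.

(* Main.v *)
Require Import Defs.
From HB Require Import structures.
From mathcomp Require Import all_boot all_order all_algebra ring.
From mathcomp Require Import boolp classical_sets.
Import GRing.Theory.
Local Open Scope ring_scope.
Set Implicit Arguments.
Unset Strict Implicit.
Unset Printing Implicit Defensive.

(* Put p_i = d_i c_i and P_k = p_1 ... p_k.  Up to powers of Z,
     X_i = P_{i-2} (c_{i-2}^-1 a_i) P_{i-1}^-1,
     Y_i = P_{i-2} (c_{i-2}^-1 b_i) P_i^-1
   are loops in a quiver with vertex set Z/n whose arcs are the p_i, the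
   c_{i-2}^-1 a_i and the c_{i-2}^-1 b_i.  As p_i = a~_i b~_i, the pentagram
   map fixes the p_i; it sends the other arcs to c~_{i-2} a~_i^-1 and
   d~_{i-1} a~_{i+1}^-1.  On arcs, the double bracket of the images is the image
   of the double bracket, up to terms that are inner at the endpoints.  Such
   terms telescope along paths, and vanish modulo commutators on loops: this
   proves (b).

   For (a), sending a_i, b_i, c_i, d_i to X_i, Y_i, 1, 1 specializes F to K, so
   a local subring R of F maps onto a set of generators of K.  The bracket of K
   is the specialization of that of F up to inner terms, which come from
   {{Z, u}}, and T lifts to R, where the argument for (b) applies. *)

(** The images of the arcs do not bracket as the arcs do: {{p, b}} has terms b ⊗ p, the bracket of
    the images has terms p ⊗ b'. The discrepancy is that of a change of frame at the vertices.
    Replacing y by g_s^-1 y g_t adds (y ⊗ 1) {{x, g_t}} - {{x, g_s}} (1 ⊗ y) to {{x, y}} at g = 1; a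
    correction only prescribes the values {{x, g_v}}, and no g_v has to exist. Sending a path to its
    image is not known to be a function. It is handled as a relation, which is compared with the
    given morphism on loops, where it lands in the coordinate algebra. In (a), the bracket of K is
    given on the X_i and Y_i only, while the images under T have denominators X_i + Y_i, so they are
    studied in F. There {{x, y}} gets two descriptions, one from the arcs and one from the loops. To
    specialize both to K they must agree already in R ⊗ R, hence the injectivity of
    [tensor_map iota iota]; over a field it follows from a linear retraction. *)

(** * Additive identities by reflection *)

Inductive zmod_expr := ZAtom of nat | ZZero | ZAdd of zmod_expr & zmod_expr
  | ZOpp of zmod_expr.

Section ZmodReflection.
Variable V : zmodType.
Implicit Type env : seq V.

Fixpoint zmod_eval env e : V :=
  match e with
  | ZAtom i => env`_i
  | ZZero => 0
  | ZAdd e1 e2 => zmod_eval env e1 + zmod_eval env e2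
  | ZOpp e1 => - zmod_eval env e1
  end.

Fixpoint zmod_coef (i : nat) e : int :=
  match e with
  | ZAtom j => (i == j)%:Z
  | ZZero => 0
  | ZAdd e1 e2 => zmod_coef i e1 + zmod_coef i e2
  | ZOpp e1 => - zmod_coef i e1
  end.

Lemma zmod_evalE env e :
  zmod_eval env e = \sum_(i < size env) env`_i *~ zmod_coef i e.
Proof.
elim: e => [j||e1 IH1 e2 IH2|e IH] /=.
- have [ltj|gej] := ltnP j (size env).
    rewrite (bigD1 (Ordinal ltj)) //= eqxx mulr1z big1 ?addr0 // => i /eqP ij.
    case: eqP => [e|]; last by rewrite mulr0z.
    by case: ij; apply: val_inj.
  rewrite nth_default // big1 // => i _; case: eqP => [e|]; last by rewrite mulr0z.
  by have := ltn_ord i; rewrite e ltnNge gej.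
- by rewrite big1 // => i _; rewrite mulr0z.
- by rewrite IH1 IH2 -big_split; apply: eq_bigr => i _; rewrite mulrzDr.
- by rewrite IH -sumrN; apply: eq_bigr => i _; rewrite mulrNz.
Qed.

(** Integer coefficients are compared by computation. This closes the goals in which tensors, taken
    as atoms, cancel in pairs. *)
Lemma zmod_reflect env e1 e2 :
  all (fun i => zmod_coef i e1 == zmod_coef i e2) (iota 0 (size env)) ->
  zmod_eval env e1 = zmod_eval env e2.
Proof.
move=> /allP h; rewrite !zmod_evalE; apply: eq_bigr => i _; congr (_ *~ _).
by apply/eqP/h; rewrite mem_iota ltn_ord.
Qed.
End ZmodReflection.

(* The instances in two occurrences of an atom may be convertible without
   being identical. *)
Ltac same_atom a e :=
  first [constr_eq_strict a e | same_args a e]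
with same_args a e :=
  lazymatch a with
  | (?c *: ?x)%R => lazymatch e with (?d *: ?y)%R => same_atom c d; same_atom x y end
  | (?x * ?y)%R => lazymatch e with (?z * ?t)%R => same_atom x z; same_atom y t end
  | (?x ⊗ ?y)%R => lazymatch e with (?z ⊗ ?t)%R => same_atom x z; same_atom y t end
  | 1%R => lazymatch e with 1%R => idtac end
  | ?f ?x => lazymatch e with ?g ?y => same_atom x y; unify f g end
  end.

Ltac zmod_env env e :=
  lazymatch e with
  | (?x + ?y)%R => let env := zmod_env env x in zmod_env env y
  | (- ?x)%R => zmod_env env x
  | 0%R => env
  | _ =>
    let rec mem l :=
      lazymatch l with
      | nil => constr:(false)
      | cons ?a ?l' => match constr:(Set) with
                       | _ => let _ := match constr:(Set) with _ => same_atom a e end in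
                              constr:(true)
                       | _ => mem l'
                       end
      end in
    lazymatch mem env with
    | true => env
    | false => constr:(cons e env)
    end
  end.

Ltac zmod_index env e :=
  lazymatch env with
  | cons ?a ?l => match constr:(Set) with
                  | _ => let _ := match constr:(Set) with _ => same_atom a e end in
                         constr:(0%N)
                  | _ => let i := zmod_index l e in constr:(S i)
                  end
  end.

Ltac zmod_reify env e :=
  lazymatch e with
  | (?x + ?y)%R => let x' := zmod_reify env x in let y' := zmod_reify env y in
                   constr:(ZAdd x' y')
  | (- ?x)%R => let x' := zmod_reify env x in constr:(ZOpp x')
  | 0%R => constr:(ZZero)
  | _ => let i := zmod_index env e in constr:(ZAtom i)
  end.

Ltac zmod_solve :=
  lazymatch goal with
  | |- @eq ?V ?x ?y =>
    let env := zmod_env (@nil V) x in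
    let env := zmod_env env y in
    let x' := zmod_reify env x in
    let y' := zmod_reify env y in
    exact: (@zmod_reflect _ env x' y' isT)
  end.

(** * Tensor products: functoriality, exchange of factors, multiplication, injectivity *)

Section TensorTheory.
Variables (k : fieldType) (A B : lmodType k).

Lemma tensDl (x x' : A) (y : B) : (x + x') ⊗ y = x ⊗ y + x' ⊗ y.
Proof. by have := (tens_bilinear A B).1 y 1 x x'; rewrite /= !scale1r. Qed.

Lemma tensDr (x : A) (y y' : B) : x ⊗ (y + y') = x ⊗ y + x ⊗ y'.
Proof. by have := (tens_bilinear A B).2 x 1 y y'; rewrite /= !scale1r. Qed.

Lemma tens0l (y : B) : (0 : A) ⊗ y = 0.
Proof. by apply: (addrI (0 ⊗ y)); rewrite -tensDl !addr0. Qed.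

Lemma tens0r (x : A) : x ⊗ (0 : B) = 0.
Proof. by apply: (addrI (x ⊗ 0)); rewrite -tensDr !addr0. Qed.

Lemma tensZl a (x : A) (y : B) : (a *: x) ⊗ y = a *: (x ⊗ y).
Proof. by have := (tens_bilinear A B).1 y a x 0; rewrite /= tens0l !addr0. Qed.

Lemma tensZr a (x : A) (y : B) : x ⊗ (a *: y) = a *: (x ⊗ y).
Proof. by have := (tens_bilinear A B).2 x a y 0; rewrite /= tens0r !addr0. Qed.

Lemma tensNl (x : A) (y : B) : (- x) ⊗ y = - (x ⊗ y).
Proof. by rewrite -scaleN1r tensZl scaleN1r. Qed.

Lemma tensNr (x : A) (y : B) : x ⊗ (- y) = - (x ⊗ y).
Proof. by rewrite -scaleN1r tensZr scaleN1r. Qed.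

Lemma tensor_ind (P : tensor A B -> Prop) :
  P 0 -> (forall x y t, P t -> P (x ⊗ y + t)) -> forall t, P t.
Proof.
move=> P0 PD t; rewrite (tensorE t); elim: (repr t) => [|p s IHs].
  by rewrite big_nil.
by rewrite big_cons; apply: PD.
Qed.

Section Lift.
Variables (V : lmodType k) (f : A -> B -> V).
Hypothesis hf : bilinear_for *:%R *:%R f.

Lemma tensor_liftD t u : tensor_lift f (t + u) = tensor_lift f t + tensor_lift f u.
Proof. by have := tensor_lift_linear hf 1 t u; rewrite !scale1r. Qed.

Lemma tensor_lift0 : tensor_lift f 0 = 0.
Proof. by apply: (addrI (tensor_lift f 0)); rewrite -tensor_liftD !addr0. Qed.

Lemma tensor_liftZ a t : tensor_lift f (a *: t) = a *: tensor_lift f t.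
Proof. by have := tensor_lift_linear hf a t 0; rewrite tensor_lift0 !addr0. Qed.

Lemma tensor_liftN t : tensor_lift f (- t) = - tensor_lift f t.
Proof. by rewrite -(scaleN1r t) tensor_liftZ scaleN1r. Qed.
End Lift.
End TensorTheory.

Section TensorMapTheory.
Variables (k : fieldType) (A B C D : lmodType k).
Variables (f : {linear A -> C}) (g : {linear B -> D}).

Lemma tensor_map_bilinear :
  bilinear_for *:%R *:%R (fun x y => f x ⊗ g y).
Proof.
split=> [y a x x'|x a y y'] /=; rewrite linearP.
  by rewrite tensDl tensZl.
by rewrite tensDr tensZr.
Qed.

Let hb := tensor_map_bilinear.

Lemma tensor_map_tens x y : tensor_map f g (x ⊗ y) = f x ⊗ g y.
Proof. exact: tensor_lift_tens. Qed.
Lemma tensor_mapD t u : tensor_map f g (t + u) = tensor_map f g t + tensor_map f g u.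
Proof. exact: tensor_liftD. Qed.
Lemma tensor_map0 : tensor_map f g 0 = 0.
Proof. exact: tensor_lift0. Qed.
Lemma tensor_mapZ a t : tensor_map f g (a *: t) = a *: tensor_map f g t.
Proof. exact: tensor_liftZ. Qed.
Lemma tensor_mapN t : tensor_map f g (- t) = - tensor_map f g t.
Proof. exact: tensor_liftN. Qed.
End TensorMapTheory.

Section TensorSwapTheory.
Variables (k : fieldType) (A B : lmodType k).

Lemma tensor_swap_bilinear :
  bilinear_for *:%R *:%R (fun (x : A) (y : B) => y ⊗ x).
Proof.
split=> [y a x x'|x a y y'] /=; first by rewrite tensDr tensZr.
by rewrite tensDl tensZl.
Qed.

Let hb := tensor_swap_bilinear.

Lemma tensor_swap_tens (x : A) (y : B) : tensor_swap (x ⊗ y) = y ⊗ x.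
Proof. exact: (tensor_lift_tens x y hb). Qed.
Lemma tensor_swapD (t u : tensor A B) :
  tensor_swap (t + u) = tensor_swap t + tensor_swap u.
Proof. exact: tensor_liftD. Qed.
Lemma tensor_swap0 : tensor_swap (0 : tensor A B) = 0.
Proof. exact: tensor_lift0. Qed.
Lemma tensor_swapZ a (t : tensor A B) : tensor_swap (a *: t) = a *: tensor_swap t.
Proof. exact: tensor_liftZ. Qed.
Lemma tensor_swapN (t : tensor A B) : tensor_swap (- t) = - tensor_swap t.
Proof. exact: tensor_liftN. Qed.
End TensorSwapTheory.

Lemma tensor_swapK (k : fieldType) (A B : lmodType k) (t : tensor A B) :
  tensor_swap (tensor_swap t) = t.
Proof.
elim/tensor_ind: t => [|x y t IHt]; first by rewrite !tensor_swap0.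
by rewrite !tensor_swapD IHt !tensor_swap_tens.
Qed.

Lemma tensor_swap_map (k : fieldType) (A B C D : lmodType k)
    (f : {linear A -> C}) (g : {linear B -> D}) t :
  tensor_swap (tensor_map f g t) = tensor_map g f (tensor_swap t).
Proof.
elim/tensor_ind: t => [|x y t IHt].
  by rewrite tensor_swap0 !tensor_map0 tensor_swap0.
by rewrite tensor_mapD !tensor_swapD tensor_mapD IHt
  !(tensor_map_tens, tensor_swap_tens).
Qed.

Section TensorAlgTheory.
Variables (k : fieldType) (A B : algType k).
Implicit Types t u v : tensor A B.

Lemma tens_scaleAl a t u : (a *: t) * u = a *: (t * u).
Proof.
elim/tensor_ind: t => [|x y t IHt]; first by rewrite scaler0 !mul0r scaler0.
rewrite scalerDr !mulrDl scalerDr IHt; congr (_ + _).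
elim/tensor_ind: u {t IHt} => [|x' y' u IHu]; first by rewrite !mulr0 scaler0.
by rewrite !mulrDr scalerDr IHu tens_mul -!tensZl tens_mul scalerAl.
Qed.

Lemma tens_scaleAr a t u : t * (a *: u) = a *: (t * u).
Proof.
elim/tensor_ind: t => [|x y t IHt]; first by rewrite !mul0r scaler0.
rewrite !mulrDl !scalerDr IHt; congr (_ + _).
elim/tensor_ind: u {t IHt} => [|x' y' u IHu].
  by rewrite scaler0 !mulr0 scaler0.
by rewrite scalerDr !mulrDr scalerDr IHu tens_mul -!tensZl tens_mul scalerAr.
Qed.

Lemma tens_commr (x : A) (y : B) t :
  t * (x ⊗ 1) * (1 ⊗ y) = t * (1 ⊗ y) * (x ⊗ 1).
Proof. by rewrite -!mulrA !tens_mul !mulr1 !mul1r. Qed.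
End TensorAlgTheory.

Lemma tensor_swapM (k : fieldType) (A B : algType k) (t u : tensor A B) :
  tensor_swap (t * u) = tensor_swap t * tensor_swap u.
Proof.
elim/tensor_ind: t => [|x y t IHt]; first by rewrite mul0r !tensor_swap0 mul0r.
rewrite mulrDl !tensor_swapD mulrDl IHt; congr (_ + _).
elim/tensor_ind: u {t IHt} => [|x' y' u IHu]; first by rewrite mulr0 !tensor_swap0 mulr0.
by rewrite mulrDr !tensor_swapD mulrDr IHu tens_mul !tensor_swap_tens tens_mul.
Qed.

Lemma tensor_mapM (k : fieldType) (A B C D : algType k)
    (f : {lrmorphism A -> C}) (g : {lrmorphism B -> D}) (t u : tensor A B) :
  tensor_map f g (t * u) = tensor_map f g t * tensor_map f g u.
Proof.
elim/tensor_ind: t => [|x y t IHt]; first by rewrite mul0r !tensor_map0 mul0r.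
rewrite mulrDl !tensor_mapD mulrDl IHt; congr (_ + _).
elim/tensor_ind: u {t IHt} => [|x' y' u IHu]; first by rewrite mulr0 !tensor_map0 mulr0.
by rewrite mulrDr !tensor_mapD mulrDr IHu tens_mul !tensor_map_tens tens_mul !rmorphM.
Qed.

Lemma tensor_map_id (k : fieldType) (A B : algType k) (t : tensor A B) :
  tensor_map (idfun : {lrmorphism A -> A}) (idfun : {lrmorphism B -> B}) t = t.
Proof.
elim/tensor_ind: t => [|x y t IHt]; first by rewrite tensor_map0.
by rewrite tensor_mapD tensor_map_tens IHt.
Qed.

Section TensorMultTheory.
Variables (k : fieldType) (A : algType k).
Implicit Types t u : tensor A A.

Lemma tensor_mult_bilinear :
  bilinear_for *:%R *:%R (fun x y : A => x * y).
Proof.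
split=> [y a x x'|x a y y'] /=; first by rewrite mulrDl scalerAl.
by rewrite mulrDr scalerAr.
Qed.

Let hb := tensor_mult_bilinear.

Lemma tensor_mult_tens (x y : A) : tensor_mult (x ⊗ y) = x * y.
Proof. exact: tensor_lift_tens. Qed.
Lemma tensor_multD t u : tensor_mult (t + u) = tensor_mult t + tensor_mult u.
Proof. exact: tensor_liftD. Qed.
Lemma tensor_mult0 : tensor_mult (0 : tensor A A) = 0.
Proof. exact: tensor_lift0. Qed.
Lemma tensor_multN t : tensor_mult (- t) = - tensor_mult t.
Proof. exact: tensor_liftN. Qed.

Lemma tensor_mult_outerl (x : A) t : tensor_mult ((x ⊗ 1) * t) = x * tensor_mult t.
Proof.
elim/tensor_ind: t => [|y z t IHt]; first by rewrite mulr0 tensor_mult0 mulr0.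
by rewrite mulrDr !tensor_multD mulrDr IHt tens_mul !tensor_mult_tens mul1r mulrA.
Qed.

Lemma tensor_mult_outerr (x : A) t : tensor_mult (t * (1 ⊗ x)) = tensor_mult t * x.
Proof.
elim/tensor_ind: t => [|y z t IHt]; first by rewrite mul0r tensor_mult0 mul0r.
by rewrite mulrDl !tensor_multD mulrDl IHt tens_mul !tensor_mult_tens mulr1 mulrA.
Qed.

(** Both sides send y ⊗ z to y x z. This makes the bracket cyclic in its first argument and kills
    half of an inner term. *)
Lemma tensor_mult_inner (x : A) t :
  tensor_mult ((1 ⊗ x) * t) = tensor_mult (t * (x ⊗ 1)).
Proof.
elim/tensor_ind: t => [|y z t IHt]; first by rewrite mul0r mulr0.
by rewrite mulrDl mulrDr !tensor_multD IHt !tens_mul !tensor_mult_tens mul1r mulr1 mulrA.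
Qed.
End TensorMultTheory.

Lemma tensor_mult_map (k : fieldType) (A B : algType k)
    (f : {lrmorphism A -> B}) t :
  tensor_mult (tensor_map f f t) = f (tensor_mult t).
Proof.
elim/tensor_ind: t => [|x y t IHt].
  by rewrite tensor_map0 !tensor_mult0 rmorph0.
by rewrite tensor_mapD !tensor_multD IHt tensor_map_tens !tensor_mult_tens rmorphD rmorphM.
Qed.

(* Zorn's lemma, applied to the graphs of linear retractions defined on
   subspaces of W that contain the image of i. *)
Section Retraction.
Variables (k : fieldType) (V W : lmodType k) (i : {linear V -> W}).
Hypothesis i_inj : injective i.

Let graph (G : W * V -> Prop) :=
  [/\ forall a p q, G p -> G q -> G (a *: p + q),
      forall v, G (0, v) -> v = 0 & forall v, G (i v, v)].

Let graphs := {G : set (W * V) | graph G}.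
Let sub (G H : graphs) : bool := `[< forall p, sval G p -> sval H p >].

Let graph_range : graph (fun p => p.1 = i p.2).
Proof.
split=> [a p q /= -> ->|v /= /esym h|//]; first by rewrite linearP.
by apply: i_inj; rewrite h linear0.
Qed.

Let maximal_graph : exists G : graphs, forall H, sub G H -> H = G.
Proof.
apply: Zorn.
- by move=> G; apply/asboolP.
- by move=> G H K /asboolP h1 /asboolP h2; apply/asboolP => p /h1 /h2.
- move=> [G hG] [H hH] /asboolP /= h1 /asboolP /= h2; apply: eq_exist.
  by apply/seteqP; split.
(* The empty chain is bounded by the inverse of [i] on its range, any other chain by its union. *)
- move=> C Ctot; have [[G0 CG0]|C0] := pselect (exists G, C G); last first.
    exists (exist _ _ graph_range) => G CG; case: C0; by exists G.
  pose U : set (W * V) := fun p => exists2 G, C G & sval G p.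
  have hU : graph U.
    split=> [a p q [G CG Gp] [H CH Hq]|v [G CG Gv]|v].
    + have [/asboolP s|/asboolP s] := Ctot _ _ CG CH.
        by exists H => //; case: (svalP H) => h _ _; apply: h => //; apply: s.
      by exists G => //; case: (svalP G) => h _ _; apply: h => //; apply: s.
    + by case: (svalP G) => _ h _; apply: h.
    + by exists G0 => //; case: (svalP G0) => _ _; apply.
  by exists (exist _ U hU) => G CG; apply/asboolP => p Gp; exists G.
Qed.

Lemma linear_retraction : exists r : W -> V, linear r /\ cancel i r.
Proof.
have [[G hG] Gmax] := maximal_graph; have [Glin G0 Gi] := hG.
have Gtot w : exists v, G (w, v).
  (* If [w] were outside the domain, it could be sent to 0: [H] is the graph extended in this way,
     and maximality forces [H = G]. *)
  pose H : set (W * V) := fun p => exists a v, G (p.1 - a *: w, v) /\ p.2 = v.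
  have [//|nw] := pselect (exists v, G (w, v)).
  have G00 : G (0, 0) by have := Gi 0; rewrite linear0.
  have GZ a p : G p -> G (a *: p).
    by move=> Gp; have := Glin a p _ Gp G00; rewrite addr0.
  have hH : graph H.
    split.
    + move=> a [p1 p2] [q1 q2] [b [v [/= Gp ->]]] [c [u [/= Gq ->]]].
      exists (a * b + c), (a *: v + u); split=> //=.
      have := Glin a _ _ Gp Gq; congr G; congr (_, _) => /=.
      by rewrite scalerBr scalerA scalerDl opprD addrACA.
    (* A nonzero coefficient [a] would put [w] in the domain of [G]. *)
    + move=> v [a [u [/= Gu ->]]]; have [a0|a0] := eqVneq a 0.
        by apply: G0; rewrite a0 scale0r subr0 in Gu.
      case: nw; exists (- a^-1 *: u).
      have := GZ (- a^-1) _ Gu; congr G; congr (_, _) => /=.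
      by rewrite sub0r scaleNr scalerN opprK scalerA mulVf // scale1r.
    + by move=> v; exists 0, v; rewrite /= scale0r subr0.
  have sGH : sub (exist _ G hG) (exist _ H hH).
    by apply/asboolP => -[p1 p2] /= Gp; exists 0, p2; rewrite scale0r subr0.
  have /(congr1 sval) /= HG := Gmax _ sGH.
  exists 0; rewrite -HG /H; exists 1, 0; split => //=.
  by rewrite scale1r subrr.
have [r hr] := choice Gtot; have Gfun w v u : G (w, v) -> G (w, u) -> v = u.
  move=> h1 h2; apply/eqP; rewrite -subr_eq0; apply/eqP/G0.
  have := Glin (-1) _ _ h2 h1; congr G; congr (_, _) => /=.
    by rewrite scaleN1r addNr.
  by rewrite scaleN1r addrC.
exists r; split=> [a w w'|v].
  by apply: Gfun (hr _) _; apply: (Glin a _ _ (hr w) (hr w')).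
exact: Gfun (hr _) (Gi v).
Qed.

(** The tensor square of a retraction is a retraction. In (a), it identifies two preimages in R ⊗ R
    of one element of F ⊗ F. *)
Lemma tensor_map_inj : injective (tensor_map i i).
Proof.
have [r [rlin rK]] := linear_retraction.
pose lr := GRing.isLinear.Build k W V _ r rlin.
pose r' : {linear W -> V} := HB.pack r lr.
apply: (can_inj (g := tensor_map r' r')) => t.
elim/tensor_ind: t => [|x y t IHt]; first by rewrite !tensor_map0.
by rewrite !tensor_mapD IHt !tensor_map_tens /= !rK.
Qed.
End Retraction.

(** * Leibniz rules of a double bracket and of its bracket *)

Section DoubleBracketTheory.
Variables (k : fieldType) (A : algType k) (db : {bilinear A -> A -> tensor A A}).
Hypothesis hdb : double_bracket db.

Lemma db_mulr a b c : db a (b * c) = db a b * (1 ⊗ c) + (b ⊗ 1) * db a c.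
Proof. exact: double_bracket_leibniz. Qed.

Lemma db_skew a b : db b a = - tensor_swap (db a b).
Proof. exact: double_bracket_skew. Qed.

Lemma db_mull a b c : db (a * b) c = db a c * (b ⊗ 1) + (1 ⊗ a) * db b c.
Proof.
rewrite db_skew db_mulr tensor_swapD !tensor_swapM !tensor_swap_tens.
by rewrite (db_skew c a) (db_skew c b) mulNr mulrN opprD.
Qed.

Lemma db_1r a : db a 1 = 0.
Proof.
have := db_mulr a 1 1; rewrite !mulr1 mul1r => h.
by apply: (addrI (db a 1)); rewrite addr0 -h.
Qed.

Lemma db_1l a : db 1 a = 0.
Proof. by rewrite db_skew db_1r tensor_swap0 oppr0. Qed.

Lemma db_invr a x y : x * y = 1 -> y * x = 1 ->
  db a y = - ((y ⊗ 1) * db a x * (1 ⊗ y)).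
Proof.
move=> xy yx; have := db_1r a; rewrite -{1}xy db_mulr => /eqP.
rewrite addr_eq0 => /eqP h; rewrite -mulrA h mulrN opprK mulrA tens_mul yx.
by rewrite mulr1 mul1r.
Qed.

Lemma db_invl a x y : x * y = 1 -> y * x = 1 ->
  db y a = - ((1 ⊗ y) * db x a * (y ⊗ 1)).
Proof.
move=> xy yx; rewrite db_skew (db_invr a xy yx) tensor_swapN !tensor_swapM.
by rewrite !tensor_swap_tens (db_skew a x) mulrN mulNr opprK.
Qed.

Lemma bracketMr a b c : bracket db a (b * c) = bracket db a b * c + b * bracket db a c.
Proof.
by rewrite /bracket db_mulr tensor_multD tensor_mult_outerr tensor_mult_outerl.
Qed.

(** By [tensor_mult_inner], multiplication exchanges the two Leibniz terms. The equality is exact,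
    not only modulo commutators. *)
Lemma bracketMl_comm a b c : bracket db (a * b) c = bracket db (b * a) c.
Proof.
by rewrite /bracket !db_mull !tensor_multD !tensor_mult_inner addrC.
Qed.

Lemma bracket1r a : bracket db a 1 = 0.
Proof. by rewrite /bracket db_1r tensor_mult0. Qed.

(** By [bracketMl_comm] the first argument may be conjugated freely; in the second one, the
    derivation {u, -} sees g and h and leaves a commutator with v. It serves to move the base vertex
    of loops. *)
Lemma bracket_conj g h u v : g * h = 1 -> h * g = 1 ->
  g * bracket db (h * u * g) (h * v * g) * h
    = bracket db u v + ((g * bracket db u h) * v - v * (g * bracket db u h)).
Proof.
move=> gh hg; rewrite bracketMl_comm mulrA gh mul1r !bracketMr.
have gh0 : bracket db u g * h = - (g * bracket db u h).
  by apply/eqP; rewrite -addr_eq0 -bracketMr gh bracket1r.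
rewrite !(mulrDr, mulrDl) !mulrA gh !mul1r -!(mulrA _ g h) gh !mulr1.
by rewrite -(mulrA v) gh0 mulrN [in RHS]addrCA addrA mulrA.
Qed.
End DoubleBracketTheory.

(** * Correspondences between double brackets along the paths of a quiver *)

Section Lift.
Variables (k : fieldType) (A B : algType k).
Implicit Types P Q : A -> B -> Prop.

(** A relation, since it has to extend relations between elements, such as that of a path to its
    image, which are not known to be functions. *)
Inductive lifts P Q : tensor A A -> tensor B B -> Prop :=
| lifts0 : lifts P Q 0 0
| lifts_cons a a' b b' t t' of P a a' & Q b b' & lifts P Q t t' :
    lifts P Q (a ⊗ b + t) (a' ⊗ b' + t').

Lemma lifts_tens P Q a a' b b' : P a a' -> Q b b' -> lifts P Q (a ⊗ b) (a' ⊗ b').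
Proof.
move=> h1 h2; rewrite -[a ⊗ b]addr0 -[a' ⊗ b']addr0.
by apply: lifts_cons => //; apply: lifts0.
Qed.

Lemma liftsD P Q t t' u u' : lifts P Q t t' -> lifts P Q u u' -> lifts P Q (t + u) (t' + u').
Proof.
move=> + hu; elim=> [|a a' b b' {}t {}t' Pa Qb _ IH]; first by rewrite !add0r.
by rewrite -!addrA; apply: lifts_cons.
Qed.

Lemma lifts_mul P Q P' Q' c c' d d' t t' :
  (forall a a', P a a' -> P' (c * a) (c' * a')) ->
  (forall b b', Q b b' -> Q' (b * d) (b' * d')) ->
  lifts P Q t t' ->
  lifts P' Q' ((c ⊗ 1) * t * (1 ⊗ d)) ((c' ⊗ 1) * t' * (1 ⊗ d')).
Proof.
move=> hP hQ; elim=> [|a a' b b' {}t {}t' Pa Qb _ IH].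
  by rewrite !mulr0 !mul0r; apply: lifts0.
rewrite !mulrDr !mulrDl !tens_mul !mul1r !mulr1.
by apply: lifts_cons; auto.
Qed.

Lemma lifts_swap P Q t t' : lifts P Q t t' -> lifts Q P (tensor_swap t) (tensor_swap t').
Proof.
elim=> [|a a' b b' {}t {}t' Pa Qb _ IH]; first by rewrite !tensor_swap0; apply: lifts0.
by rewrite !tensor_swapD !tensor_swap_tens; apply: lifts_cons.
Qed.

Lemma liftsZ P Q (c : k) t t' : (forall a a', P a a' -> P (c *: a) (c *: a')) ->
  lifts P Q t t' -> lifts P Q (c *: t) (c *: t').
Proof.
move=> hP; elim=> [|a a' b b' {}t {}t' Pa Qb _ IH]; first by rewrite !scaler0; apply: lifts0.
by rewrite !scalerDr -!tensZl; apply: lifts_cons; auto.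
Qed.
End Lift.

(* A path carries an element x of A, the element x' of B corresponding to x,
   and the value at x, for each vertex, of a double derivation; only the
   elements satisfying ok are inverted.  Two paths are compatible if
   {{x', y'}} is the image of {{x, y}} up to a correction that is inner at the
   endpoints of the paths, so that it telescopes along composites and dies in
   B / [B, B] on loops. *)
Section Correspondence.
Variables (k : fieldType) (A A0 B B0 : algType k).
Variables (iA : {lrmorphism A -> A0}) (iB : {lrmorphism B -> B0}).
Variables (dbA : {bilinear A0 -> A0 -> tensor A0 A0}).
Variables (dbB : {bilinear B0 -> B0 -> tensor B0 B0}).
Hypotheses (hdbA : double_bracket dbA) (hdbB : double_bracket dbB).
Variables (V : Type).
Variables gen ok : V -> V -> A -> B -> (V -> tensor B B) -> Prop.

Inductive qpath : V -> V -> A -> B -> (V -> tensor B B) -> Prop :=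
| qpath_gen s t x x' r of gen s t x x' r : qpath s t x x' r
| qpath_1 s : qpath s s 1 1 (fun=> 0)
| qpath_lin s t a x x' r y y' q of qpath s t x x' r & qpath s t y y' q :
    qpath s t (a *: x + y) (a *: x' + y') (fun v => a *: r v + q v)
| qpath_mul s t u x x' r y y' q of qpath s t x x' r & qpath t u y y' q :
    qpath s u (x * y) (x' * y') (fun v => r v * (y' ⊗ 1) + (1 ⊗ x') * q v)
| qpath_inv s t x x' r y y' of qpath s t x x' r & ok s t x x' r
    & x * y = 1 & y * x = 1 & x' * y' = 1 & y' * x' = 1 :
    qpath t s y y' (fun v => - ((1 ⊗ y') * r v * (y' ⊗ 1))).

Definition joins s t x x' : Prop := exists r, qpath s t x x' r.

Lemma joinsM s t u x x' y y' :
  joins s t x x' -> joins t u y y' -> joins s u (x * y) (x' * y').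
Proof. by move=> [r h] [q h']; eexists; apply: qpath_mul h h'. Qed.

Lemma joins_lin s t a x x' y y' : joins s t x x' -> joins s t y y' ->
  joins s t (a *: x + y) (a *: x' + y').
Proof. by move=> [r h] [q h']; eexists; apply: qpath_lin h h'. Qed.

Lemma joinsZ s t a x x' : joins s t x x' -> joins s t (a *: x) (a *: x').
Proof.
move=> h; have := joins_lin (a - 1) h h.
by rewrite !scalerBl !scale1r !subrK.
Qed.

Lemma lifts_joins s t u v v' w w' : lifts (joins s t) (joins t u) w w' ->
  joins s u v v' -> joins s u (tensor_mult w) (tensor_mult w').
Proof.
move=> + hv; elim=> [|a a' b b' {}w {}w' ha hb _ IH].
  by rewrite !tensor_mult0; have := joinsZ 0 hv; rewrite !scale0r.
rewrite !tensor_multD !tensor_mult_tens -[a * b]scale1r -[a' * b']scale1r.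
exact: joins_lin (joinsM ha hb) IH.
Qed.

(** The first-order effect of a change of frame: if [r v] stands for {{x, g_v}} and [q v] for {{y,
    g_v}}, these are the terms that the Leibniz rules add to {{x, y}} when x becomes g_s^-1 x g_t
    and y becomes g_s'^-1 y g_t', taken at g = 1. *)
Definition inner (s t : V) (x : B) (r : V -> tensor B B)
    (s' t' : V) (y : B) (q : V -> tensor B B) : tensor B B :=
  (y ⊗ 1) * r t' - r s' * (1 ⊗ y)
    - (1 ⊗ x) * tensor_swap (q t) + tensor_swap (q s) * (x ⊗ 1).

(** By the Leibniz rules, the left factor of {{x, y}} starts as y and ends as x, the right factor
    starts as x and ends as y; this fixes the endpoints in [lifts]. *)
Definition compatible s t x x' r s' t' y y' q : Prop :=
  exists u u', [/\ lifts (joins s' t) (joins s t') u u',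
    dbA (iA x) (iA y) = tensor_map iA iA u
  & dbB (iB x') (iB y') = tensor_map iB iB (u' + inner s t x' r s' t' y' q)].

(** [inner] is itself skew: the exchange of factors swaps its terms in r with its terms in q. Hence
    it is enough to decompose the second path. *)
Lemma compatible_sym s t x x' r s' t' y y' q :
  compatible s t x x' r s' t' y y' q -> compatible s' t' y y' q s t x x' r.
Proof.
move=> [u [u' [hl h1 h2]]]; exists (- tensor_swap u), (- tensor_swap u'); split.
- rewrite -[- tensor_swap u]scaleN1r -[- tensor_swap u']scaleN1r.
  by apply: liftsZ (lifts_swap hl) => a a'; apply: joinsZ.
- by rewrite (db_skew hdbA) h1 tensor_swap_map tensor_mapN.
- rewrite (db_skew hdbB) h2 tensor_swap_map -tensor_mapN tensor_swapD opprD.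
  congr (tensor_map _ _ (_ + _)); rewrite /inner !tensor_swapD !tensor_swapN.
  rewrite !tensor_swapM !tensor_swapK !tensor_swap_tens !opprD !opprK.
  by rewrite -addrA addrC addrA.
Qed.

Section FixLeft.
Variables (s t : V) (x : A) (x' : B) (r : V -> tensor B B).
Let good s' t' y y' q := compatible s t x x' r s' t' y y' q.

Lemma compatible_1 v : good v v 1 1 (fun=> 0).
Proof.
exists 0, 0; split; first exact: lifts0.
  by rewrite rmorph1 (db_1r hdbA) tensor_map0.
have e : 1 ⊗ 1 = 1 :> tensor B B by [].
rewrite rmorph1 (db_1r hdbB) /inner tensor_swap0 mulr0 mul0r e.
by rewrite mul1r mulr1 subrr sub0r oppr0 !addr0 tensor_map0.
Qed.

Lemma compatible_lin s' t' a y y' q z z' p :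
  good s' t' y y' q -> good s' t' z z' p ->
  good s' t' (a *: y + z) (a *: y' + z') (fun v => a *: q v + p v).
Proof.
move=> [u [u' [hu u1 u2]]] [w [w' [hw w1 w2]]].
exists (a *: u + w), (a *: u' + w'); split.
- by apply: liftsD => //; apply: liftsZ hu => b b'; apply: joinsZ.
- by rewrite linearP linearPr tensor_mapD tensor_mapZ u1 w1.
- rewrite linearP linearPr u2 w2 -tensor_mapZ -tensor_mapD; congr tensor_map.
  rewrite scalerDr addrACA; congr (_ + _); rewrite /inner.
  rewrite tensDl tensDr tensZl tensZr !tensor_swapD !tensor_swapZ.
  rewrite !mulrDl !mulrDr !tens_scaleAl !tens_scaleAr !scalerDr !scalerN !opprD.
  rewrite addrACA; congr (_ + _); rewrite addrACA; congr (_ + _).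
  by rewrite addrACA.
Qed.

(** The corrections at the middle vertex telescope: (y' ⊗ 1) (r m) (1 ⊗ z') comes with sign + from y
    and with sign - from z. *)
Lemma compatible_mul s' m t' y y' q z z' p :
  joins s' m y y' -> joins m t' z z' ->
  good s' m y y' q -> good m t' z z' p ->
  good s' t' (y * z) (y' * z') (fun v => q v * (z' ⊗ 1) + (1 ⊗ y') * p v).
Proof.
move=> jy jz [u [u' [hu u1 u2]]] [w [w' [hw w1 w2]]].
exists (u * (1 ⊗ z) + (y ⊗ 1) * w), (u' * (1 ⊗ z') + (y' ⊗ 1) * w'); split.
- apply: liftsD.
    rewrite -[u]mul1r -[u']mul1r; apply: lifts_mul hu => b b' hb.
      by rewrite !mul1r.
    exact: joinsM hb jz.
  rewrite -[_ * w]mulr1 -[_ * w']mulr1; apply: lifts_mul hw => b b' hb.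
    exact: joinsM jy hb.
  by rewrite !mulr1.
- rewrite rmorphM (db_mulr hdbA) u1 w1 tensor_mapD !tensor_mapM.
  by rewrite !tensor_map_tens !rmorph1.
- rewrite rmorphM (db_mulr hdbB) u2 w2 -(rmorph1 iB) -!tensor_map_tens.
  rewrite -!tensor_mapM -tensor_mapD; congr tensor_map.
  rewrite mulrDl mulrDr addrACA; congr (_ + _).
  rewrite /inner !tensor_swapD !tensor_swapM !tensor_swap_tens.
  have e1 : (y' * z') ⊗ 1 = (y' ⊗ 1) * (z' ⊗ 1) :> tensor B B by rewrite tens_mul mulr1.
  have e2 : 1 ⊗ (y' * z') = (1 ⊗ y') * (1 ⊗ z') :> tensor B B by rewrite tens_mul mulr1.
  rewrite e1 e2 !(mulrDl, mulrDr, mulrN, mulNr) !mulrA tens_commr.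
  set Y := y' ⊗ 1; set Z := 1 ⊗ z'; set X := 1 ⊗ x'.
  have e3 : X * Y = Y * X by rewrite !tens_mul !mul1r !mulr1.
  rewrite !opprD e3 addrACA; congr (_ + _); rewrite addrACA; congr (_ + _).
  by rewrite addrC addrA subrK.
Qed.

(** Multiplying by z' on both sides cancels y' and exchanges the terms at the two endpoints, in
    accordance with the reversal of the path. *)
Lemma compatible_inv s' t' y y' q z z' :
  y * z = 1 -> z * y = 1 -> y' * z' = 1 -> z' * y' = 1 -> joins t' s' z z' ->
  good s' t' y y' q ->
  good t' s' z z' (fun v => - ((1 ⊗ z') * q v * (z' ⊗ 1))).
Proof.
move=> yz zy yz' zy' jz [u [u' [hu u1 u2]]].
exists (- ((z ⊗ 1) * u * (1 ⊗ z))), (- ((z' ⊗ 1) * u' * (1 ⊗ z'))); split.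
- rewrite -[X in lifts _ _ X]scaleN1r -[X in lifts _ _ _ X]scaleN1r.
  apply: liftsZ => [a a'|]; first exact: joinsZ.
  by apply: lifts_mul hu => b b' hb; [apply: joinsM jz hb|apply: joinsM hb jz].
- have e : iA y * iA z = 1 by rewrite -rmorphM yz rmorph1.
  have e' : iA z * iA y = 1 by rewrite -rmorphM zy rmorph1.
  by rewrite (db_invr hdbA _ e e') u1 tensor_mapN !tensor_mapM !tensor_map_tens !rmorph1.
- have e : iB y' * iB z' = 1 by rewrite -rmorphM yz' rmorph1.
  have e' : iB z' * iB y' = 1 by rewrite -rmorphM zy' rmorph1.
  rewrite (db_invr hdbB _ e e') u2 -{1 2}(rmorph1 iB) -!tensor_map_tens.
  rewrite -!tensor_mapM -tensor_mapN; congr tensor_map.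
  rewrite mulrDr mulrDl opprD; congr (_ + _).
  rewrite /inner !tensor_swapN !tensor_swapM !tensor_swap_tens.
  set a := r t'; set b := r s'; set c := tensor_swap (q t).
  set d := tensor_swap (q s).
  rewrite !(mulrDr, mulrDl, mulNr, mulrN) !opprD !opprK.
  have z1 : (z' ⊗ 1) * (y' ⊗ 1) = 1 :> tensor B B by rewrite tens_mul zy' mulr1.
  have z2 : (1 ⊗ y') * (1 ⊗ z') = 1 :> tensor B B by rewrite tens_mul yz' mulr1.
  have xz : (1 ⊗ x') * (z' ⊗ 1) = (z' ⊗ 1) * (1 ⊗ x') :> tensor B B.
    by rewrite !tens_mul !mul1r !mulr1.
  have xz' : (x' ⊗ 1) * (1 ⊗ z') = (1 ⊗ z') * (x' ⊗ 1) :> tensor B B.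
    by rewrite !tens_mul !mul1r !mulr1.
  rewrite !mulrA z1 mul1r -(mulrA _ (1 ⊗ y')) z2 mulr1 xz.
  rewrite -(mulrA _ (x' ⊗ 1)) xz' !mulrA.
  by congr (_ + _ - _); rewrite addrC.
Qed.
End FixLeft.

Hypothesis gen_compatible : forall s t x x' r s' t' y y' q,
  gen s t x x' r -> gen s' t' y y' q -> compatible s t x x' r s' t' y y' q.

Lemma qpath_compatible_right s t x x' r s' t' y y' q :
  (forall s0 t0 y0 y0' q0, gen s0 t0 y0 y0' q0 ->
     compatible s t x x' r s0 t0 y0 y0' q0) ->
  qpath s' t' y y' q -> compatible s t x x' r s' t' y y' q.
Proof.
move=> hg; elim=> {s' t' y y' q}.
- by move=> *; apply: hg.
- exact: compatible_1.
- by move=> s' t' a y y' q z z' p _ hy _ hz; apply: compatible_lin.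
- move=> s' m t' y y' q z z' p py hy pz hz.
  by apply: compatible_mul hy hz; [exists q|exists p].
- move=> s' t' y y' q z z' py hy oky yz zy yz' zy'.
  by apply: compatible_inv hy => //; eexists; apply: qpath_inv py oky _ _ _ _.
Qed.

Theorem qpath_compatible s t x x' r s' t' y y' q :
  qpath s t x x' r -> qpath s' t' y y' q -> compatible s t x x' r s' t' y y' q.
Proof.
move=> px py; apply: qpath_compatible_right py => s0 t0 y0 y0' q0 gy.
apply: compatible_sym; apply: qpath_compatible_right px => s1 t1 x1 x1' r1 gx.
exact: gen_compatible.
Qed.
End Correspondence.

(** For loops at one vertex, the two terms in q cancel by [tensor_mult_inner], and those in r form a
    commutator. *)
Lemma tensor_mult_inner_comm (k : fieldType) (B : algType k) (V : Type) (v : V)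
    (x y : B) (r q : V -> tensor B B) :
  tensor_mult (inner v v x r v v y q)
    = y * tensor_mult (r v) - tensor_mult (r v) * y.
Proof.
rewrite /inner !(tensor_multD, tensor_multN) tensor_mult_inner.
by rewrite subrK tensor_mult_outerl tensor_mult_outerr.
Qed.

(** * The square move at one index *)

(* In the notation of the paper, at a single index, p = d c, w is b~, and
   square_E, square_A, square_D are c~, the inverse of a~, and d~. *)
Section SquareMove.
Variables (k : fieldType) (A : algType k) (db : {bilinear A -> A -> tensor A A}).
Hypothesis hdb : double_bracket db.
Variable h : k.
Hypothesis h2 : h + h = 1.
Variables a b c d : A.
Hypotheses (ba : db b a = h *: (b ⊗ a)) (bc : db b c = h *: (c ⊗ b))
  (ad : db a d = h *: (1 ⊗ (a * d))) (cd : db c d = h *: ((d * c) ⊗ 1))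
  (ac : db a c = 0) (bd : db b d = 0)
  (aa : db a a = 0) (bb : db b b = 0) (cc : db c c = 0) (dd : db d d = 0).
Variable c' : A.
Hypotheses (cV : c * c' = 1) (cV' : c' * c = 1).

Let tnorm := (@tens_scaleAl, @tens_scaleAr, @tens_mul, @mulr1, @mul1r, @mulNr,
  @mulrN, @scalerN, @mulr0, @mul0r, @scaler0, @oppr0, @addr0, @add0r).

Let swapZ := (@tensor_swapN, @tensor_swapZ, @tensor_swap_tens, @tensor_swapD).

Let ab : db a b = - (h *: (a ⊗ b)).
Proof. by rewrite (db_skew hdb) ba !swapZ. Qed.
Let cb : db c b = - (h *: (b ⊗ c)).
Proof. by rewrite (db_skew hdb) bc !swapZ. Qed.
Let da : db d a = - (h *: ((a * d) ⊗ 1)).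
Proof. by rewrite (db_skew hdb) ad !swapZ. Qed.
Let dc : db d c = - (h *: (1 ⊗ (d * c))).
Proof. by rewrite (db_skew hdb) cd !swapZ. Qed.
Let ca : db c a = 0.
Proof. by rewrite (db_skew hdb) ac tensor_swap0 oppr0. Qed.
Let db_db : db d b = 0.
Proof. by rewrite (db_skew hdb) bd tensor_swap0 oppr0. Qed.

Local Notation p := (d * c).

Lemma square_pa : db p a = - (h *: ((a * p) ⊗ 1)).
Proof. by rewrite (db_mull hdb) da ca !tnorm mulrA. Qed.

Lemma square_pb : db p b = - (h *: (b ⊗ p)).
Proof. by rewrite (db_mull hdb) db_db cb !tnorm. Qed.

Lemma square_pd : db p d = h *: (p ⊗ d).
Proof. by rewrite (db_mull hdb) dd cd !tnorm. Qed.

Lemma square_pp : db p p = 0.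
Proof.
have pc : db p c = - (h *: (c ⊗ p)) by rewrite (db_mull hdb) dc cc !tnorm.
by rewrite (db_mulr hdb) square_pd pc !tnorm subrr.
Qed.

Lemma square_pc' : db p c' = h *: (1 ⊗ (p * c')).
Proof.
have pc : db p c = - (h *: (c ⊗ p)) by rewrite (db_mull hdb) dc cc !tnorm.
by rewrite (db_invr hdb _ cV cV') pc !tnorm opprK cV'.
Qed.

Lemma square_ac' : db a c' = 0.
Proof. by rewrite (db_invr hdb _ cV cV') ac !tnorm. Qed.

Lemma square_bc' : db b c' = - (h *: (1 ⊗ (b * c'))).
Proof. by rewrite (db_invr hdb _ cV cV') bc !tnorm cV'. Qed.

Lemma square_c'c' : db c' c' = 0.
Proof. by rewrite (db_invr hdb _ cV cV') (db_invl hdb _ cV cV') cc !tnorm. Qed.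

Variables w w' q : A.
Hypotheses (wE : w = b + a * d * c) (wV : w * w' = 1) (wV' : w' * w = 1).
Hypotheses (pV : p * q = 1) (pV' : q * p = 1).
Local Notation y := (a * d).

Let wEp : w = b + a * p. Proof. by rewrite wE mulrA. Qed.

Let hh (t : tensor A A) : h *: t + h *: t = t.
Proof. by rewrite -scalerDl h2 scale1r. Qed.

Let ap : db a p = h *: (1 ⊗ (a * p)).
Proof. by rewrite (db_skew hdb) square_pa !swapZ opprK. Qed.

Let pw : db p w = - (h *: (w ⊗ p)).
Proof.
rewrite wEp linearDr square_pb (db_mulr hdb) square_pa square_pp !tnorm.
by rewrite tensDl scalerDr opprD.
Qed.

Let wp : db w p = h *: (p ⊗ w).
Proof. by rewrite (db_skew hdb) pw !swapZ opprK. Qed.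

Let py : db p y = 0.
Proof. by rewrite (db_mulr hdb) square_pa square_pd !tnorm mulrA addNr. Qed.

Let wa : db w a = h *: (w ⊗ a) - (a * p) ⊗ a.
Proof.
rewrite wEp linearDl ba (db_mull hdb) aa square_pa !tnorm.
by rewrite tensDl scalerDr -[X in _ = _ - X]hh opprD addrA addrK.
Qed.

Let wd : db w d = p ⊗ y.
Proof.
by rewrite wEp linearDl bd (db_mull hdb) ad square_pd !tnorm hh.
Qed.

Let wy : db w y = h *: (w ⊗ y).
Proof.
by rewrite (db_mulr hdb) wa wd mulrDl !tnorm subrK.
Qed.

Let yd : db y d = h *: (d ⊗ y).
Proof. by rewrite (db_mull hdb) ad dd !tnorm. Qed.

Let yy : db y y = 0.
Proof.
have ya : db y a = - (h *: (y ⊗ a)) by rewrite (db_mull hdb) da aa !tnorm.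
by rewrite (db_mulr hdb) ya yd !tnorm addNr.
Qed.

Let ww : db w w = 0.
Proof.
rewrite {2}wEp linearDr (db_mulr hdb) wa wp.
have wb : db w b = - (h *: ((a * p) ⊗ b)) - h *: (b ⊗ (a * p)).
  by rewrite wEp linearDl bb (db_mull hdb) ab square_pb !tnorm.
rewrite wb mulrDl !tnorm wEp tensDl tensDr !scalerDr.
(* The term of weight 1 is split into two halves, so that all atoms have weight [h]. *)
rewrite -[X in _ + (_ - X + _)]hh.
zmod_solve.
Qed.

Let pw' : db p w' = h *: (1 ⊗ (p * w')).
Proof. by rewrite (db_invr hdb _ wV wV') pw !tnorm opprK wV'. Qed.

Definition square_E := w' * y.
Definition square_A := w * q.
Definition square_D := d - p * square_E.
Local Notation E := square_E.
Local Notation B := square_A.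
Local Notation D := square_D.

Let wEy : w * E = y. Proof. by rewrite mulrA wV mul1r. Qed.
Let BpE : B * p = w. Proof. by rewrite -mulrA pV' mulr1. Qed.

(** p brackets with E and a~^-1 just as with c^-1 and a, in line with the absence of a correction on
    the arcs a. With D the pattern is p ⊗ D, against b ⊗ p for b: this is what the corrections
    repair. *)
Lemma square_pE : db p E = h *: (1 ⊗ (p * E)).
Proof. by rewrite (db_mulr hdb) py pw' !tnorm -mulrA. Qed.

Let Ep : db E p = - (h *: ((p * E) ⊗ 1)).
Proof. by rewrite (db_skew hdb) square_pE !swapZ. Qed.

Let wEb : db w E = h *: (1 ⊗ y).
Proof.
by rewrite (db_mulr hdb) wy (db_invr hdb _ wV wV') ww !tnorm wV'.
Qed.

Lemma square_EE : db E E = 0.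
Proof.
have yE : db y E = h *: (E ⊗ y).
  rewrite (db_mulr hdb) yy (db_invr hdb _ wV wV') (db_skew hdb w y) wy !swapZ.
  by rewrite !tnorm opprK -mulrA -/E wEy.
rewrite /E (db_mull hdb) -/E yE (db_invl hdb _ wV wV') wEb !tnorm.
by rewrite -/E addNr.
Qed.

Lemma square_pA : db p B = - (h *: ((B * p) ⊗ 1)).
Proof.
by rewrite (db_mulr hdb) pw (db_invr hdb _ pV pV') square_pp !tnorm pV BpE.
Qed.

Let Bp : db B p = h *: (1 ⊗ (B * p)).
Proof. by rewrite (db_skew hdb) square_pA !swapZ opprK. Qed.

Lemma square_AE : db B E = 0.
Proof.
rewrite (db_mull hdb) wEb (db_invl hdb _ pV pV') square_pE !tnorm.
by rewrite [q * (p * E)]mulrA pV' mul1r wEy subrr.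
Qed.

Lemma square_AA : db B B = 0.
Proof.
have wB : db w B = - (h *: (w ⊗ B)).
  by rewrite (db_mulr hdb) ww (db_invr hdb _ pV pV') wp !tnorm pV' mulr1.
rewrite {1}/B (db_mull hdb) wB (db_invl hdb _ pV pV') square_pA !tnorm opprK.
by rewrite BpE -/B addNr.
Qed.

Lemma square_pD : db p D = h *: (p ⊗ D).
Proof.
rewrite linearBr square_pd (db_mulr hdb) square_pp square_pE !tnorm.
by rewrite tensDr tensNr scalerBr.
Qed.

Let Ed : db E d = h *: (d ⊗ E) - (p * E) ⊗ E.
Proof.
rewrite (db_mull hdb) yd (db_invl hdb _ wV wV') wd !tnorm -/E.
by rewrite -mulrA -/E addrC.
Qed.

Lemma square_ED : db E D = h *: (D ⊗ E).
Proof.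
rewrite linearBr (db_mulr hdb) square_EE Ep Ed !tnorm opprK.
rewrite tensDl tensNl scalerBr -[X in _ - X + _]hh; zmod_solve.
Qed.

Lemma square_AD : db B D = - (h *: (1 ⊗ (B * D))).
Proof.
rewrite linearBr (db_mulr hdb) square_AE Bp !tnorm.
rewrite (db_mull hdb) wd (db_invl hdb _ pV pV') square_pd !tnorm.
rewrite pV [w * (q * d)]mulrA -/B BpE wEy mulrBr mulrA BpE wEy.
rewrite tensDr tensNr scalerBr -[X in X + _ - _]hh; zmod_solve.
Qed.

Lemma square_DD : db D D = 0.
Proof.
have dE : db d E = E ⊗ (p * E) - h *: (E ⊗ d).
  by rewrite (db_skew hdb) Ed !swapZ opprB.
have dp : db d p = - (h *: (d ⊗ p)) by rewrite (db_skew hdb) square_pd !swapZ.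
rewrite {1}/D linearBl linearBr dd (db_mulr hdb) dp dE (db_mull hdb p).
rewrite square_pD square_ED mulrBr !tnorm !(tensDl, tensDr, tensNl, tensNr).
rewrite !(scalerBr, scalerDr, scalerN) -[X in - (_ + (X - _))]hh.
zmod_solve.
Qed.
End SquareMove.

(** * Brackets of the variables at all pairs of indices *)

(** By the Leibniz rules, the elements whose bracket with a given element is 0 are closed under all
    skew field operations. *)
Lemma skew_span_db0 (k : fieldType) (F : unitAlgType k)
    (db : {bilinear F -> F -> tensor F F}) (I J : Type) (u : I -> F) (v : J -> F) x y :
  double_bracket db -> (forall i j, db (u i) (v j) = 0) ->
  skew_span u x -> skew_span v y -> db x y = 0.
Proof.
move=> hdb uv hx hy.
have {}hx j : db x (v j) = 0.
  elim: hx => {x} [//||a x y' _ hx _ hy'|x y' _ hx _ hy'|x _ hx].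
  - exact: db_1l.
  - by rewrite linearPl hx hy' scaler0 addr0.
  - by rewrite (db_mull hdb) hx hy' mul0r mulr0 addr0.
  (* The inverse of a non-unit is, by convention, the element itself. *)
  - have [xU|xU] := boolP (x \is a GRing.unit); last by rewrite invr_out.
    rewrite (db_invl hdb _ (divrr xU) (mulVr xU)) hx.
    by rewrite mulr0 mul0r oppr0.
elim: hy => {y} [//||a y z _ hy _ hz|y z _ hy _ hz|y _ hy].
- exact: db_1r.
- by rewrite linearPr hy hz scaler0 addr0.
- by rewrite (db_mulr hdb) hy hz mul0r mulr0 addr0.
- have [yU|yU] := boolP (y \is a GRing.unit); last by rewrite invr_out.
  rewrite (db_invr hdb _ (divrr yU) (mulVr yU)) hy.
  by rewrite mulr0 mul0r oppr0.
Qed.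

Section IndexMod.
Variables (n : nat) (n_gt0 : (0 < n)%N).
Local Notation idx := (index_mod n_gt0).

Lemma index_mod_eq i j : (idx i == idx j) = (n%:Z %| i - j)%Z.
Proof.
have n0 : n%:Z != 0 by rewrite -lt0n.
rewrite -val_eqE /= -(inj_eq (can_inj absz_nat)) !gez0_abs ?modz_ge0 //.
by rewrite eqz_mod_dvd; congr (_ %| _)%Z; ring.
Qed.

Lemma index_mod_dvd i j z : (n%:Z %| z)%Z -> i - j = z -> idx i = idx j.
Proof. by move=> h e; apply/eqP; rewrite index_mod_eq e. Qed.

Lemma index_mod_ord (o : 'I_n) : idx o.+1%:Z = o.
Proof.
apply: val_inj; rewrite /= intS addrC addKr modz_nat.
by rewrite modn_small.
Qed.

Lemma index_repK i : idx (index_rep n_gt0 i)%:Z = idx i.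
Proof. exact: index_mod_ord. Qed.
End IndexMod.

Section Letters.
Variables (n : nat) (F : unitAlgType rat) (g : letter * 'I_n -> F).
Variable db : {bilinear F -> F -> tensor F F}.
Hypotheses (hdb : double_bracket db) (hgen : pent_bracket_gens g db).
Implicit Types o : 'I_n.

Local Notation a o := (g (La, o)).
Local Notation b o := (g (Lb, o)).
Local Notation c o := (g (Lc, o)).
Local Notation d o := (g (Ld, o)).

Definition vp o : F := d o * c o.
Definition vw o : F := b o + a o * d o * c o.
Definition vE o : F := (vw o)^-1 * (a o * d o).
Definition vA o : F := vw o * (vp o)^-1.
Definition vD o : F := d o - vp o * vE o.
Definition vC o : F := (c o)^-1.

Hypotheses (gU : forall l, g l \is a GRing.unit)
  (wU : forall o, vw o \is a GRing.unit).

Let pU o : vp o \is a GRing.unit. Proof. by rewrite unitrMl. Qed.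

Definition half_delta o o' : rat := if o == o' then 2^-1 else 0.
Local Notation dd := half_delta.

Lemma half_deltaC o o' : dd o o' = dd o' o.
Proof. by rewrite /dd eq_sym. Qed.

Definition local o : F -> Prop := skew_span (fun l => g (l, o)).

Lemma localM o x y : local o x -> local o y -> local o (x * y).
Proof. exact: skew_span_mul. Qed.
Lemma localD o x y : local o x -> local o y -> local o (x + y).
Proof. by move=> hx hy; have := skew_span_lin 1 hx hy; rewrite scale1r. Qed.
Lemma localV o x : local o x -> local o x^-1.
Proof. exact: skew_span_inv. Qed.
Lemma localB o x y : local o x -> local o y -> local o (x - y).
Proof. by move=> hx hy; have := skew_span_lin (-1) hy hx; rewrite scaleN1r addrC. Qed.
Lemma local_g l o : local o (g (l, o)).
Proof. exact: (skew_span_gen (fun l => g (l, o))). Qed.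

Lemma local_p o : local o (vp o).
Proof. by apply: localM; apply: local_g. Qed.
Lemma local_w o : local o (vw o).
Proof. by apply: localD; [|apply: localM; [apply: localM|]]; apply: local_g. Qed.
Lemma local_E o : local o (vE o).
Proof.
apply: localM; first exact/localV/local_w.
by apply: localM; apply: local_g.
Qed.
Lemma local_A o : local o (vA o).
Proof. by apply: localM; [apply: local_w|apply/localV/local_p]. Qed.
Lemma local_D o : local o (vD o).
Proof.
apply: localB; first exact: local_g.
by apply: localM; [apply: local_p|apply: local_E].
Qed.
Lemma local_C o : local o (vC o).
Proof. exact/localV/local_g. Qed.

Lemma letter_db0 o o' x y : o != o' -> local o x -> local o' y -> db x y = 0.
Proof.
move=> ne; apply: skew_span_db0 => // l l'.
case: hgen => _ h1 h2 h3.
have ne' : o' != o by rewrite eq_sym.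
have [h11 h12 h13 h14] := h1 _ _ ne; have [h11' h12' h13' h14'] := h1 _ _ ne'.
have [h21 h22] := h2 o o'; have [h21' h22'] := h2 o' o.
have [h31 h32 h33 h34] := h3 o o'.
by case: l; case: l' => //=; rewrite (double_bracket_skew hdb)
  ?(h11', h12', h13', h14', h21', h22') tensor_swap0 oppr0.
Qed.

(** Distinct indices bracket to 0, so the square move at one index gives the whole table. *)
Lemma letter_table (x y : 'I_n -> F) (f : 'I_n -> 'I_n -> tensor F F) :
  (forall o, local o (x o)) -> (forall o, local o (y o)) ->
  (forall o, db (x o) (y o) = 2^-1 *: f o o) ->
  forall o o', db (x o) (y o') = dd o o' *: f o o'.
Proof.
move=> hx hy h o o'; rewrite /dd; case: eqP => [<-|/eqP ne] //.
by rewrite scale0r; apply: letter_db0 (hx o) (hy o').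
Qed.

Lemma letter_table0 (x y : 'I_n -> F) :
  (forall o, local o (x o)) -> (forall o, local o (y o)) ->
  (forall o, db (x o) (y o) = 0) -> forall o o', db (x o) (y o') = 0.
Proof.
move=> hx hy h o o'.
have := @letter_table x y (fun _ _ => 0) hx hy.
by rewrite scaler0 => ->; rewrite ?scaler0.
Qed.
Let halves : 2^-1 + 2^-1 = 1 :> rat. Proof. by []. Qed.

Ltac by_square lem :=
  let o := fresh "o" in
  move=> o; case: (hgen) => /(_ o) [hba hbc had hcd] _ /(_ o o) [hac hbd]
    /(_ o o) [haa hbb hcc hdd]; rewrite ?scalerN; apply: lem;
  first [exact: hdb | exact: halves | eassumption | exact: mulVr (gU _) | exact: divrr (gU _)
    | exact: mulVr (wU _) | exact: divrr (wU _) | exact: mulVr (pU _)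
    | exact: divrr (pU _) | reflexivity].

Lemma letter_pp o o' : db (vp o) (vp o') = 0.
Proof.
move: o o'; apply: letter_table0; [exact: local_p|exact: local_p|].
by_square square_pp.
Qed.

Lemma letter_pa o o' : db (vp o) (a o') = - (dd o o' *: ((a o' * vp o) ⊗ 1)).
Proof.
rewrite -scalerN; move: o o'; apply: letter_table; [exact: local_p|move=> o; exact: local_g|].
by_square square_pa.
Qed.

Lemma letter_pb o o' : db (vp o) (b o') = - (dd o o' *: (b o' ⊗ vp o)).
Proof.
rewrite -scalerN; move: o o'; apply: letter_table; [exact: local_p|move=> o; exact: local_g|].
by_square square_pb.
Qed.

Lemma letter_pC o o' : db (vp o) (vC o') = dd o o' *: (1 ⊗ (vp o * vC o')).
Proof.
move: o o'; apply: letter_table; [exact: local_p|exact: local_C|].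
by_square square_pc'.
Qed.

Lemma letter_aa o o' : db (a o) (a o') = 0.
Proof.
move: o o'; apply: letter_table0; [move=> o; exact: local_g|move=> o; exact: local_g|].
by move=> o; case: hgen => _ _ _ /(_ o o) [].
Qed.

Lemma letter_aC o o' : db (a o) (vC o') = 0.
Proof.
move: o o'; apply: letter_table0; [move=> o; exact: local_g|exact: local_C|].
move=> o; apply: (square_ac' hdb _ (divrr (gU (Lc, o))) (mulVr (gU (Lc, o)))).
by case: hgen => _ _ /(_ o o) [].
Qed.

Lemma letter_ba o o' : db (b o) (a o') = dd o o' *: (b o ⊗ a o').
Proof.
move: o o'; apply: letter_table; [move=> o; exact: local_g|move=> o; exact: local_g|].
by move=> o; case: hgen => /(_ o) [].
Qed.

Lemma letter_bC o o' : db (b o) (vC o') = - (dd o o' *: (1 ⊗ (b o * vC o'))).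
Proof.
rewrite -scalerN; move: o o'; apply: letter_table; [move=> o; exact: local_g|exact: local_C|].
by_square square_bc'.
Qed.

Lemma letter_bb o o' : db (b o) (b o') = 0.
Proof.
move: o o'; apply: letter_table0; [move=> o; exact: local_g|move=> o; exact: local_g|].
by move=> o; case: hgen => _ _ _ /(_ o o) [].
Qed.

Lemma letter_CC o o' : db (vC o) (vC o') = 0.
Proof.
move: o o'; apply: letter_table0; [exact: local_C|exact: local_C|].
move=> o; apply: (square_c'c' hdb _ (divrr (gU (Lc, o))) (mulVr (gU (Lc, o)))).
by case: hgen => _ _ _ /(_ o o) [].
Qed.

Lemma letter_pE o o' : db (vp o) (vE o') = dd o o' *: (1 ⊗ (vp o * vE o')).
Proof.
move: o o'; apply: letter_table; [exact: local_p|exact: local_E|].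
by_square square_pE.
Qed.

Lemma letter_pA o o' : db (vp o) (vA o') = - (dd o o' *: ((vA o' * vp o) ⊗ 1)).
Proof.
rewrite -scalerN; move: o o'; apply: letter_table; [exact: local_p|exact: local_A|].
by_square square_pA.
Qed.

Lemma letter_pD o o' : db (vp o) (vD o') = dd o o' *: (vp o ⊗ vD o').
Proof.
move: o o'; apply: letter_table; [exact: local_p|exact: local_D|].
by_square square_pD.
Qed.

Lemma letter_EE o o' : db (vE o) (vE o') = 0.
Proof.
move: o o'; apply: letter_table0; [exact: local_E|exact: local_E|].
by_square square_EE.
Qed.

Lemma letter_AE o o' : db (vA o) (vE o') = 0.
Proof.
move: o o'; apply: letter_table0; [exact: local_A|exact: local_E|].
by_square square_AE.
Qed.

Lemma letter_AA o o' : db (vA o) (vA o') = 0.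
Proof.
move: o o'; apply: letter_table0; [exact: local_A|exact: local_A|].
by_square square_AA.
Qed.

Lemma letter_ED o o' : db (vE o) (vD o') = dd o o' *: (vD o' ⊗ vE o).
Proof.
move: o o'; apply: letter_table; [exact: local_E|exact: local_D|].
by_square square_ED.
Qed.

Lemma letter_AD o o' : db (vA o) (vD o') = - (dd o o' *: (1 ⊗ (vA o * vD o'))).
Proof.
rewrite -scalerN; move: o o'; apply: letter_table; [exact: local_A|exact: local_D|].
by_square square_AD.
Qed.

Lemma letter_DD o o' : db (vD o) (vD o') = 0.
Proof.
move: o o'; apply: letter_table0; [exact: local_D|exact: local_D|].
by_square square_DD.
Qed.
Lemma letter_Ca o o' : db (vC o) (a o') = 0.
Proof. by rewrite (db_skew hdb) letter_aC tensor_swap0 oppr0. Qed.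

Lemma letter_ab o o' : db (a o) (b o') = - (dd o o' *: (a o ⊗ b o')).
Proof.
by rewrite (db_skew hdb) letter_ba tensor_swapZ tensor_swap_tens half_deltaC.
Qed.

Lemma letter_Cb o o' : db (vC o) (b o') = dd o o' *: ((b o' * vC o) ⊗ 1).
Proof.
rewrite (db_skew hdb) letter_bC tensor_swapN tensor_swapZ tensor_swap_tens.
by rewrite opprK half_deltaC.
Qed.

Lemma letter_EA o o' : db (vE o) (vA o') = 0.
Proof. by rewrite (db_skew hdb) letter_AE tensor_swap0 oppr0. Qed.

Lemma letter_DA o o' : db (vD o) (vA o') = dd o o' *: ((vA o' * vD o) ⊗ 1).
Proof.
rewrite (db_skew hdb) letter_AD tensor_swapN tensor_swapZ tensor_swap_tens.
by rewrite opprK half_deltaC.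
Qed.
End Letters.

(** * Brackets of the arcs and of their images *)

Ltac tens_norm := rewrite ?(tens_scaleAl, tens_scaleAr, tens_mul, mulr1, mul1r,
  mulNr, mulrN, scalerN, mulr0, mul0r, scaler0, oppr0, addr0, add0r, opprK).

(* With vertices modulo n, arc_p i joins i - 1 to i, arc_a i joins i - 2 to
   i - 1, and arc_b i joins i - 2 to i; closing arc_a i and arc_b i up to loops
   along the arc_p j gives X_i and Y_i.  The primed arcs are their images under
   the pentagram map, which fixes arc_p i. *)
Section Arcs.
Variables (n : nat) (n_gt0 : (0 < n)%N).
Variables (F : unitAlgType rat) (g : letter * 'I_n -> F).
Variable db : {bilinear F -> F -> tensor F F}.
Hypotheses (hdb : double_bracket db) (hgen : pent_bracket_gens g db).
Hypotheses (gU : forall l, g l \is a GRing.unit)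
  (wU : forall o, vw g o \is a GRing.unit).
Local Notation idx := (index_mod n_gt0).

Definition arc_p (i : int) : F := vp g (idx i).
Definition arc_a (i : int) : F := vC g (idx (i - 2)) * g (La, idx i).
Definition arc_b (i : int) : F := vC g (idx (i - 2)) * g (Lb, idx i).
Definition arc_a' (i : int) : F := vE g (idx (i - 2)) * vA g (idx i).
Definition arc_b' (i : int) : F := vD g (idx (i - 1)) * vA g (idx (i + 1)).

(** Vertices are compared modulo n, and for n = 1 or 2 the residues of i - 2, i - 1 and i are not
    all distinct. Keeping the coefficients symbolic avoids any case distinction on n. *)
Definition dl (z : int) : rat := if (n%:Z %| z)%Z then 2^-1 else 0.

Lemma half_delta_idx i j : half_delta (idx i) (idx j) = dl (i - j).
Proof. by rewrite /half_delta index_mod_eq. Qed.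

Lemma dlN z : dl (- z) = dl z.
Proof. by rewrite /dl !dvdzE abszN. Qed.

(** Indices congruent modulo n may be identified under the coefficient [dl z], which vanishes unless
    n divides z. *)
Lemma dl_scale (V : lmodType rat) z (t u : V) :
  ((n%:Z %| z)%Z -> t = u) -> dl z *: t = dl z *: u.
Proof. by rewrite /dl; case: ifP => [_ -> //|_ _]; rewrite !scale0r. Qed.

Lemma db_arc_pp i j : db (arc_p i) (arc_p j) = 0.
Proof. exact: letter_pp. Qed.

Lemma db_arc_pa i j : db (arc_p i) (arc_a j) =
  dl (i - j + 2) *: (1 ⊗ (arc_p i * arc_a j)) - dl (i - j) *: ((arc_a j * arc_p i) ⊗ 1).
Proof.
rewrite /arc_p /arc_a /arc_b /arc_a' /arc_b'.
rewrite (db_mulr hdb) letter_pC // letter_pa // !half_delta_idx; tens_norm.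
by rewrite !mulrA; congr (dl _ *: _ - _); ring.
Qed.

Lemma db_arc_pb i j : db (arc_p i) (arc_b j) =
  dl (i - j + 2) *: (1 ⊗ (arc_p i * arc_b j)) - dl (i - j) *: (arc_b j ⊗ arc_p i).
Proof.
rewrite /arc_p /arc_a /arc_b /arc_a' /arc_b'.
rewrite (db_mulr hdb) letter_pC // letter_pb // !half_delta_idx; tens_norm.
by rewrite !mulrA; congr (dl _ *: _ - _); ring.
Qed.

Lemma db_arc_aa i j : db (arc_a i) (arc_a j) = 0.
Proof.
rewrite /arc_p /arc_a /arc_b /arc_a' /arc_b'.
rewrite (db_mulr hdb) !(db_mull hdb) letter_CC // letter_aC // letter_Ca //.
by rewrite letter_aa //; tens_norm.
Qed.

Lemma db_arc_ab i j : db (arc_a i) (arc_b j) =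
  dl (i - j - 2) *: ((arc_b j * arc_a i) ⊗ 1) - dl (i - j) *: (arc_a i ⊗ arc_b j).
Proof.
rewrite /arc_p /arc_a /arc_b /arc_a' /arc_b'.
rewrite (db_mulr hdb) !(db_mull hdb) letter_CC // letter_aC // letter_Cb //.
rewrite letter_ab // !half_delta_idx mulrDr; tens_norm.
rewrite !mulrA; congr (dl _ *: _ - _); first by ring.
apply: dl_scale => h.
by rewrite (@index_mod_dvd _ n_gt0 (i - 2) (j - 2) _ h) //; ring.
Qed.

Lemma db_arc_bb i j : db (arc_b i) (arc_b j) =
  dl (i - j - 2) *: ((arc_b j * arc_b i) ⊗ 1)
    - dl (i - j + 2) *: (1 ⊗ (arc_b i * arc_b j)).
Proof.
rewrite /arc_p /arc_a /arc_b /arc_a' /arc_b'.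
rewrite (db_mulr hdb) !(db_mull hdb) letter_CC // letter_bC // letter_Cb //.
rewrite letter_bb // !half_delta_idx; tens_norm.
rewrite !mulrA addrC; congr (dl _ *: _ - dl _ *: _); ring.
Qed.

Lemma db_arc_pa' i j : db (arc_p i) (arc_a' j) =
  dl (i - j + 2) *: (1 ⊗ (arc_p i * arc_a' j))
    - dl (i - j) *: ((arc_a' j * arc_p i) ⊗ 1).
Proof.
rewrite /arc_p /arc_a /arc_b /arc_a' /arc_b'.
rewrite (db_mulr hdb) letter_pE // letter_pA // !half_delta_idx; tens_norm.
by rewrite !mulrA; congr (dl _ *: _ - _); ring.
Qed.

Lemma db_arc_pb' i j : db (arc_p i) (arc_b' j) =
  dl (i - j + 1) *: (arc_p i ⊗ arc_b' j)
    - dl (i - j - 1) *: ((arc_b' j * arc_p i) ⊗ 1).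
Proof.
rewrite /arc_p /arc_a /arc_b /arc_a' /arc_b'.
rewrite (db_mulr hdb) letter_pD // letter_pA // !half_delta_idx; tens_norm.
by rewrite !mulrA; congr (dl _ *: _ - dl _ *: _); ring.
Qed.

Lemma db_arc_aa' i j : db (arc_a' i) (arc_a' j) = 0.
Proof.
rewrite /arc_p /arc_a /arc_b /arc_a' /arc_b'.
rewrite (db_mulr hdb) !(db_mull hdb (vE _ _)) letter_EE // letter_AE // letter_EA //.
by rewrite letter_AA //; tens_norm.
Qed.

Lemma db_arc_ab' i j : db (arc_a' i) (arc_b' j) =
  dl (i - j - 1) *: (arc_b' j ⊗ arc_a' i)
    - dl (i - j + 1) *: (1 ⊗ (arc_a' i * arc_b' j)).
Proof.
rewrite /arc_p /arc_a /arc_b /arc_a' /arc_b'.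
rewrite (db_mulr hdb) !(db_mull hdb (vE _ _)) letter_ED // letter_AD // letter_EA //.
rewrite letter_AA // !half_delta_idx mulrDl; tens_norm.
have -> : i - 2 - (j - 1) = i - j - 1 by ring.
have -> : i - (j - 1) = i - j + 1 by ring.
congr (_ - _); last by rewrite !mulrA.
apply: dl_scale => h; rewrite (@index_mod_dvd _ n_gt0 i (j + 1) _ h) //; ring.
Qed.

Lemma db_arc_bb' i j : db (arc_b' i) (arc_b' j) =
  dl (i - j - 2) *: ((arc_b' j * arc_b' i) ⊗ 1)
    - dl (i - j + 2) *: (1 ⊗ (arc_b' i * arc_b' j)).
Proof.
rewrite /arc_p /arc_a /arc_b /arc_a' /arc_b'.
rewrite (db_mulr hdb) !(db_mull hdb (vD _ _)) letter_DD // letter_AD // letter_DA //.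
rewrite letter_AA // !half_delta_idx; tens_norm.
rewrite !mulrA addrC; congr (dl _ *: _ - dl _ *: _); ring.
Qed.
End Arcs.

(** * The arcs and their images are compatible *)

Section ArcCorrespondence.
Variables (n : nat) (n_gt0 : (0 < n)%N).
Variables (F : unitAlgType rat) (g : letter * 'I_n -> F).
Variable db : {bilinear F -> F -> tensor F F}.
Hypotheses (hdb : double_bracket db) (hgen : pent_bracket_gens g db).
Hypotheses (gU : forall l, g l \is a GRing.unit)
  (wU : forall o, vw g o \is a GRing.unit).
Variables (B : algType rat) (iB : {lrmorphism B -> F}).
Variable m : int.
Implicit Types i j : int.
Local Notation idx := (index_mod n_gt0).
Local Notation dl := (dl n).
Local Notation ap := (arc_p n_gt0 g).
Local Notation aa := (arc_a n_gt0 g).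
Local Notation ab := (arc_b n_gt0 g).

Variables img_p img_a img_b : int -> B.
Hypotheses (img_pE : forall i, iB (img_p i) = ap (i + m))
  (img_aE : forall i, iB (img_a i) = arc_a' n_gt0 g (i + m))
  (img_bE : forall i, iB (img_b i) = arc_b' n_gt0 g (i + m)).

(** Only the arcs b carry a correction, located at their source and target. In [compatible_pb] and
    [compatible_ab] its inner term cancels the image of the bracket entirely and supplies the
    bracket of the images. *)
Inductive arc_gen : 'I_n -> 'I_n -> F -> B -> ('I_n -> tensor B B) -> Prop :=
| arc_gen_p i : arc_gen (idx (i - 1)) (idx i) (ap i) (img_p i) (fun=> 0)
| arc_gen_a i : arc_gen (idx (i - 2)) (idx (i - 1)) (aa i) (img_a i) (fun=> 0)
| arc_gen_b i : arc_gen (idx (i - 2)) (idx i) (ab i) (img_b i)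
    (fun v => half_delta v (idx (i - 2)) *: (img_b i ⊗ 1)
              - half_delta v (idx i) *: (1 ⊗ img_b i)).

Let iA : {lrmorphism F -> F} := idfun.

Local Notation qpath := (qpath arc_gen arc_gen).
Local Notation joins := (joins arc_gen arc_gen).
Local Notation compatible := (compatible iA iB db db arc_gen arc_gen).

Lemma lifts_dl s t s' t' z a a' b b' :
  ((n%:Z %| z)%Z -> joins s t a a' /\ joins s' t' b b') ->
  lifts (joins s t) (joins s' t') (dl z *: (a ⊗ b)) (dl z *: (a' ⊗ b')).
Proof.
rewrite /dl; case: ifP => [_ [//|ha hb]|_ _]; last by rewrite !scale0r; apply: lifts0.
by apply: liftsZ (lifts_tens ha hb) => x x'; apply: joinsZ.
Qed.

Lemma lifts_dlN s t s' t' z a a' b b' :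
  ((n%:Z %| z)%Z -> joins s t a a' /\ joins s' t' b b') ->
  lifts (joins s t) (joins s' t') (- (dl z *: (a ⊗ b))) (- (dl z *: (a' ⊗ b'))).
Proof.
move=> h; rewrite -!(scaleN1r (_ *: _)); apply: liftsZ (lifts_dl h) => x x'.
exact: joinsZ.
Qed.

Lemma joins_p i : joins (idx (i - 1)) (idx i) (ap i) (img_p i).
Proof. by eexists; apply: qpath_gen; apply: arc_gen_p. Qed.
Lemma joins_a i : joins (idx (i - 2)) (idx (i - 1)) (aa i) (img_a i).
Proof. by eexists; apply: qpath_gen; apply: arc_gen_a. Qed.
Lemma joins_b i : joins (idx (i - 2)) (idx i) (ab i) (img_b i).
Proof. by eexists; apply: qpath_gen; apply: arc_gen_b. Qed.
Lemma joins_1 s t : s = t -> joins s t 1 1.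
Proof. by move=> ->; eexists; apply: qpath_1. Qed.

Ltac map_norm := rewrite ?(tensor_mapD, tensor_mapN, tensor_mapZ, tensor_map_tens,
  rmorphM, rmorph1) /= ?(img_pE, img_aE, img_bE).

Lemma compatible_pp i j :
  compatible (idx (i - 1)) (idx i) (ap i) (img_p i) (fun=> 0)
             (idx (j - 1)) (idx j) (ap j) (img_p j) (fun=> 0).
Proof.
exists 0, 0; split; first exact: lifts0.
  by rewrite db_arc_pp // tensor_map0.
rewrite !img_pE db_arc_pp // /inner tensor_swap0; tens_norm.
by rewrite tensor_map0.
Qed.

Lemma compatible_pa i j :
  compatible (idx (i - 1)) (idx i) (ap i) (img_p i) (fun=> 0)
             (idx (j - 2)) (idx (j - 1)) (aa j) (img_a j) (fun=> 0).
Proof.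
exists (dl (i - j + 2) *: (1 ⊗ (ap i * aa j)) - dl (i - j) *: ((aa j * ap i) ⊗ 1)).
exists (dl (i - j + 2) *: (1 ⊗ (img_p i * img_a j))
        - dl (i - j) *: ((img_a j * img_p i) ⊗ 1)); split.
- apply: liftsD.
    apply: lifts_dl => h.
    have e : idx (j - 2) = idx i.
      by apply/esym; apply: (index_mod_dvd _ h); ring.
    split; first exact: joins_1.
    by apply: joinsM (joins_p i) _; rewrite -e; apply: joins_a.
  apply: lifts_dlN => h.
  have e : idx (i - 1) = idx (j - 1).
    by apply: (index_mod_dvd _ h); ring.
  split; last exact: joins_1.
  by apply: joinsM (joins_a j) _; rewrite -e; apply: joins_p.
- by rewrite tensor_map_id db_arc_pa.
- rewrite /inner tensor_swap0; tens_norm; map_norm.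
  rewrite db_arc_pa' //.
  congr (dl _ *: _ - dl _ *: _); ring.
Qed.

Lemma compatible_aa i j :
  compatible (idx (i - 2)) (idx (i - 1)) (aa i) (img_a i) (fun=> 0)
             (idx (j - 2)) (idx (j - 1)) (aa j) (img_a j) (fun=> 0).
Proof.
exists 0, 0; split; first exact: lifts0.
  by rewrite db_arc_aa // tensor_map0.
rewrite !img_aE db_arc_aa' // /inner tensor_swap0; tens_norm.
by rewrite tensor_map0.
Qed.

Let corr_b (j : int) (v : 'I_n) := half_delta v (idx (j - 2)) *: (img_b j ⊗ 1)
              - half_delta v (idx j) *: (1 ⊗ img_b j).

Lemma compatible_pb i j :
  compatible (idx (i - 1)) (idx i) (ap i) (img_p i) (fun=> 0)
             (idx (j - 2)) (idx j) (ab j) (img_b j) (corr_b j).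
Proof.
exists (dl (i - j + 2) *: (1 ⊗ (ap i * ab j)) - dl (i - j) *: (ab j ⊗ ap i)).
exists (dl (i - j + 2) *: (1 ⊗ (img_p i * img_b j))
        - dl (i - j) *: (img_b j ⊗ img_p i)); split.
- apply: liftsD.
    apply: lifts_dl => h.
    have e : idx (j - 2) = idx i.
      by apply/esym; apply: (index_mod_dvd _ h); ring.
    split; first exact: joins_1.
    by apply: joinsM (joins_p i) _; rewrite -e; apply: joins_b.
  apply: lifts_dlN => h; have e : idx i = idx j by apply: (index_mod_dvd _ h).
  split; first by rewrite e; apply: joins_b.
  by rewrite -e; apply: joins_p.
- by rewrite tensor_map_id db_arc_pb.
- rewrite /inner /corr_b !half_delta_idx !(tensor_swapD, tensor_swapN, tensor_swapZ).
  rewrite !tensor_swap_tens !(mulrDl, mulrDr); tens_norm; map_norm.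
  rewrite db_arc_pb' //.
  have -> : i + m - (j + m) + 1 = i - j + 1 by ring.
  have -> : i + m - (j + m) - 1 = i - j - 1 by ring.
  have -> : i - (j - 2) = i - j + 2 by ring.
  have -> : i - 1 - (j - 2) = i - j + 1 by ring.
  have -> : i - 1 - j = i - j - 1 by ring.
  zmod_solve.
Qed.

Lemma compatible_ab i j :
  compatible (idx (i - 2)) (idx (i - 1)) (aa i) (img_a i) (fun=> 0)
             (idx (j - 2)) (idx j) (ab j) (img_b j) (corr_b j).
Proof.
exists (dl (i - j - 2) *: ((ab j * aa i) ⊗ 1) - dl (i - j) *: (aa i ⊗ ab j)).
exists (dl (i - j - 2) *: ((img_b j * img_a i) ⊗ 1)
        - dl (i - j) *: (img_a i ⊗ img_b j)); split.
- apply: liftsD.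
    apply: lifts_dl => h.
    have e : idx (i - 2) = idx j by apply: (index_mod_dvd _ h); ring.
    split; last exact: joins_1.
    by apply: joinsM (joins_b j) _; rewrite -e; apply: joins_a.
  apply: lifts_dlN => h; have e : idx i = idx j by apply: (index_mod_dvd _ h).
  have e2 : idx (i - 2) = idx (j - 2) by apply: (index_mod_dvd _ h); ring.
  split; first by rewrite -e2; apply: joins_a.
  by rewrite e2; apply: joins_b.
- by rewrite tensor_map_id db_arc_ab.
- rewrite /inner /corr_b !half_delta_idx !(tensor_swapD, tensor_swapN, tensor_swapZ).
  rewrite !tensor_swap_tens !(mulrDl, mulrDr); tens_norm; map_norm.
  rewrite db_arc_ab' //.
  have -> : i + m - (j + m) + 1 = i - j + 1 by ring.
  have -> : i + m - (j + m) - 1 = i - j - 1 by ring.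
  have -> : i - 1 - (j - 2) = i - j + 1 by ring.
  have -> : i - 1 - j = i - j - 1 by ring.
  have -> : i - 2 - (j - 2) = i - j by ring.
  have -> : i - 2 - j = i - j - 2 by ring.
  zmod_solve.
Qed.

(** {{b, b}} and {{b', b'}} have the same form, so the inner contributions of the two corrections
    must cancel. One is indexed by i - j and the other by j - i; [dlN] matches them. *)
Lemma compatible_bb i j :
  compatible (idx (i - 2)) (idx i) (ab i) (img_b i) (corr_b i)
             (idx (j - 2)) (idx j) (ab j) (img_b j) (corr_b j).
Proof.
exists (dl (i - j - 2) *: ((ab j * ab i) ⊗ 1) - dl (i - j + 2) *: (1 ⊗ (ab i * ab j))).
exists (dl (i - j - 2) *: ((img_b j * img_b i) ⊗ 1)
        - dl (i - j + 2) *: (1 ⊗ (img_b i * img_b j))); split.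
- apply: liftsD.
    apply: lifts_dl => h.
    have e : idx (i - 2) = idx j by apply: (index_mod_dvd _ h); ring.
    split; last exact: joins_1.
    by apply: joinsM (joins_b j) _; rewrite -e; apply: joins_b.
  apply: lifts_dlN => h.
  have e : idx (j - 2) = idx i by apply/esym; apply: (index_mod_dvd _ h); ring.
  split; first exact: joins_1.
  by apply: joinsM (joins_b i) _; rewrite -e; apply: joins_b.
- by rewrite tensor_map_id db_arc_bb.
- rewrite /inner /corr_b !half_delta_idx !(tensor_swapD, tensor_swapN, tensor_swapZ).
  rewrite !tensor_swap_tens !(mulrDl, mulrDr, mulrBl, mulrBr); tens_norm; map_norm.
  rewrite db_arc_bb' //.
  have -> : i + m - (j + m) + 2 = i - j + 2 by ring.
  have -> : i + m - (j + m) - 2 = i - j - 2 by ring.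
  have -> : j - (i - 2) = - (i - j - 2) by ring.
  have -> : j - 2 - (i - 2) = - (i - j) by ring.
  have -> : j - 2 - i = - (i - j + 2) by ring.
  have -> : j - i = - (i - j) by ring.
  have -> : i - 2 - (j - 2) = i - j by ring.
  have -> : i - 2 - j = i - j - 2 by ring.
  have -> : i - (j - 2) = i - j + 2 by ring.
  rewrite !dlN; zmod_solve.
Qed.

Theorem arc_compatible s t x x' r s' t' y y' q :
  qpath s t x x' r -> qpath s' t' y y' q -> compatible s t x x' r s' t' y y' q.
Proof.
apply: qpath_compatible => // {}s {}t {}x {}x' {}r {}s' {}t' {}y {}y' {}q.
by case=> i; case=> j; do [exact: compatible_pp | exact: compatible_pa
  | exact: compatible_pb | exact: compatible_aa | exact: compatible_ab
  | exact: compatible_bb | apply: compatible_sym => //; exact: compatible_pa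
  | apply: compatible_sym => //; exact: compatible_pb
  | apply: compatible_sym => //; exact: compatible_ab].
Qed.
End ArcCorrespondence.

(** * Walks on the universal cover of the cycle; coordinates as loops *)

Section Cover.
Variables (n : nat) (n_gt0 : (0 < n)%N).
Variables (F : unitAlgType rat) (g : letter * 'I_n -> F).
Hypothesis gU : forall l, g l \is a GRing.unit.
Local Notation idx := (index_mod n_gt0).
Local Notation ap := (arc_p n_gt0 g).
Local Notation aa := (arc_a n_gt0 g).
Local Notation ab := (arc_b n_gt0 g).
Implicit Types i j k : int.

Lemma arc_p_unit i : ap i \is a GRing.unit.
Proof. by rewrite unitrMl; apply: gU. Qed.

(* The product arc_p 1 * ... * arc_p k, extended to all integers k. *)
Definition walk k : F :=
  match k with
  | Posz m => \prod_(1 <= j < m.+1) ap j%:Z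
  | Negz m => \prod_(0 <= j < m.+1) (ap (- j%:Z))^-1
  end.

Lemma walkS k : walk k = walk (k - 1) * ap k.
Proof.
case: k => [[|m]|m].
- by rewrite /walk /= big_geq // big_nat1 oppr0 mulVr // arc_p_unit.
- rewrite (_ : Posz m.+1 - 1 = Posz m); last by rewrite -addn1 PoszD addrK.
  by rewrite /walk big_nat_recr.
- rewrite (_ : Negz m - 1 = Negz m.+1); last by rewrite !NegzE -[in RHS]addn1 PoszD opprD.
  rewrite /walk [in RHS]big_nat_recr //= -mulrA NegzE.
  by rewrite mulVr ?arc_p_unit // mulr1.
Qed.

Lemma walk0 : walk 0 = 1.
Proof. by rewrite /walk /= big_geq. Qed.

Lemma int_walk (P : int -> Prop) :
  (forall k, P k <-> P (k - 1)) -> P 0 -> forall k, P k.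
Proof.
move=> h P0; elim/int_rect => [//|m IH|m IH].
  by apply/h; rewrite -addn1 PoszD addrK.
by have /h := IH; rewrite -addn1 PoszD opprD.
Qed.

Lemma walk_unit k : walk k \is a GRing.unit.
Proof.
elim/int_walk: k => [k|]; last by rewrite walk0 unitr1.
by rewrite walkS unitrMl ?arc_p_unit.
Qed.

Lemma index_modDn i : idx (i + n%:Z) = idx i.
Proof. by apply: (@index_mod_dvd _ n_gt0 _ _ n%:Z); [exact: dvdzz|ring]. Qed.

Lemma pzE (k : nat) : (0 < k)%N -> pz n_gt0 g k = walk (k%:Z - 1) * gd n_gt0 g k%:Z.
Proof.
case: k => // k _; rewrite /pz; congr (_ * _).
by rewrite (_ : Posz k.+1 - 1 = Posz k) // -addn1 PoszD addrK.
Qed.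

Lemma walk_n : walk n%:Z = pZ n_gt0 g.
Proof. by rewrite /pZ walkS pzE // -mulrA. Qed.

Lemma walkDn k : walk (k + n%:Z) = pZ n_gt0 g * walk k.
Proof.
have h i : ap (i + n%:Z) = ap i by rewrite /arc_p index_modDn.
elim/int_walk: k => [k|]; last by rewrite add0r walk0 mulr1 walk_n.
rewrite walkS [walk k]walkS h (mulrA (pZ _ _)).
rewrite (_ : k + n%:Z - 1 = k - 1 + n%:Z); last by ring.
by split=> [h0|->] //; apply: (mulIr (arc_p_unit k)).
Qed.

Definition loop_a i := walk (i - 2) * aa i * (walk (i - 1))^-1.
Definition loop_b i := walk (i - 2) * ab i * (walk i)^-1.

(* pX i and pY i are built on the representative of i - 2 in {1, ..., n}. *)
Definition lap i : int := (index_rep n_gt0 (i - 2))%:Z + 2.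

Lemma index_lap i : idx (lap i) = idx i.
Proof.
apply: (@index_mod_dvd _ n_gt0 _ _ ((index_rep n_gt0 (i - 2))%:Z - (i - 2))).
  by rewrite -(index_mod_eq n_gt0) index_repK.
by rewrite /lap; ring.
Qed.

Lemma idx_lap i c : idx (lap i + c) = idx (i + c).
Proof.
apply/eqP; rewrite index_mod_eq (_ : _ - _ = lap i - i); last by ring.
by rewrite -(index_mod_eq n_gt0) index_lap.
Qed.

(** As z_k is P_(k-1) d_k, that is P_k c_k^-1, conjugating x_i by z_(i-2) leaves c_(i-2)^-1 in front
    of a_i and absorbs the trailing c_(i-2)^-1. *)
Lemma pXE i : pX n_gt0 g i = loop_a (lap i).
Proof.
rewrite /pX /px /loop_a /arc_a /ga idx_lap index_lap.
set k := index_rep n_gt0 (i - 2).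
have ek : lap i - 2 = k%:Z by rewrite addrK.
have ek1 : lap i - 1 = k%:Z + 1 by rewrite /lap -/k; ring.
rewrite ek ek1 [walk (_ + 1)]walkS addrK [walk k]walkS pzE // /vC.
rewrite !invrM ?(unitrMl, unitrMr, walk_unit, arc_p_unit, gU) //.
have e1 : idx k = idx (i - 2) by rewrite /k index_repK.
have e2 : idx (k%:Z + 1) = idx (i - 1) by rewrite -ek1 idx_lap.
rewrite /arc_p /vp /gd /gc e1 e2 !mulrA; congr (_ * _ * _).
by rewrite (mulrK (gU _)).
Qed.

Lemma pYE i : pY n_gt0 g i = loop_b (lap i).
Proof.
rewrite /pY /py /loop_b /arc_b /gb idx_lap index_lap.
set k := index_rep n_gt0 (i - 2).
have ek : lap i - 2 = k%:Z by rewrite addrK.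
have ek1 : lap i - 1 = k%:Z + 1 by rewrite /lap -/k; ring.
have ek2 : lap i = k%:Z + 1 + 1 by rewrite /lap -/k; ring.
rewrite ek ek2 [walk (_ + 1 + 1)]walkS addrK [walk (_ + 1)]walkS addrK.
rewrite [walk k]walkS pzE // /vC.
rewrite !invrM ?(unitrMl, unitrMr, walk_unit, arc_p_unit, gU) //.
have e1 : idx k = idx (i - 2) by rewrite /k index_repK.
have e2 : idx (k%:Z + 1) = idx (i - 1) by rewrite -ek1 idx_lap.
have e3 : idx (k%:Z + 1 + 1) = idx i by rewrite -ek2 index_lap.
rewrite /arc_p /vp /gd /gc e1 e2 e3 !mulrA; congr (_ * _ * _).
by rewrite (mulrK (gU _)).
Qed.

Lemma LXE i : \val (LX n_gt0 g i) = loop_a (lap i). Proof. exact: pXE. Qed.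
Lemma LYE i : \val (LY n_gt0 g i) = loop_b (lap i). Proof. exact: pYE. Qed.
End Cover.

(** * Paths closed up into elements of the coordinate algebra *)

Lemma inverse_uniq (R : unitRingType) (x y : R) : x * y = 1 -> y * x = 1 -> x^-1 = y.
Proof.
move=> xy yx; have xU : x \is a GRing.unit by apply/unitrP; exists y.
by apply: (mulrI xU); rewrite divrr.
Qed.

Section Realization.
Variables (n : nat) (n_gt0 : (0 < n)%N).
Variables (F : unitAlgType rat) (g : letter * 'I_n -> F).
Hypothesis gU : forall l, g l \is a GRing.unit.
Local Notation idx := (index_mod n_gt0).
Local Notation ap := (arc_p n_gt0 g).
Local Notation aa := (arc_a n_gt0 g).
Local Notation ab := (arc_b n_gt0 g).
Local Notation walk := (walk n_gt0 g).
Local Notation lap := (lap n_gt0).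
Local Notation L := (pentL n_gt0 g).
Variables (C : unitAlgType rat) (phi : {lrmorphism L -> C}).
Variables (B : algType rat) (fB : {lrmorphism B -> C}).
Variables img_p img_a img_b : int -> B.
Variable Q : int -> C.
Implicit Types i j k : int.
Hypotheses (QU : forall k, Q k \is a GRing.unit)
  (QS : forall k, Q k = Q (k - 1) * fB (img_p k))
  (QDn : forall k, Q (k + n%:Z) = phi (LZ n_gt0 g) * Q k)
  (phiX : forall i, phi (LX n_gt0 g i) = Q (lap i - 2) * fB (img_a i) * (Q (lap i - 1))^-1)
  (phiY : forall i, phi (LY n_gt0 g i) = Q (lap i - 2) * fB (img_b i) * (Q (lap i))^-1).

(** The graph of [phi] seen in F x C: membership in L and the value of [phi] are propagated
    together. *)
Definition real (x : F) (c : C) : Prop := exists l : L, \val l = x /\ phi l = c.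
(** The inverse is required in L and not only in F, so that [phi] applies to it. *)
Definition realU (x : F) (c : C) : Prop :=
  exists l l' : L, [/\ l * l' = 1, l' * l = 1, \val l = x & phi l = c].

Lemma real_of_realU x c : realU x c -> real x c.
Proof. by move=> [l [l' [_ _ h1 h2]]]; exists l. Qed.

Lemma realM x c y d : real x c -> real y d -> real (x * y) (c * d).
Proof.
move=> [l [<- <-]] [l' [<- <-]]; exists (l * l').
by rewrite [phi _]rmorphM [\val _]rmorphM.
Qed.

Lemma real_lin (a : rat) x c y d :
  real x c -> real y d -> real (a *: x + y) (a *: c + d).
Proof.
move=> [l [<- <-]] [l' [<- <-]]; exists (a *: l + l').
by rewrite [phi _]linearP [\val _]linearP.
Qed.

Lemma real_fun l c : real (\val l) c -> phi l = c.
Proof. by move=> [k [/val_inj <-]]. Qed.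

Lemma real_lifts (f : {lrmorphism B -> C}) (P P' : F -> B -> Prop) t t' :
  (forall x x', P x x' -> real x (f x')) -> (forall x x', P' x x' -> real x (f x')) ->
  lifts P P' t t' -> real (tensor_mult t) (f (tensor_mult t')).
Proof.
move=> hP hP'; elim=> [|a a' b b' {}t {}t' Pa Pb _ IH].
  by exists 0; rewrite !tensor_mult0 !rmorph0.
rewrite !tensor_multD !tensor_mult_tens rmorphD rmorphM -[_ * b]scale1r.
rewrite -[f a' * f b']scale1r; apply: real_lin IH.
exact: realM (hP _ _ Pa) (hP' _ _ Pb).
Qed.

Lemma realU1 : realU 1 1.
Proof. by exists 1, 1; rewrite !mulr1; split; rewrite ?rmorph1. Qed.

Lemma realUM x c y d : realU x c -> realU y d -> realU (x * y) (c * d).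
Proof.
move=> [l [l' [h1 h2 <- <-]]] [k [k' [h3 h4 <- <-]]]; exists (l * k), (k' * l').
split.
- by rewrite mulrA -(mulrA l) h3 mulr1.
- by rewrite mulrA -(mulrA k') h2 mulr1.
- exact: rmorphM.
- exact: rmorphM.
Qed.

Lemma realUV x c : realU x c -> realU x^-1 c^-1.
Proof.
move=> [l [l' [h1 h2 <- <-]]]; exists l', l; split=> //.
  by apply/esym/inverse_uniq; rewrite -rmorphM ?h1 ?h2 rmorph1.
by apply/esym/inverse_uniq; rewrite -rmorphM ?h1 ?h2 rmorph1.
Qed.

Lemma realU_Z : realU (pZ n_gt0 g) (phi (LZ n_gt0 g)).
Proof.
have ZU : pZ n_gt0 g \is a GRing.unit by rewrite -walk_n // walk_unit.
pose ZV : L := Sub (pZ n_gt0 g)^-1 (pent_gen_mem (pent_gen_ZV n_gt0 g)).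
exists (LZ n_gt0 g), ZV.
by split=> //; apply: val_inj; [exact: divrr|exact: mulVr].
Qed.

Lemma loop_a_unit i : loop_a n_gt0 g i \is a GRing.unit.
Proof.
have aaU : aa i \is a GRing.unit by rewrite unitrMl ?unitrV; apply: gU.
rewrite /loop_a unitrMl ?unitrV ?walk_unit //.
by rewrite unitrMl ?walk_unit.
Qed.

Lemma loop_b_unit i : loop_b n_gt0 g i \is a GRing.unit.
Proof.
have abU : ab i \is a GRing.unit by rewrite unitrMl ?unitrV; apply: gU.
rewrite /loop_b unitrMl ?unitrV ?walk_unit //.
by rewrite unitrMl ?walk_unit.
Qed.

Lemma realU_X i : realU (loop_a n_gt0 g (lap i)) (phi (LX n_gt0 g i)).
Proof.
have XU : pX n_gt0 g i \is a GRing.unit by rewrite pXE // loop_a_unit.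
pose V : L := Sub (pX n_gt0 g i)^-1 (pent_gen_mem (pent_gen_XV n_gt0 g i)).
exists (LX n_gt0 g i), V.
split=> //; first by apply: val_inj; exact: divrr.
  by apply: val_inj; exact: mulVr.
exact: pXE.
Qed.

Lemma realU_Y i : realU (loop_b n_gt0 g (lap i)) (phi (LY n_gt0 g i)).
Proof.
have YU : pY n_gt0 g i \is a GRing.unit by rewrite pYE // loop_b_unit.
pose V : L := Sub (pY n_gt0 g i)^-1 (pent_gen_mem (pent_gen_YV n_gt0 g i)).
exists (LY n_gt0 g i), V.
split=> //; first by apply: val_inj; exact: divrr.
  by apply: val_inj; exact: mulVr.
exact: pYE.
Qed.

(* The walk and its image Q both gain a factor Z per turn. *)
Lemma realU_turn i j : idx i = idx j ->
  realU (walk i * (walk j)^-1) (Q i * (Q j)^-1).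
Proof.
move=> /eqP; rewrite index_mod_eq => /dvdzP[q hq].
have -> : i = j + q * n%:Z by rewrite -hq addrC subrK.
elim/int_walk: q {hq} => [q|]; last first.
  by rewrite mul0r addr0 !divrr ?walk_unit //; apply: realU1.
have -> : j + q * n%:Z = j + (q - 1) * n%:Z + n%:Z by ring.
set k := j + _; rewrite walkDn // QDn -(mulrA (pZ _ _)) -(mulrA (phi _)); split; first last.
  exact: realUM realU_Z.
move=> /(realUM (realUV realU_Z)).
have ZU : pZ n_gt0 g \is a GRing.unit by rewrite -walk_n // walk_unit.
rewrite !(mulKr ZU) mulKr //.
by have := QU (k + n%:Z); rewrite QDn unitrMl.
Qed.

Lemma realU_shift i i' j j' x c : idx i = idx i' -> idx j = idx j' ->
  realU (walk i * x * (walk j)^-1) (Q i * c * (Q j)^-1) ->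
  realU (walk i' * x * (walk j')^-1) (Q i' * c * (Q j')^-1).
Proof.
move=> ei ej h.
have := realUM (realUM (realU_turn (esym ei)) h) (realU_turn ej).
by rewrite !mulrA !(divrK, mulrVK) ?walk_unit.
Qed.

Local Notation gen := (arc_gen n_gt0 g img_p img_a img_b).

Lemma realU_gen s t x x' r i j : gen s t x x' r -> idx i = s -> idx j = t ->
  realU (walk i * x * (walk j)^-1) (Q i * fB x' * (Q j)^-1).
Proof.
case=> k ei ej.
- apply: (@realU_shift (k - 1) _ k) => //.
  rewrite -walkS // -QS !divrr ?walk_unit //; exact: realU1.
- apply: (@realU_shift (lap k - 2) _ (lap k - 1)).
  + by rewrite ei idx_lap.
  + by rewrite ej idx_lap.
  + have := realU_X k; rewrite phiX /loop_a.
    by rewrite /arc_a idx_lap index_lap.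
- apply: (@realU_shift (lap k - 2) _ (lap k)).
  + by rewrite ei idx_lap.
  + by rewrite ej index_lap.
  + have := realU_Y k; rewrite phiY /loop_b.
    by rewrite /arc_b idx_lap index_lap.
Qed.

(** In a composite the walks at the middle vertex cancel. Inversion is limited to generators
    because, by [realU_gen], these are invertible in L once closed up, which fails to be available
    for sums. *)
Theorem real_qpath s t x x' r i j : qpath gen gen s t x x' r ->
  idx i = s -> idx j = t ->
  real (walk i * x * (walk j)^-1) (Q i * fB x' * (Q j)^-1).
Proof.
move=> h; elim: h i j => {s t x x' r}.
- by move=> s t x x' r h i j ei ej; apply/real_of_realU/(realU_gen h).
- move=> s i j ei ej; rewrite rmorph1 !mulr1.
  by apply/real_of_realU/realU_turn; rewrite ei ej.
- move=> s t a x x' r y y' q _ hx _ hy i j ei ej.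
  rewrite linearP !mulrDr !mulrDl -!scalerAr -!scalerAl.
  by apply: real_lin; [apply: hx|apply: hy].
- move=> s t u x x' r y y' q _ hx _ hy i j ei ej.
  have et := index_mod_ord n_gt0 t.
  have := realM (hx i t.+1%:Z ei et) (hy t.+1%:Z j et ej).
  by rewrite !mulrA !(divrK, mulrVK) ?walk_unit // rmorphM !mulrA.
- move=> s t x x' r y y' _ _ hg xy yx xy' yx' i j ei ej.
  apply: real_of_realU; have := realUV (realU_gen hg ej ei).
  have xU : x \is a GRing.unit by apply/unitrP; exists y.
  have e1 : fB x' * fB y' = 1 by rewrite -rmorphM xy' rmorph1.
  have e2 : fB y' * fB x' = 1 by rewrite -rmorphM yx' rmorph1.
  have x'U : fB x' \is a GRing.unit by apply/unitrP; exists (fB y').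
  rewrite !invrM ?invrK ?unitrMl ?unitrV ?walk_unit //.
  by rewrite (inverse_uniq xy yx) (inverse_uniq e1 e2) !mulrA.
Qed.
End Realization.

(** * Elements of the coordinate algebra as loops at the vertex 0 *)

Section LoopPaths.
Variables (n : nat) (n_gt0 : (0 < n)%N).
Variables (F : unitAlgType rat) (g : letter * 'I_n -> F).
Hypothesis gU : forall l, g l \is a GRing.unit.
Local Notation idx := (index_mod n_gt0).
Local Notation ap := (arc_p n_gt0 g).
Local Notation aa := (arc_a n_gt0 g).
Local Notation ab := (arc_b n_gt0 g).
Local Notation walk := (walk n_gt0 g).
Variables (B : algType rat) (img_p img_a img_b : int -> B).
Local Notation invertible x := (exists y, x * y = 1 /\ y * x = 1).
Hypotheses (ipU : forall i, invertible (img_p i))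
  (iaU : forall i, invertible (img_a i)) (ibU : forall i, invertible (img_b i)).
Local Notation gen := (arc_gen n_gt0 g img_p img_a img_b).
Local Notation joins := (joins gen gen).

(** Only generators may be inverted in a path, so the inverse of a composite has to be assembled
    from the inverses of its factors: both directions are tracked. *)
Definition reversible s t x : Prop :=
  (exists x', joins s t x x') /\ (exists x', joins t s x^-1 x').

Lemma reversible_gen s t x x' r :
  x \is a GRing.unit -> invertible x' -> gen s t x x' r -> reversible s t x.
Proof.
move=> xU [y' [h1 h2]] hg; split.
  by exists x', r; apply: qpath_gen.
exists y'; eexists; apply: (qpath_inv _ hg (divrr xU) (mulVr xU) h1 h2).
exact: qpath_gen.
Qed.

Lemma reversibleV s t x : reversible s t x -> reversible t s x^-1.
Proof. by case=> h1 h2; split; rewrite ?invrK. Qed.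

Lemma reversibleM s t u x y : x \is a GRing.unit -> y \is a GRing.unit ->
  reversible s t x -> reversible t u y -> reversible s u (x * y).
Proof.
move=> xU yU [[x1 hx1] [x2 hx2]] [[y1 hy1] [y2 hy2]]; split.
  by exists (x1 * y1); apply: joinsM hx1 hy1.
by exists (y2 * x2); rewrite invrM //; apply: joinsM hy2 hx2.
Qed.

Lemma reversible_p i : reversible (idx (i - 1)) (idx i) (ap i).
Proof.
apply: (reversible_gen _ (ipU i) (arc_gen_p n_gt0 g img_p img_a img_b i)).
exact: arc_p_unit.
Qed.

Lemma arc_a_unit i : aa i \is a GRing.unit.
Proof. by rewrite unitrMl ?unitrV; apply: gU. Qed.

Lemma arc_b_unit i : ab i \is a GRing.unit.
Proof. by rewrite unitrMl ?unitrV; apply: gU. Qed.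

Lemma reversible_a i : reversible (idx (i - 2)) (idx (i - 1)) (aa i).
Proof.
apply: (reversible_gen _ (iaU i) (arc_gen_a n_gt0 g img_p img_a img_b i)).
exact: arc_a_unit.
Qed.

Lemma reversible_b i : reversible (idx (i - 2)) (idx i) (ab i).
Proof.
apply: (reversible_gen _ (ibU i) (arc_gen_b n_gt0 g img_p img_a img_b i)).
exact: arc_b_unit.
Qed.

Lemma reversible_walk k : reversible (idx 0) (idx k) (walk k).
Proof.
elim/int_walk: k => [k|]; last first.
  by rewrite walk0; split; exists 1; rewrite ?invr1; eexists; apply: qpath_1.
have e : walk (k - 1) = walk k * (ap k)^-1 by rewrite [walk k]walkS // mulrK ?arc_p_unit.
split=> h; last by rewrite walkS //; apply: reversibleM h (reversible_p k);
  rewrite ?walk_unit ?arc_p_unit.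
rewrite e; apply: reversibleM h (reversibleV (reversible_p k));
  by rewrite ?unitrV ?walk_unit ?arc_p_unit.
Qed.

Lemma reversible_loop_a i : reversible (idx 0) (idx 0) (loop_a n_gt0 g i).
Proof.
have aU := arc_a_unit i; rewrite /loop_a.
apply: reversibleM (reversibleV (reversible_walk (i - 1))).
- by rewrite unitrMl ?walk_unit.
- by rewrite unitrV walk_unit.
- by apply: reversibleM (reversible_walk _) (reversible_a i); rewrite ?walk_unit.
Qed.

Lemma reversible_loop_b i : reversible (idx 0) (idx 0) (loop_b n_gt0 g i).
Proof.
have bU := arc_b_unit i; rewrite /loop_b.
apply: reversibleM (reversibleV (reversible_walk i)).
- by rewrite unitrMl ?walk_unit.
- by rewrite unitrV walk_unit.
- by apply: reversibleM (reversible_walk _) (reversible_b i); rewrite ?walk_unit.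
Qed.

Lemma reversible_Z : reversible (idx 0) (idx 0) (pZ n_gt0 g).
Proof.
rewrite -walk_n //; have := reversible_walk n%:Z.
by rewrite -[n%:Z]add0r index_modDn.
Qed.

Lemma pentL_joins x : alg_span (pent_gen n_gt0 g) x ->
  exists x', joins (idx 0) (idx 0) x x'.
Proof.
elim=> {x} [x hx||a x y _ [x' hx] _ [y' hy]|x y _ [x' hx] _ [y' hy]].
- case: hx => [i|i|i|i||]; rewrite ?pXE ?pYE //.
  + by case: (reversible_loop_a (lap n_gt0 i)).
  + by case: (reversible_loop_a (lap n_gt0 i)).
  + by case: (reversible_loop_b (lap n_gt0 i)).
  + by case: (reversible_loop_b (lap n_gt0 i)).
  + by case: reversible_Z.
  + by case: reversible_Z.
- by exists 1; eexists; apply: qpath_1.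
- by exists (a *: x' + y'); apply: joins_lin.
- by exists (x' * y'); apply: joinsM hx hy.
Qed.
End LoopPaths.

(** * Units of a free skew field over the rationals *)

Section FreeSkewField.
Variables (I : Type) (F : unitAlgType rat) (g : I -> F).
Hypothesis hfree : free_skew_field g.

Lemma specialization_unit (D : unitAlgType rat) (R : algType rat)
    (iota : {lrmorphism R -> F}) (s : {lrmorphism R -> D}) x :
  injective iota -> s x != 0 -> iota x \is a GRing.unit.
Proof.
move=> inj sx; case: hfree => F_skew _ _; apply: F_skew; apply: contraNneq sx => x0.
by rewrite (inj x 0) ?rmorph0 // x0 rmorph0.
Qed.

Lemma rat_alg_two_neq0 (D : algType rat) : 1 + 1 != 0 :> D.
Proof.
apply/eqP => /(congr1 ( *:%R (2^-1 : rat))); rewrite scaler0 scalerDr -scalerDl.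
by rewrite (_ : 2^-1 + 2^-1 = 1) // scale1r => /eqP; rewrite oner_eq0.
Qed.

(** Sending every generator to 1 is a specialization, under which a generator goes to 1 and the sums
    of the next two lemmas go to 1 + 1. An element with nonzero specialization is a unit. *)
Lemma free_gen_unit i : g i \is a GRing.unit.
Proof.
case: hfree => F_skew _ /(_ F (fun=> 1) F_skew) [R [iota [s [inj hg _]]]].
have [r <- sr] := hg i; apply: (specialization_unit (s := s)) => //.
by rewrite /= sr oner_neq0.
Qed.

Lemma free_sum_unit i j : g i + g j \is a GRing.unit.
Proof.
case: hfree => F_skew _ /(_ F (fun=> 1) F_skew) [R [iota [s [inj hg _]]]].
have [r <- sr] := hg i; have [r' <- sr'] := hg j.
rewrite -rmorphD; apply: (specialization_unit (s := s)) => //.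
by rewrite rmorphD /= sr sr' rat_alg_two_neq0.
Qed.

Lemma free_binomial_unit i j k l : g i + g j * g k * g l \is a GRing.unit.
Proof.
case: hfree => F_skew _ /(_ F (fun=> 1) F_skew) [R [iota [s [inj hg _]]]].
have [r1 <- s1] := hg i; have [r2 <- s2] := hg j.
have [r3 <- s3] := hg k; have [r4 <- s4] := hg l.
rewrite -!rmorphM -rmorphD; apply: (specialization_unit (s := s)) => //.
by rewrite rmorphD !rmorphM /= s1 s2 s3 s4 !mulr1 rat_alg_two_neq0.
Qed.
End FreeSkewField.

(** * The pentagram images as closed arcs *)

Section PentagramImages.
Variables (n : nat) (n_gt0 : (0 < n)%N).
Variables (F : unitAlgType rat) (g : letter * 'I_n -> F).
Hypotheses (gU : forall l, g l \is a GRing.unit)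
  (wU : forall o, vw g o \is a GRing.unit).
Local Notation idx := (index_mod n_gt0).
Local Notation ap := (arc_p n_gt0 g).
Local Notation walk := (walk n_gt0 g).
Local Notation lap := (lap n_gt0).

Let pU o : vp g o \is a GRing.unit.
Proof. by rewrite unitrMl; apply: gU. Qed.

Let taE i : ta n_gt0 g i = vp g (idx i) * (vw g (idx i))^-1. Proof. by []. Qed.
Let tbE i : tb n_gt0 g i = vw g (idx i). Proof. by []. Qed.

Let taV i : (ta n_gt0 g i)^-1 = vA g (idx i).
Proof. by rewrite taE invrM ?unitrV ?pU ?wU // invrK. Qed.

Let tbV_taV i : (tb n_gt0 g i)^-1 * (ta n_gt0 g i)^-1 = (vp g (idx i))^-1.
Proof. by rewrite taV tbE mulKr ?wU. Qed.

Let tcE i : tc n_gt0 g i = vE g (idx i).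
Proof. by rewrite /tc tbE /vE mulrA. Qed.

(** Substituting b = b~ - a d c in a~ b c^-1 gives the difference that defines [vD]. *)
Lemma vDE o : vD g o = vp g o * (vw g o)^-1 * g (Lb, o) * (g (Lc, o))^-1.
Proof.
have -> : g (Lb, o) = vw g o - g (La, o) * g (Ld, o) * g (Lc, o) by rewrite addrK.
rewrite /vD /vE mulrBr mulrBl divrK ?wU // !mulrA.
by rewrite !mulrK //; apply: gU.
Qed.

Let tdE i : td n_gt0 g i = vD g (idx i).
Proof. by rewrite vDE. Qed.

Lemma txiE (k : nat) : txi n_gt0 g k = walk k%:Z.
Proof.
rewrite /txi /walk; apply: eq_bigr => j _.
by rewrite taE tbE divrK ?wU.
Qed.

(** xi_k is the walk P_k, and b~^-1 a~^-1 is an inverse arc p^-1. The shift by 2 makes the image of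
    X_i start at the same vertex as X_i. *)
Lemma tX_loop i : tX n_gt0 g (i - 2) =
  walk (lap i - 2) * arc_a' n_gt0 g i * (walk (lap i - 1))^-1.
Proof.
rewrite /tX txiE tcE taV subrK (_ : i - 2 + 1 = i - 1); last by ring.
rewrite -(mulrA _ (tb _ _ _)^-1) tbV_taV /lap addrK.
set k := index_rep n_gt0 (i - 2).
have -> : k%:Z + 2 - 1 = k%:Z + 1 by ring.
have e : idx (k%:Z + 1) = idx (i - 1).
  by rewrite -(idx_lap n_gt0 i (-1)); congr index_mod; rewrite /lap -/k; ring.
rewrite [walk (_ + 1)]walkS // addrK.
rewrite (@invrM _ (walk k) (ap (k%:Z + 1))) ?walk_unit ?arc_p_unit //.
by rewrite [ap _]/arc_p e /arc_a' !mulrA.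
Qed.

Lemma tY_loop i : tY n_gt0 g (i - 2) =
  walk (lap i - 2) * arc_b' n_gt0 g i * (walk (lap i))^-1.
Proof.
rewrite /tY txiE tdE subrK (_ : i - 2 + 1 = i - 1); last by ring.
rewrite (_ : i - 2 + 3 = i + 1); last by ring.
rewrite -(mulrA _ (tb _ _ (i - 1))^-1) tbV_taV -(mulrA _ (tb _ _ i)^-1) tbV_taV.
rewrite taV /lap addrK; set k := index_rep n_gt0 (i - 2).
have -> : k%:Z + 2 = k%:Z + 1 + 1 by ring.
have e : idx (k%:Z + 1) = idx (i - 1).
  by rewrite -(idx_lap n_gt0 i (-1)); congr index_mod; rewrite /lap -/k; ring.
have e2 : idx (k%:Z + 1 + 1) = idx i.
  by rewrite -(index_lap n_gt0 i); congr index_mod; rewrite /lap -/k; ring.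
rewrite [walk (_ + 1 + 1)]walkS // addrK [walk (_ + 1)]walkS // addrK.
rewrite (@invrM _ (walk k * ap (k%:Z + 1)) (ap (k%:Z + 1 + 1)));
  rewrite ?(@invrM _ (walk k) (ap (k%:Z + 1)));
  rewrite ?unitrMl ?walk_unit ?arc_p_unit //; try exact: gU.
by rewrite /arc_p e e2 /arc_b' !mulrA.
Qed.
End PentagramImages.

(** * Part (b) *)

Section Invariance.
Variables (n : nat) (n_gt0 : (0 < n)%N).
Variables (F : unitAlgType rat) (g : letter * 'I_n -> F).
Variable db : {bilinear F -> F -> tensor F F}.
Hypotheses (hfree : free_skew_field g) (hdb : double_bracket db)
  (hgen : pent_bracket_gens g db).
Local Notation idx := (index_mod n_gt0).
Local Notation ap := (arc_p n_gt0 g).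
Local Notation walk := (walk n_gt0 g).
Local Notation lap := (lap n_gt0).
Local Notation L := (pentL n_gt0 g).
Let gU : forall l, g l \is a GRing.unit := free_gen_unit hfree.
Let wU o : vw g o \is a GRing.unit.
Proof. exact: free_binomial_unit. Qed.

Lemma vA_unit o : vA g o \is a GRing.unit.
Proof. by rewrite unitrMl ?wU // unitrV unitrMl; apply: gU. Qed.
Lemma vE_unit o : vE g o \is a GRing.unit.
Proof. by rewrite unitrMl ?unitrV ?wU // unitrMl; apply: gU. Qed.
Lemma vD_unit o : vD g o \is a GRing.unit.
Proof.
rewrite vDE //; do 2 (rewrite unitrMl; last by rewrite ?unitrV; apply: gU).
by rewrite unitrMl ?unitrV ?wU // unitrMl; apply: gU.
Qed.

Theorem shifted_pentagram_invariance (phi : {lrmorphism L -> F}) :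
  (forall i : int, phi (LX n_gt0 g i) = tX n_gt0 g (i - 2)) ->
  (forall i : int, phi (LY n_gt0 g i) = tY n_gt0 g (i - 2)) ->
  phi (LZ n_gt0 g) = pZ n_gt0 g ->
  forall u v : L, exists w : L,
    \val w = bracket db (\val u) (\val v) /\
    eq_mod_comm (bracket db (phi u) (phi v)) (phi w).
Proof.
move=> hX hY hZ u v.
pose iB : {lrmorphism F -> F} := idfun.
pose img_a := arc_a' n_gt0 g; pose img_b := arc_b' n_gt0 g.
have inv (x : F) : x \is a GRing.unit -> exists y, x * y = 1 /\ y * x = 1.
  by move=> xU; exists x^-1; rewrite divrr ?mulVr.
have path (l : L) : exists x' r,
    qpath (arc_gen n_gt0 g ap img_a img_b) (arc_gen n_gt0 g ap img_a img_b)
      (idx 0) (idx 0) (\val l) x' r.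
  have [||||x' [r h]] := @pentL_joins n n_gt0 F g gU F ap img_a img_b _ _ _ (\val l).
  - by move=> i; apply: inv; apply: arc_p_unit.
  - by move=> i; apply: inv; rewrite unitrMl ?vA_unit ?vE_unit.
  - by move=> i; apply: inv; rewrite unitrMl ?vA_unit ?vD_unit.
  - by apply/asboolP; apply: (valP l).
  - by exists x', r.
have realize s t x x' r i j : 
    qpath (arc_gen n_gt0 g ap img_a img_b) (arc_gen n_gt0 g ap img_a img_b)
      s t x x' r -> idx i = s -> idx j = t ->
    real phi (walk i * x * (walk j)^-1) (walk i * iB x' * (walk j)^-1).
  apply: real_qpath => // [k|k|k|k|k].
  - exact: walk_unit.
  - exact: walkS.
  - by rewrite walkDn // hZ.
  - by rewrite hX tX_loop.
  - by rewrite hY tY_loop.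
have real0 x x' : joins (arc_gen n_gt0 g ap img_a img_b)
    (arc_gen n_gt0 g ap img_a img_b) (idx 0) (idx 0) x x' -> real phi x (iB x').
  by move=> [r h]; have := realize _ _ _ _ _ 0 0 h erefl erefl; rewrite walk0 invr1 !mul1r !mulr1.
have [[u' [r hu]] [v' [q hv]]] := (path u, path v).
have phiu : phi u = u' by apply: real_fun; apply: real0; exists r.
have phiv : phi v = v' by apply: real_fun; apply: real0; exists q.
(* With S^2 T the vertices stay in place: m = 0. *)
have hp i : iB (ap i) = ap (i + 0) by rewrite addr0.
have ha i : iB (img_a i) = arc_a' n_gt0 g (i + 0) by rewrite addr0.
have hb i : iB (img_b i) = arc_b' n_gt0 g (i + 0) by rewrite addr0.
have [t [t' [ht t1 t2]]] := arc_compatible hdb hgen gU wU hp ha hb hu hv.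
(* The factors of {{u, v}} are loops at the vertex 0, so their products lie in L. *)
have [w [w1 w2]] := real_lifts real0 real0 ht.
exists w; split; first by rewrite w1 /bracket t1 tensor_map_id.
rewrite /bracket phiu phiv t2 tensor_map_id tensor_multD w2.
(* All that remains of the inner term is one commutator. *)
exists [:: (v', tensor_mult (r (idx 0)))]; rewrite big_seq1 /=.
by rewrite tensor_mult_inner_comm addrC addKr.
Qed.
End Invariance.

(** * Towards part (a): periodicity of the coordinates, and the double bracket with Z at Z = 1 *)

Section Periodicity.
Variables (n : nat) (n_gt0 : (0 < n)%N) (F : unitAlgType rat) (g : letter * 'I_n -> F).
Hypothesis gU : forall l, g l \is a GRing.unit.
Local Notation idx := (index_mod n_gt0).

Lemma index_modDr i j c : idx i = idx j -> idx (i + c) = idx (j + c).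
Proof.
move=> /eqP e; apply/eqP; move: e; rewrite !index_mod_eq; congr (_ %| _)%Z.
by ring.
Qed.

Lemma lap_mod i j : idx i = idx j -> lap n_gt0 i = lap n_gt0 j.
Proof. by move=> e; rewrite /lap /index_rep (index_modDr (- 2) e). Qed.

Lemma LX_mod i j : idx i = idx j -> LX n_gt0 g i = LX n_gt0 g j.
Proof. by move=> e; apply: val_inj; rewrite !LXE // (lap_mod e). Qed.

Lemma LY_mod i j : idx i = idx j -> LY n_gt0 g i = LY n_gt0 g j.
Proof. by move=> e; apply: val_inj; rewrite !LYE // (lap_mod e). Qed.

Lemma LX_LXY i : LX n_gt0 g i = LXY n_gt0 g (true, idx i).
Proof. by apply: LX_mod; rewrite index_mod_ord. Qed.

Lemma LY_LXY i : LY n_gt0 g i = LXY n_gt0 g (false, idx i).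
Proof. by apply: LY_mod; rewrite index_mod_ord. Qed.
End Periodicity.

Lemma cancel_mid (R : unitRingType) (a w x y : R) : w \is a GRing.unit ->
  a * w^-1 * (w * x * y) = a * x * y.
Proof. by move=> wU; rewrite !mulrA mulrVK. Qed.

Lemma cancel_mid2 (R : unitRingType) (a w x : R) : w \is a GRing.unit ->
  a * w^-1 * (w * x) = a * x.
Proof. by move=> wU; rewrite !mulrA mulrVK. Qed.

Lemma cancel_mid3 (R : unitRingType) (a b w x : R) : w \is a GRing.unit ->
  a * (b * w) * (w^-1 * x) = a * b * x.
Proof. by move=> wU; rewrite !mulrA mulrK. Qed.

Section LoopBracket.
Variables (n : nat) (n_gt0 : (0 < n)%N).
Variables (F : unitAlgType rat) (g : letter * 'I_n -> F).
Variable db : {bilinear F -> F -> tensor F F}.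
Hypotheses (hdb : double_bracket db) (hgen : pent_bracket_gens g db).
Hypotheses (gU : forall l, g l \is a GRing.unit).
Local Notation idx := (index_mod n_gt0).
Local Notation ap := (arc_p n_gt0 g).
Local Notation aa := (arc_a n_gt0 g).
Local Notation ab := (arc_b n_gt0 g).
Local Notation walk := (walk n_gt0 g).
Local Notation lap := (lap n_gt0).
Local Notation L := (pentL n_gt0 g).
Local Notation dl := (dl n).
Implicit Types i j k : int.

Lemma db_p_walk k j : db (ap k) (walk j) = 0.
Proof.
elim/int_walk: j => [j|]; last by rewrite walk0 (db_1r hdb).
rewrite [walk j]walkS // (db_mulr hdb) db_arc_pp // mulr0 addr0.
split=> [h|->]; last by rewrite mul0r.
have := congr1 ( *%R^~ (1 ⊗ (ap j)^-1)) h.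
by rewrite /= mul0r -mulrA tens_mul divrr ?arc_p_unit // !mulr1.
Qed.

Lemma db_p_walkV k j : db (ap k) (walk j)^-1 = 0.
Proof.
have wU := walk_unit n_gt0 gU j.
by rewrite (db_invr hdb _ (divrr wU) (mulVr wU)) db_p_walk mulr0 mul0r oppr0.
Qed.

Lemma db_walk_walk k j : db (walk k) (walk j) = 0.
Proof.
elim/int_walk: k => [k|]; last by rewrite walk0 (db_1l hdb).
rewrite [walk k]walkS // (db_mull hdb) db_p_walk mulr0 addr0.
split=> [h|->]; last by rewrite mul0r.
have := congr1 ( *%R^~ ((ap k)^-1 ⊗ 1)) h.
by rewrite /= mul0r -mulrA tens_mul divrr ?arc_p_unit // !mulr1.
Qed.

(** One term of the Leibniz expansion of {{P_n, u}}. Its factors are grouped into loops and turns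
    [walk i * (walk j)^-1]; where the coefficient [dl] is nonzero, i and j are congruent and the
    turns lie in L. *)
Lemma db_step_a k i :
  (1 ⊗ walk (k - 1)) * db (ap k) (loop_a n_gt0 g i) * ((walk k)^-1 ⊗ 1) =
    dl (k - i + 2) *:
      ((walk (i - 2) * (walk k)^-1) ⊗ (walk k * (walk (i - 2))^-1 * loop_a n_gt0 g i))
    - dl (k - i) *:
      ((loop_a n_gt0 g i * (walk (i - 1) * (walk (k - 1))^-1))
        ⊗ (walk (k - 1) * (walk (i - 1))^-1)).
Proof.
have U := walk_unit n_gt0 gU; have pU := arc_p_unit n_gt0 gU.
rewrite /loop_a (db_mulr hdb _ (_ * aa i)) (db_mulr hdb _ (walk _)).
rewrite db_p_walk db_p_walkV db_arc_pa //.
rewrite mul0r add0r mulr0 addr0 !mulrBr !mulrBl; tens_norm.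
rewrite mulrBr mulrBl; tens_norm.
congr (_ *: _ - _ *: _).
  by rewrite cancel_mid //; congr (_ ⊗ _); rewrite [walk k]walkS // !mulrA.
rewrite cancel_mid2 // [walk k]walkS // (@invrM _ (walk (k - 1)) (ap k)) //; last exact: pU.
by rewrite cancel_mid3 //; exact: pU.
Qed.

Lemma db_step_b k i :
  (1 ⊗ walk (k - 1)) * db (ap k) (loop_b n_gt0 g i) * ((walk k)^-1 ⊗ 1) =
    dl (k - i + 2) *:
      ((walk (i - 2) * (walk k)^-1) ⊗ (walk k * (walk (i - 2))^-1 * loop_b n_gt0 g i))
    - dl (k - i) *:
      ((loop_b n_gt0 g i * (walk i * (walk k)^-1)) ⊗ (walk k * (walk i)^-1)).
Proof.
have U := walk_unit n_gt0 gU; have pU := arc_p_unit n_gt0 gU.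
rewrite /loop_b (db_mulr hdb _ (_ * ab i)) (db_mulr hdb _ (walk _)).
rewrite db_p_walk db_p_walkV db_arc_pb //.
rewrite mul0r add0r mulr0 addr0 !mulrBr !mulrBl; tens_norm.
rewrite mulrBr mulrBl; tens_norm.
congr (_ *: _ - _ *: _).
  by rewrite cancel_mid //; congr (_ ⊗ _); rewrite [walk k]walkS // !mulrA.
by rewrite cancel_mid2 //; congr (_ ⊗ _); rewrite [walk k]walkS // !mulrA.
Qed.
End LoopBracket.

Section ReducedLoops.
Variables (n : nat) (n_gt0 : (0 < n)%N).
Variables (F : unitAlgType rat) (g : letter * 'I_n -> F).
Variable db : {bilinear F -> F -> tensor F F}.
Hypotheses (hdb : double_bracket db) (hgen : pent_bracket_gens g db).
Hypotheses (gU : forall l, g l \is a GRing.unit).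
Local Notation idx := (index_mod n_gt0).
Local Notation ap := (arc_p n_gt0 g).
Local Notation aa := (arc_a n_gt0 g).
Local Notation ab := (arc_b n_gt0 g).
Local Notation walk := (walk n_gt0 g).
Local Notation lap := (lap n_gt0).
Local Notation L := (pentL n_gt0 g).
Local Notation dl := (dl n).
Local Notation LZ := (LZ n_gt0 g).
Local Notation LX := (LX n_gt0 g).
Local Notation LY := (LY n_gt0 g).
Implicit Types i j k : int.
Variables (K : unitAlgType rat) (f : {lrmorphism L -> K}).
Hypothesis fZ : f LZ = 1.

(** A walk gains a factor Z per turn, and Z is 1 in K, so a constant is a legitimate image of the
    walks. *)
Let Q (k : int) : K := 1.
Let QU k : Q k \is a GRing.unit. Proof. exact: unitr1. Qed.
Let QDn k : Q (k + n%:Z) = f LZ * Q k. Proof. by rewrite fZ mulr1. Qed.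

Lemma realU_turn1 i j : idx i = idx j -> realU f (walk i * (walk j)^-1) 1.
Proof. by move=> e; have := realU_turn gU QU QDn e; rewrite divr1. Qed.

Lemma realU_shift1 i i' j j' x c : idx i = idx i' -> idx j = idx j' ->
  realU f (walk i * x * (walk j)^-1) c -> realU f (walk i' * x * (walk j')^-1) c.
Proof.
move=> e e' h; have := @realU_shift _ n_gt0 F g gU K f Q QU QDn i i' j j' x c e e'.
by rewrite !divr1 !mul1r; apply.
Qed.

Lemma realU_loop_a i : realU f (loop_a n_gt0 g i) (f (LX i)).
Proof.
apply: (@realU_shift1 (lap i - 2) _ (lap i - 1)); rewrite ?idx_lap //.
by have := realU_X gU f i; rewrite /loop_a /arc_a idx_lap index_lap.
Qed.

Lemma realU_loop_b i : realU f (loop_b n_gt0 g i) (f (LY i)).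
Proof.
apply: (@realU_shift1 (lap i - 2) _ (lap i)); rewrite ?idx_lap ?index_lap //.
by have := realU_Y gU f i; rewrite /loop_b /arc_b idx_lap index_lap.
Qed.

Definition real_tensor : tensor F F -> tensor K K -> Prop :=
  lifts (real f) (real f).

Lemma real_tens x c y d : real f x c -> real f y d -> real_tensor (x ⊗ y) (c ⊗ d).
Proof. exact: lifts_tens. Qed.

Lemma realZ (a : rat) x c : real f x c -> real f (a *: x) (a *: c).
Proof.
move=> h; have h0 : real f 0 0 by exists 0; rewrite !rmorph0.
by have := real_lin a h h0; rewrite !addr0.
Qed.

Lemma real_tensorZ (a : rat) t t' : real_tensor t t' -> real_tensor (a *: t) (a *: t').
Proof. by apply: liftsZ => x c; apply: realZ. Qed.

Lemma real_tensorB t t' u u' :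
  real_tensor t t' -> real_tensor u u' -> real_tensor (t - u) (t' - u').
Proof.
move=> h h'; rewrite -(scaleN1r u) -(scaleN1r u'); apply: liftsD => //.
exact: real_tensorZ.
Qed.

Lemma real_tensorMr t t' x c :
  real_tensor t t' -> real f x c -> real_tensor (t * (x ⊗ 1)) (t' * (c ⊗ 1)).
Proof.
move=> + hx; elim=> [|a a' b b' {}t {}t' ha hb _ IH].
  by rewrite !mul0r; apply: lifts0.
rewrite !mulrDl !tens_mul !mulr1; apply: lifts_cons => //.
exact: realM.
Qed.

Lemma real_tensor_map t t' : real_tensor t t' ->
  exists u : tensor L L, tensor_map (\val : {linear L -> F}) (\val : {linear L -> F}) u = t
    /\ tensor_map f f u = t'.
Proof.
elim=> [|a a' b b' {}t {}t' [l [<- <-]] [l' [<- <-]] _ [u [<- <-]]].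
  by exists 0; rewrite !tensor_map0.
by exists (l ⊗ l' + u); rewrite !tensor_mapD !tensor_map_tens.
Qed.

Lemma real_tensor_dl z t t' : ((n%:Z %| z)%Z -> real_tensor t t') ->
  real_tensor (dl z *: t) (dl z *: t').
Proof.
rewrite /dl; case: ifP => [_ h|_ _]; first exact/real_tensorZ/h.
by rewrite !scale0r; apply: lifts0.
Qed.

(** Exactly one j among 1, ..., n is congruent to c. *)
Lemma sum_dl c : \sum_(1 <= j < n.+1) dl (j%:Z - c) = 2^-1.
Proof.
rewrite big_add1 /= big_mkord (bigD1 (idx c)) //= big1 ?addr0 => [|o ne].
  rewrite -[dl _](half_delta_idx n_gt0) (index_mod_ord n_gt0 (idx c)).
  by rewrite /half_delta eqxx.
rewrite -[dl _](half_delta_idx n_gt0) index_mod_ord.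
by rewrite /half_delta (negPf ne).
Qed.

(** The factor (walk k)^-1 ⊗ 1 makes the Leibniz expansion additive: lengthening the walk by one arc
    adds one term and leaves the earlier ones unchanged. *)
Lemma db_walk_real (w : F) (c : K) i (k : nat) :
  (forall k, real_tensor ((1 ⊗ walk (k - 1)) * db (ap k) w * ((walk k)^-1 ⊗ 1))
     (dl (k - i + 2) *: (1 ⊗ c) - dl (k - i) *: (c ⊗ 1))) ->
  real_tensor (db (walk k%:Z) w * ((walk k%:Z)^-1 ⊗ 1))
    ((\sum_(1 <= j < k.+1) dl (j%:Z - i + 2)) *: (1 ⊗ c)
      - (\sum_(1 <= j < k.+1) dl (j%:Z - i)) *: (c ⊗ 1)).
Proof.
move=> step; elim: k => [|k IH].
  rewrite walk0 (db_1l hdb) mul0r !big_geq // !scale0r subrr.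
  exact: lifts0.
have -> : db (walk k.+1%:Z) w * ((walk k.+1%:Z)^-1 ⊗ 1)
    = db (walk k%:Z) w * ((walk k%:Z)^-1 ⊗ 1)
      + (1 ⊗ walk (k.+1%:Z - 1)) * db (ap k.+1%:Z) w * ((walk k.+1%:Z)^-1 ⊗ 1).
  have e : k.+1%:Z - 1 = k%:Z by rewrite -addn1 PoszD addrK.
  have pU := arc_p_unit n_gt0 gU k.+1%:Z.
  rewrite {1}[walk k.+1%:Z]walkS // e (db_mull hdb) mulrDl; congr (_ + _).
  rewrite -mulrA tens_mul mul1r [walk k.+1%:Z]walkS // e.
  by rewrite (@invrM _ (walk k%:Z) (ap k.+1%:Z)) ?walk_unit // mulVKr.
have -> : \sum_(1 <= j < k.+2) dl (j%:Z - i + 2)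
    = \sum_(1 <= j < k.+1) dl (j%:Z - i + 2) + dl (k.+1%:Z - i + 2).
  by rewrite big_nat_recr.
have -> : \sum_(1 <= j < k.+2) dl (j%:Z - i)
    = \sum_(1 <= j < k.+1) dl (j%:Z - i) + dl (k.+1%:Z - i).
  by rewrite big_nat_recr.
rewrite !scalerDl opprD addrACA.
exact: liftsD IH (step _).
Qed.

(** A full turn meets each residue once, so both sums are 1/2; the factor Z^-1 ⊗ 1 is removed by
    multiplying by Z, which goes to 1. *)
Lemma db_Z_loop (w : F) (c : K) i :
  (forall k, real_tensor ((1 ⊗ walk (k - 1)) * db (ap k) w * ((walk k)^-1 ⊗ 1))
     (dl (k - i + 2) *: (1 ⊗ c) - dl (k - i) *: (c ⊗ 1))) ->
  real_tensor (db (pZ n_gt0 g) w) (2^-1 *: (1 ⊗ c) - 2^-1 *: (c ⊗ 1)).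
Proof.
move=> step; have := db_walk_real n step; rewrite sum_dl.
have -> : \sum_(1 <= j < n.+1) dl (j%:Z - i + 2) = 2^-1.
  by rewrite -(sum_dl (i - 2)); apply: eq_bigr => j _; congr dl; ring.
move=> h.
have rZ : real f (walk n%:Z) 1.
  by rewrite walk_n // -fZ; exists LZ.
have := real_tensorMr h rZ.
by rewrite -mulrA tens_mul mulVr ?walk_unit // !mulr1 walk_n.
Qed.

Lemma db_Z_loop_a i : real_tensor (db (pZ n_gt0 g) (loop_a n_gt0 g i))
  (2^-1 *: (1 ⊗ f (LX i)) - 2^-1 *: (f (LX i) ⊗ 1)).
Proof.
apply: (@db_Z_loop _ _ i) => k; rewrite db_step_a //.
have ra := real_of_realU (realU_loop_a i).
apply: real_tensorB; apply: real_tensor_dl => h.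
- have e : idx (i - 2) = idx k.
    by apply/esym; apply: (index_mod_dvd _ h); ring.
  rewrite -[X in 1 ⊗ X]mul1r; apply: real_tens.
    exact/real_of_realU/realU_turn1.
  by apply: realM ra; apply/real_of_realU/realU_turn1.
- have e : idx (i - 1) = idx (k - 1).
    by apply/esym; apply: (index_mod_dvd _ h); ring.
  rewrite -[X in X ⊗ 1]mulr1; apply: real_tens.
    by apply: realM ra _; apply/real_of_realU/realU_turn1.
  exact/real_of_realU/realU_turn1.
Qed.

Lemma db_Z_loop_b i : real_tensor (db (pZ n_gt0 g) (loop_b n_gt0 g i))
  (2^-1 *: (1 ⊗ f (LY i)) - 2^-1 *: (f (LY i) ⊗ 1)).
Proof.
apply: (@db_Z_loop _ _ i) => k; rewrite db_step_b //.
have rb := real_of_realU (realU_loop_b i).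
apply: real_tensorB; apply: real_tensor_dl => h.
- have e : idx (i - 2) = idx k.
    by apply/esym; apply: (index_mod_dvd _ h); ring.
  rewrite -[X in 1 ⊗ X]mul1r; apply: real_tens.
    exact/real_of_realU/realU_turn1.
  by apply: realM rb; apply/real_of_realU/realU_turn1.
- have e : idx i = idx k by apply/esym; apply: (index_mod_dvd _ h).
  rewrite -[X in X ⊗ 1]mulr1; apply: real_tens.
    by apply: realM rb _; apply/real_of_realU/realU_turn1.
  exact/real_of_realU/realU_turn1.
Qed.
End ReducedLoops.

(** * The images of the loops as rational functions of the loops *)

Section ImageLoops.
Variables (n : nat) (n_gt0 : (0 < n)%N).
Variables (F : unitAlgType rat) (g : letter * 'I_n -> F).
Hypotheses (gU : forall l, g l \is a GRing.unit)
  (wU : forall o, vw g o \is a GRing.unit).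
Local Notation idx := (index_mod n_gt0).
Local Notation ap := (arc_p n_gt0 g).
Local Notation walk := (walk n_gt0 g).
Local Notation la := (loop_a n_gt0 g).
Local Notation lb := (loop_b n_gt0 g).
Implicit Types i : int.

Let U := walk_unit n_gt0 gU.
Let pU := arc_p_unit n_gt0 gU.

Lemma walkVS i : (walk i)^-1 = (ap i)^-1 * (walk (i - 1))^-1.
Proof. by rewrite walkS // (@invrM _ (walk (i - 1)) (ap i)) ?U ?pU. Qed.

(** Extending the arc a by p_i gives it the endpoints of the arc b, and a_i p_i + b_i is b~_i. *)
Lemma loop_sumE i :
  la i + lb i = walk (i - 2) * vC g (idx (i - 2)) * vw g (idx i) * (walk i)^-1.
Proof.
have e : (walk (i - 1))^-1 = ap i * (walk i)^-1 by rewrite [in RHS]walkVS mulVKr.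
rewrite /loop_a /loop_b e /arc_a /arc_b /arc_p /vp /vw !mulrA -mulrDl.
by rewrite mulrDr !mulrA addrC.
Qed.

Lemma loop_sum_unit i : la i + lb i \is a GRing.unit.
Proof.
rewrite loop_sumE unitrMl ?unitrV ?U // unitrMl ?wU // unitrMl ?U //.
by rewrite unitrV; apply: gU.
Qed.

(** An identity in F, before Z is set to 1. Each b~ in the image is matched with a sum of two loops
    by [loop_sumE]; so the lifts of the images to R are rational in loops, and their brackets can be
    compared with those of K. *)
Lemma image_loop_a i : walk i * arc_a' n_gt0 g (i + 2) * (walk (i + 1))^-1 =
  (la i + lb i)^-1 * la i * (la (i + 2) + lb (i + 2)).
Proof.
apply: (mulrI (loop_sum_unit i)); rewrite !mulrA divrr ?loop_sum_unit // mul1r.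
have e : (walk (i + 2))^-1 = (ap (i + 2))^-1 * (walk (i + 1))^-1.
  by rewrite walkVS (_ : i + 2 - 1 = i + 1) //; ring.
rewrite !loop_sumE addrK e /arc_a' ?addrK /vE /vA /loop_a !mulrA.
rewrite !mulrVK ?U ?wU //; congr (_ * _ * _ * _).
rewrite [X in _ = _ * X * _]walkS // mulrA mulrVK ?U // /arc_p /vp !mulrA.
by rewrite (mulrK (wU _)) [in RHS](mulrK (gU (Lc, idx i))).
Qed.

Lemma image_loop_b i : walk i * arc_b' n_gt0 g (i + 2) * (walk (i + 2))^-1 =
  (la (i + 1) + lb (i + 1))^-1 * lb (i + 1) * (la (i + 3) + lb (i + 3)).
Proof.
apply: (mulrI (loop_sum_unit (i + 1))).
rewrite !mulrA divrr ?loop_sum_unit // mul1r.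
have e : (walk (i + 3))^-1 = (ap (i + 3))^-1 * (walk (i + 2))^-1.
  by rewrite walkVS (_ : i + 3 - 1 = i + 2) //; ring.
have e1 : i + 3 - 2 = i + 1 by ring.
have e2 : i + 2 - 1 = i + 1 by ring.
have e3 : i + 2 + 1 = i + 3 by ring.
rewrite !loop_sumE e e1 /arc_b' e2 e3 vDE // /vA /loop_b !mulrA.
rewrite [in LHS]walkVS addrK.
rewrite !mulrA (mulrVK (U i)) [in RHS](mulrVK (U _)).
rewrite -(mulrA _ (g (Ld, _)) (g (Lc, _))) (mulrVK (pU (i + 1))).
by rewrite (mulrK (wU _)).
Qed.
End ImageLoops.

(** * Part (a) *)

Section ReducedInvariance.
Variables (n : nat) (n_gt0 : (0 < n)%N).
Variables (F : unitAlgType rat) (g : letter * 'I_n -> F).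
Variable db : {bilinear F -> F -> tensor F F}.
Hypotheses (hfree : free_skew_field g) (hdb : double_bracket db)
  (hgen : pent_bracket_gens g db).
Local Notation idx := (index_mod n_gt0).
Local Notation ap := (arc_p n_gt0 g).
Local Notation walk := (walk n_gt0 g).
Local Notation la := (loop_a n_gt0 g).
Local Notation lb := (loop_b n_gt0 g).
Local Notation lap := (lap n_gt0).
Local Notation L := (pentL n_gt0 g).
Local Notation LXY := (LXY n_gt0 g).
Local Notation LX := (LX n_gt0 g).
Local Notation LY := (LY n_gt0 g).
Local Notation LZ := (LZ n_gt0 g).
Implicit Types (i j k : int) (o : 'I_n).

Let gU : forall l, g l \is a GRing.unit := free_gen_unit hfree.
Let wU o : vw g o \is a GRing.unit.
Proof. exact: free_binomial_unit. Qed.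

Variables (K : unitAlgType rat) (f : {lrmorphism L -> K}).
Variable dbK : {bilinear K -> K -> tensor K K}.
Hypotheses (fZ : f LZ = 1) (hfreeK : free_skew_field (fun p => f (LXY p))).
Hypothesis hred : reduced_bracket n_gt0 g db f dbK.
Variables (R : algType rat) (iota : {lrmorphism R -> F}) (s : {lrmorphism R -> K}).
Definition special_values (l : letter * 'I_n) : K :=
  match l.1 with
  | La => f (LXY (true, l.2))
  | Lb => f (LXY (false, l.2))
  | _ => 1
  end.
Hypotheses (iota_inj : injective iota)
  (hR : forall l, exists2 r, iota r = g l & s r = special_values l)
  (hinv : forall r, s r != 0 -> exists r', iota r' = (iota r)^-1).

Let hdbK : double_bracket dbK. Proof. by case: hred. Qed.

Let VX o := f (LXY (true, o)).
Let VY o := f (LXY (false, o)).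
Let XU p : f (LXY p) \is a GRing.unit. Proof. exact: (free_gen_unit hfreeK). Qed.
Let SU o : VX o + VY o \is a GRing.unit.
Proof. exact: (free_sum_unit hfreeK (true, o) (false, o)). Qed.

Definition lies_over (x : F) (c : K) : Prop := exists y, iota y = x /\ s y = c.

Lemma lies_over_s y : lies_over (iota y) (s y). Proof. by exists y. Qed.

Lemma lies_over1 : lies_over 1 1.
Proof. by exists 1; rewrite !rmorph1. Qed.

Lemma lies_overM x c y d : lies_over x c -> lies_over y d -> lies_over (x * y) (c * d).
Proof. by move=> [u [<- <-]] [v [<- <-]]; exists (u * v); rewrite !rmorphM. Qed.

Lemma lies_overD x c y d : lies_over x c -> lies_over y d -> lies_over (x + y) (c + d).
Proof. by move=> [u [<- <-]] [v [<- <-]]; exists (u + v); rewrite !rmorphD. Qed.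

Lemma iota_unit y : s y != 0 -> iota y \is a GRing.unit.
Proof. exact: (specialization_unit hfree). Qed.

Lemma unit_neq0 (A : unitRingType) (c : A) : c \is a GRing.unit -> c != 0.
Proof. by apply: contraTneq => ->; rewrite unitr0. Qed.

Lemma lies_overV x c : c \is a GRing.unit -> lies_over x c -> lies_over x^-1 c^-1.
Proof.
move=> cU [y [<- yc]]; have sy : s y != 0 by rewrite yc unit_neq0.
have [y' y'E] := hinv sy; exists y'; split=> //.
have yU := iota_unit sy.
have e1 : y * y' = 1 by apply: iota_inj; rewrite rmorphM rmorph1 /= y'E divrr.
have e2 : y' * y = 1 by apply: iota_inj; rewrite rmorphM rmorph1 /= y'E mulVr.
by apply/esym/inverse_uniq; rewrite -yc -rmorphM ?e1 ?e2 rmorph1.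
Qed.

Lemma lies_over_g l : lies_over (g l) (special_values l).
Proof. by have [r h1 h2] := hR l; exists r. Qed.

Lemma lies_over_p o : lies_over (vp g o) 1.
Proof.
by rewrite -[1]mulr1; apply: lies_overM (lies_over_g (Ld, o)) (lies_over_g (Lc, o)).
Qed.

Lemma lies_over_w o : lies_over (vw g o) (VX o + VY o).
Proof.
rewrite addrC -[VX o]mulr1 -[VX o]mulr1; apply: lies_overD (lies_over_g (Lb, o)) _.
apply: lies_overM _ (lies_over_g (Lc, o)).
exact: lies_overM (lies_over_g (La, o)) (lies_over_g (Ld, o)).
Qed.

Lemma lies_over_A o : lies_over (vA g o) (VX o + VY o).
Proof.
rewrite -[_ + VY o]mulr1 -[X in lies_over _ (_ * X)]invr1; apply: lies_overM (lies_over_w o) _.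
by apply: lies_overV (lies_over_p o); apply: unitr1.
Qed.

Lemma lies_over_E o : lies_over (vE g o) ((VX o + VY o)^-1 * VX o).
Proof.
apply: lies_overM; first exact: lies_overV (lies_over_w o).
rewrite -[VX o]mulr1.
exact: lies_overM (lies_over_g (La, o)) (lies_over_g (Ld, o)).
Qed.

Lemma lies_over_D o : lies_over (vD g o) ((VX o + VY o)^-1 * VY o).
Proof.
rewrite vDE // -[_ * VY o]mulr1 -[X in lies_over _ (_ * X)]invr1.
apply: lies_overM; last first.
  by apply: lies_overV (lies_over_g (Lc, o)); apply: unitr1.
apply: lies_overM (lies_over_g (Lb, o)).
rewrite -[X in lies_over _ X]mul1r.
by apply: lies_overM (lies_over_p o) _; apply: lies_overV (lies_over_w o).
Qed.

Lemma lies_over_walk k : lies_over (walk k) 1.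
Proof.
elim/int_walk: k => [k|]; last by rewrite walk0; apply: lies_over1.
have p1 := lies_over_p (idx k); split=> h; last first.
  by rewrite walkS // -[X in lies_over _ X]mulr1; apply: lies_overM h p1.
have -> : walk (k - 1) = walk k * (ap k)^-1 by rewrite [walk k]walkS // mulrK ?arc_p_unit.
rewrite -[X in lies_over _ X]divr1; apply: lies_overM h _.
by apply: lies_overV p1; apply: unitr1.
Qed.

Lemma lies_over_conj i j x c : lies_over x c -> lies_over (walk i * x * (walk j)^-1) c.
Proof.
move=> h; rewrite -[c]mul1r -[_ * c]mulr1 -[X in lies_over _ (_ * X)]invr1.
apply: lies_overM; first exact: lies_overM (lies_over_walk i) h.
by apply: lies_overV (lies_over_walk j); apply: unitr1.
Qed.

Lemma lies_over_C o : lies_over (vC g o) 1.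
Proof.
rewrite -[1]invr1; apply: lies_overV (lies_over_g (Lc, o)); exact: unitr1.
Qed.

Lemma lies_over_la i : lies_over (la i) (f (LX i)).
Proof.
rewrite LX_LXY //; apply: lies_over_conj; rewrite -[f _]mul1r.
exact: lies_overM (lies_over_C _) (lies_over_g (La, idx i)).
Qed.

Lemma lies_over_lb i : lies_over (lb i) (f (LY i)).
Proof.
rewrite LY_LXY //; apply: lies_over_conj; rewrite -[f _]mul1r.
exact: lies_overM (lies_over_C _) (lies_over_g (Lb, idx i)).
Qed.

Lemma lies_over_Z : lies_over (pZ n_gt0 g) 1.
Proof. by rewrite -walk_n //; apply: lies_over_walk. Qed.

(** All loops are based at one vertex, hence the type [unit]. Z carries a correction because {{Z,
    u}} does not vanish at Z = 1 whereas {{1, u}} does; by [db_Z_loop] the difference is inner. *)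
Inductive loop_gen : unit -> unit -> R -> K -> (unit -> tensor K K) -> Prop :=
| loop_gen_XY p y of iota y = \val (LXY p) & s y = f (LXY p) :
    loop_gen tt tt y (f (LXY p)) (fun=> 0)
| loop_gen_Z y of iota y = pZ n_gt0 g & s y = 1 :
    loop_gen tt tt y 1 (fun=> 2^-1 *: (1 ⊗ 1)).

(** Any invertible loop may be inverted here, in particular the denominators X_i + Y_i of T. *)
Let ok (_ _ : unit) (_ : R) (_ : K) (_ : unit -> tensor K K) : Prop := True.
Local Notation joinsA := (joins loop_gen ok tt tt).

Definition loop_over (x : F) (c : K) : Prop := exists y, iota y = x /\ joinsA y c.

Lemma joinsA_s y c : joinsA y c -> c = s y.
Proof.
move=> [r]; elim=> {y c r}.
- by move=> t t' y c r [p {}y _ ->|{}y _ ->].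
- by move=> t; rewrite rmorph1.
- by move=> t t' a x x' r y y' q _ -> _ ->; rewrite linearP.
- by move=> t t' t'' x x' r y y' q _ -> _ ->; rewrite rmorphM.
- move=> t t' x x' r y y' _ ex _ xy yx xy' yx'; rewrite -[y']mulr1.
  by rewrite -(rmorph1 s) -xy rmorphM mulrA /= -ex yx' mul1r.
Qed.

Lemma loop_overM x c y d : loop_over x c -> loop_over y d -> loop_over (x * y) (c * d).
Proof.
move=> [u [<- h]] [v [<- h']]; exists (u * v); rewrite rmorphM.
by split=> //; apply: joinsM h h'.
Qed.

Lemma loop_over_lin (a : rat) x c y d :
  loop_over x c -> loop_over y d -> loop_over (a *: x + y) (a *: c + d).
Proof.
move=> [u [<- h]] [v [<- h']]; exists (a *: u + v); rewrite linearP.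
by split=> //; apply: joins_lin.
Qed.

Lemma loop_over1 : loop_over 1 1.
Proof. by exists 1; rewrite rmorph1; split=> //; eexists; apply: qpath_1. Qed.

Lemma loop_over_inv x c y d : loop_over x c -> lies_over y d ->
  x * y = 1 -> y * x = 1 -> loop_over y d.
Proof.
move=> [u [<- hu]] [v [<- <-]] e1 e2; exists v; split=> //.
have uv : u * v = 1 by apply: iota_inj; rewrite rmorphM rmorph1.
have vu : v * u = 1 by apply: iota_inj; rewrite rmorphM rmorph1.
have cs := joinsA_s hu; case: hu => r hu; eexists.
by apply: (qpath_inv hu); rewrite ?uv ?vu ?cs -?rmorphM ?uv ?vu ?rmorph1.
Qed.

Lemma loop_overV x c : c \is a GRing.unit -> loop_over x c -> loop_over x^-1 c^-1.
Proof.
move=> cU [u [<- hu]]; have cs := joinsA_s hu.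
have xU : iota u \is a GRing.unit by apply: iota_unit; rewrite -cs unit_neq0.
apply: (@loop_over_inv (iota u) c); rewrite ?divrr ?mulVr //; first by exists u.
by apply: lies_overV => //; rewrite cs; apply: lies_over_s.
Qed.

Lemma loop_over_X i : loop_over (pX n_gt0 g i) (f (LX i)).
Proof.
have [y [h1 h2]] := lies_over_la (lap i).
have e : f (LX (lap i)) = f (LX i) by rewrite (@LX_mod _ _ _ _ gU (lap i) i) ?index_lap.
exists y; rewrite h1 pXE //; split=> //; exists (fun=> 0); apply: qpath_gen.
rewrite LX_LXY //; apply: loop_gen_XY; rewrite -LX_LXY // ?LXE //.
by rewrite h2.
Qed.

Lemma loop_over_Y i : loop_over (pY n_gt0 g i) (f (LY i)).
Proof.
have [y [h1 h2]] := lies_over_lb (lap i).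
have e : f (LY (lap i)) = f (LY i) by rewrite (@LY_mod _ _ _ _ gU (lap i) i) ?index_lap.
exists y; rewrite h1 pYE //; split=> //; exists (fun=> 0); apply: qpath_gen.
rewrite LY_LXY //; apply: loop_gen_XY; rewrite -LY_LXY // ?LYE //.
by rewrite h2.
Qed.

Lemma loop_over_Z : loop_over (pZ n_gt0 g) 1.
Proof.
have [y [h1 h2]] := lies_over_Z; exists y; split=> //.
by eexists; apply: qpath_gen; apply: loop_gen_Z.
Qed.

Lemma loop_over_L (l : L) : loop_over (\val l) (f l).
Proof.
suff [c [h /real_fun e]] : exists c, loop_over (\val l) c /\ real f (\val l) c by rewrite e.
have hl : alg_span (pent_gen n_gt0 g) (\val l) by apply/asboolP; apply: (valP l).
elim: hl => [x hx||a x y _ [c [h1 h2]] _ [d [h3 h4]]|x y _ [c [h1 h2]] _ [d [h3 h4]]].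
- have realV y c : realU f y c -> real f y^-1 c^-1.
    by move=> h; apply/real_of_realU/realUV.
  case: hx => [i|i|i|i||].
  + by exists (f (LX i)); split; [apply: loop_over_X|exists (LX i)].
  + exists (f (LX i))^-1; split; last by apply: realV; rewrite pXE //; apply: realU_X.
    by apply: loop_overV (loop_over_X i); rewrite LX_LXY.
  + by exists (f (LY i)); split; [apply: loop_over_Y|exists (LY i)].
  + exists (f (LY i))^-1; split; last by apply: realV; rewrite pYE //; apply: realU_Y.
    by apply: loop_overV (loop_over_Y i); rewrite LY_LXY.
  + by exists 1; split; [apply: loop_over_Z|exists LZ].
  + exists 1^-1; split; last by apply: realV; rewrite -fZ; apply: realU_Z.
    by apply: loop_overV loop_over_Z; apply: unitr1.
- by exists 1; split; [apply: loop_over1|apply/real_of_realU/realU1].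
- by exists (a *: c + d); split; [apply: loop_over_lin|apply: real_lin].
- by exists (c * d); split; [apply: loop_overM|apply: realM].
Qed.

Lemma real_tensor_lifts t t' : real_tensor f t t' ->
  exists u, lifts (joins loop_gen ok tt tt) (joins loop_gen ok tt tt) u t'
    /\ tensor_map iota iota u = t.
Proof.
elim=> [|x c y d {}t {}t' [l [<- <-]] [l' [<- <-]] _ [u [hu <-]]].
  by exists 0; rewrite tensor_map0; split=> //; apply: lifts0.
have [[v [<- hv]] [v' [<- hv']]] := (loop_over_L l, loop_over_L l').
exists (v ⊗ v' + u); rewrite tensor_mapD tensor_map_tens; split=> //.
exact: lifts_cons.
Qed.

Let choose (v : 'I_n -> F) (c : 'I_n -> K) : (forall o, lies_over (v o) (c o)) ->
  exists r : 'I_n -> R, (forall o, iota (r o) = v o) /\ (forall o, s (r o) = c o).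
Proof.
by move=> h; have [r hr] := choice h; exists r; split=> o; case: (hr o).
Qed.

Section Images.
Variables rp rA rE rD : 'I_n -> R.
Hypotheses (rpE : forall o, iota (rp o) = vp g o) (rpS : forall o, s (rp o) = 1)
  (rAE : forall o, iota (rA o) = vA g o) (rAS : forall o, s (rA o) = VX o + VY o)
  (rEE : forall o, iota (rE o) = vE g o)
  (rES : forall o, s (rE o) = (VX o + VY o)^-1 * VX o)
  (rDE : forall o, iota (rD o) = vD g o)
  (rDS : forall o, s (rD o) = (VX o + VY o)^-1 * VY o).

(* T(X_i) is arc_a' (i + 2), which starts at the vertex i and not at i - 2,
   closed up to a loop: hence the shift by 2. *)
Definition rimg_p i : R := rp (idx (i + 2)).
Definition rimg_a i : R := rE (idx (i + 2 - 2)) * rA (idx (i + 2)).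
Definition rimg_b i : R := rD (idx (i + 2 - 1)) * rA (idx (i + 2 + 1)).
Local Notation genB := (arc_gen n_gt0 g rimg_p rimg_a rimg_b).

Lemma rimg_pE i : iota (rimg_p i) = ap (i + 2). Proof. exact: rpE. Qed.
Lemma rimg_aE i : iota (rimg_a i) = arc_a' n_gt0 g (i + 2).
Proof. by rewrite /rimg_a rmorphM /= rEE rAE. Qed.
Lemma rimg_bE i : iota (rimg_b i) = arc_b' n_gt0 g (i + 2).
Proof. by rewrite /rimg_b rmorphM /= rDE rAE. Qed.

Lemma s_rimg_p i : s (rimg_p i) = 1. Proof. exact: rpS. Qed.
Lemma s_rimg_a i : s (rimg_a i) = (f (LX i) + f (LY i))^-1 * f (LX i)
  * (f (LX (i + 2)) + f (LY (i + 2))).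
Proof. by rewrite /rimg_a rmorphM /= rES rAS addrK !LX_LXY // !LY_LXY. Qed.
Lemma s_rimg_b i : s (rimg_b i) = (f (LX (i + 1)) + f (LY (i + 1)))^-1
  * f (LY (i + 1)) * (f (LX (i + 3)) + f (LY (i + 3))).
Proof.
rewrite /rimg_b rmorphM /= rDS rAS !LX_LXY // !LY_LXY //.
have -> : i + 2 - 1 = i + 1 by ring.
by have -> : i + 2 + 1 = i + 3 by ring.
Qed.

Let s_invertible y : s y \is a GRing.unit -> exists y', y * y' = 1 /\ y' * y = 1.
Proof.
move=> sU; have [y' [e _]] := lies_overV sU (lies_over_s y); exists y'.
have yU : iota y \is a GRing.unit by apply/iota_unit/unit_neq0.
by split; apply: iota_inj; rewrite rmorphM rmorph1 /= e ?divrr ?mulVr.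
Qed.

Lemma SxU i : f (LX i) + f (LY i) \is a GRing.unit.
Proof. by rewrite LX_LXY // LY_LXY //; apply: SU. Qed.

Let ipU i : exists y, rimg_p i * y = 1 /\ y * rimg_p i = 1.
Proof. by apply: s_invertible; rewrite s_rimg_p unitr1. Qed.
Let iaU i : exists y, rimg_a i * y = 1 /\ y * rimg_a i = 1.
Proof.
apply: s_invertible; rewrite s_rimg_a unitrMl ?SxU // unitrMl ?unitrV ?SxU //.
by rewrite LX_LXY.
Qed.
Let ibU i : exists y, rimg_b i * y = 1 /\ y * rimg_b i = 1.
Proof.
apply: s_invertible; rewrite s_rimg_b unitrMl ?SxU // unitrMl ?unitrV ?SxU //.
by rewrite LY_LXY.
Qed.

Lemma pentL_joinsB (l : L) : exists x', joins genB genB (idx 0) (idx 0) (\val l) x'.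
Proof.
apply: (pentL_joins gU ipU iaU ibU); apply/asboolP; exact: (valP l).
Qed.

Variable Tq : {lrmorphism L -> K}.
Hypotheses (TZ : Tq LZ = 1)
  (TX : forall i, Tq (LX i) = (f (LX i) + f (LY i))^-1 * f (LX i)
    * (f (LX (i + 2)) + f (LY (i + 2))))
  (TY : forall i, Tq (LY i) = (f (LX (i + 1)) + f (LY (i + 1)))^-1
    * f (LY (i + 1)) * (f (LX (i + 3)) + f (LY (i + 3)))).

Lemma realB a b x x' r i j : qpath genB genB a b x x' r -> idx i = a -> idx j = b ->
  real Tq (walk i * x * (walk j)^-1) (s x').
Proof.
move=> h ei ej; have := real_qpath (phi := Tq) (fB := s) (Q := fun=> 1) gU _ _ _ _ _ h ei ej.
rewrite divr1 mul1r; apply=> [k|k|k|k|k].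
- exact: unitr1.
- by rewrite s_rimg_p mulr1.
- by rewrite TZ mulr1.
- by rewrite TX s_rimg_a mul1r divr1.
- by rewrite TY s_rimg_b mul1r divr1.
Qed.

Lemma joinsB_real x x' : joins genB genB (idx 0) (idx 0) x x' -> exists c, real f x c.
Proof.
move=> [r h]; have [l [hl _]] := realB (i := 0) (j := 0) h erefl erefl.
rewrite walk0 mul1r invr1 mulr1 in hl; exists (f l), l; split=> //.
Qed.

(** Only the source side of the arc correspondence is used: the factors of {{l, l'}} are loops at
    the vertex 0, hence in L. This supplies the tensor on which [reduced_bracket] depends. *)
Lemma db_L_real (l l' : L) : exists t, real_tensor f (db (\val l) (\val l')) t.
Proof.
have [[x [r hx]] [y [q hy]]] := (pentL_joinsB l, pentL_joinsB l').
have [t [t' [ht -> _]]] := arc_compatible hdb hgen gU wU rimg_pE rimg_aE rimg_bE hx hy.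
rewrite tensor_map_id; elim: ht => [|a a' b b' {}t {}t' ha hb _ [u hu]].
  by exists 0; apply: lifts0.
have [[c hc] [d hd]] := (joinsB_real ha, joinsB_real hb).
by exists (c ⊗ d + u); apply: lifts_cons.
Qed.

Let idK : {lrmorphism K -> K} := idfun.

Lemma loop_gen_compatible a b x x' r a' b' y y' q :
  loop_gen a b x x' r -> loop_gen a' b' y y' q ->
  compatible iota idK db dbK loop_gen ok a b x x' r a' b' y y' q.
Proof.
(* In K the bracket is 0, one argument being 1; the specialization of the bracket with Z is
   cancelled by the inner term of its correction. *)
have XYZ p y1 z1 : iota y1 = \val (LXY p) -> s y1 = f (LXY p) ->
    iota z1 = pZ n_gt0 g -> s z1 = 1 ->
  compatible iota idK db dbK loop_gen ok tt tt z1 1 (fun=> 2^-1 *: (1 ⊗ 1))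
    tt tt y1 (f (LXY p)) (fun=> 0).
  move=> e1 e2 e3 e4.
  have hr : real_tensor f (db (pZ n_gt0 g) (\val (LXY p)))
      (2^-1 *: (1 ⊗ f (LXY p)) - 2^-1 *: (f (LXY p) ⊗ 1)).
    case: p {e1 e2} => -[] o /=.
      have := db_Z_loop_a hdb hgen gU fZ (lap o.+1%:Z).
      rewrite -LXE // (@LX_mod _ _ _ _ gU (lap o.+1%:Z) o.+1%:Z) ?index_lap //.
    have := db_Z_loop_b hdb hgen gU fZ (lap o.+1%:Z).
    by rewrite -LYE // (@LY_mod _ _ _ _ gU (lap o.+1%:Z) o.+1%:Z) ?index_lap.
  have [u [hu eu]] := real_tensor_lifts hr.
  exists u, (2^-1 *: (1 ⊗ f (LXY p)) - 2^-1 *: (f (LXY p) ⊗ 1)).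
  split=> //; first by rewrite e1 e3 eu.
  rewrite (db_1l hdbK) tensor_map_id /inner tensor_swap0; tens_norm.
  zmod_solve.
case=> [p {}x ex sx|{}x ex sx]; case=> [p' {}y ey sy|{}y ey sy].
(* On two coordinates there is no correction: [hred] prescribes the bracket of K. *)
- have [t ht] := db_L_real (LXY p) (LXY p').
  have [tL [e1 e2]] := real_tensor_map ht.
  have [u [hu eu]] := real_tensor_lifts ht; exists u, t; split=> //.
    by rewrite ex ey eu.
  rewrite /inner tensor_swap0; tens_norm; rewrite tensor_map_id -e2.
  by case: hred => _; apply.
- by apply: compatible_sym => //; apply: XYZ.
- exact: XYZ.
- exists 0, 0; split; first exact: lifts0.
    by rewrite ex ey -walk_n // db_walk_walk // tensor_map0.
  rewrite (db_1l hdbK) tensor_map_id /inner tensor_swapZ tensor_swap_tens.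
  tens_norm; zmod_solve.
Qed.

Let loopish z := exists c, loop_over z c.

Let loopishM z t : loopish z -> loopish t -> loopish (z * t).
Proof. by move=> [c hc] [d hd]; exists (c * d); apply: loop_overM. Qed.

Let loopish_real z c : real f z c -> loopish z.
Proof. by move=> [l [<- _]]; exists (f l); apply: loop_over_L. Qed.

Let loopish_turn i j : idx i = idx j -> loopish (walk i * (walk j)^-1).
Proof. by move=> e; apply: loopish_real; apply/real_of_realU/(realU_turn1 gU fZ e). Qed.

Let loopish_sum i : loop_over (la i + lb i) (f (LX i) + f (LY i)).
Proof.
have [[l [hl lX]] [l' [hl' lY]]] :=
  (real_of_realU (realU_loop_a gU fZ i), real_of_realU (realU_loop_b gU fZ i)).
by have := loop_over_L (l + l'); rewrite [\val _]rmorphD [f _]rmorphD /= hl hl' lX lY.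
Qed.

Let loopish_sumV i : loopish (la i + lb i)^-1.
Proof. by eexists; apply: loop_overV (loopish_sum i); apply: SxU. Qed.

Let loopish_shift i i' j j' z : idx i = idx i' -> idx j = idx j' ->
  loopish (walk i * z * (walk j)^-1) -> loopish (walk i' * z * (walk j')^-1).
Proof.
move=> ei ej h; have := loopishM (loopishM (loopish_turn (esym ei)) h) (loopish_turn ej).
by rewrite !mulrA !(divrK, mulrVK) ?walk_unit.
Qed.

Let loopish_gen a b x x' r i j : genB a b x x' r -> idx i = a -> idx j = b ->
  loopish (walk (i + 2) * iota x' * (walk (j + 2))^-1).
Proof.
case=> k ei ej.
- apply: (@loopish_shift (k + 1) _ (k + 2)); rewrite ?rimg_pE.
  + by rewrite (index_modDr 2 ei); congr index_mod; ring.
  + by rewrite (index_modDr 2 ej).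
  + rewrite (_ : k + 1 = k + 2 - 1); last by ring.
    by rewrite -walkS // divrr ?walk_unit //; exists 1; apply: loop_over1.
- apply: (@loopish_shift k _ (k + 1)); rewrite ?rimg_aE.
  + by rewrite (index_modDr 2 ei) subrK.
  + by rewrite (index_modDr 2 ej); congr index_mod; ring.
  + rewrite image_loop_a //; apply: loopishM; last by eexists; apply: loopish_sum.
    by apply: loopishM (loopish_sumV k) _;
      apply: loopish_real (real_of_realU (realU_loop_a gU fZ k)).
- apply: (@loopish_shift k _ (k + 2)); rewrite ?rimg_bE.
  + by rewrite (index_modDr 2 ei) subrK.
  + by rewrite (index_modDr 2 ej).
  + rewrite image_loop_b //; apply: loopishM; last by eexists; apply: loopish_sum.
    by apply: loopishM (loopish_sumV _) _;
      apply: loopish_real (real_of_realU (realU_loop_b gU fZ _)).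
Qed.

(** The image of a path starts and ends two vertices further, hence the walks at i + 2 and j + 2. On
    generators, [image_loop_a] and [image_loop_b] make the closed image rational in the loops. *)
Lemma qpath_loop_over a b x x' r i j : qpath genB genB a b x x' r ->
  idx i = a -> idx j = b ->
  exists c, loop_over (walk (i + 2) * iota x' * (walk (j + 2))^-1) c.
Proof.
move=> h; elim: h i j => {a b x x' r}.
- by move=> a b x x' r h i j ei ej; apply: loopish_gen h ei ej.
- move=> a i j ei ej; rewrite rmorph1 mulr1; apply: loopish_turn.
  by apply: index_modDr; rewrite ei ej.
- move=> a b z x x' r y y' q _ hx _ hy i j ei ej.
  have [[c hc] [d hd]] := (hx i j ei ej, hy i j ei ej); exists (z *: c + d).
  rewrite linearP !mulrDr !mulrDl -!scalerAr -!scalerAl.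
  exact: loop_over_lin.
- move=> a b e x x' r y y' q _ hx _ hy i j ei ej.
  have et := index_mod_ord n_gt0 b.
  have := loopishM (hx i b.+1%:Z ei et) (hy b.+1%:Z j et ej).
  by rewrite !mulrA !(divrK, mulrVK) ?walk_unit // rmorphM !mulrA.
- move=> a b x x' r y y' _ _ hg xy yx xy' yx' i j ei ej.
  have [c hc] := loopish_gen hg ej ei.
  have e1 : iota x' * iota y' = 1 by rewrite -rmorphM xy' rmorph1.
  have e2 : iota y' * iota x' = 1 by rewrite -rmorphM yx' rmorph1.
  exists (s y'); apply: (loop_over_inv hc).
  + exact: lies_over_conj (lies_over_s y').
  + by rewrite !mulrA mulrVK ?walk_unit // -(mulrA _ (iota x')) e1 mulr1 divrr ?walk_unit.
  + by rewrite !mulrA mulrVK ?walk_unit // -(mulrA _ (iota y')) e2 mulr1 divrr ?walk_unit.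
Qed.

Lemma reduced_invariance (u v : L) : exists w : L,
  \val w = bracket db (\val u) (\val v) /\
  eq_mod_comm (bracket dbK (Tq u) (Tq v)) (Tq w).
Proof.
(* Loops are conjugated to the vertex -2: their images are then loops at the vertex 0, where the
   closing walk is 1, so that the image itself is rational in loops. *)
pose h := walk (- 2); have hU : h \is a GRing.unit by apply: walk_unit.
have [[h1 hh1] [h2 hh2]] := reversible_walk n_gt0 gU rimg_a rimg_b ipU (- 2).
have loopB (l : L) : exists x' r, [/\
    qpath genB genB (idx (- 2)) (idx (- 2)) (h^-1 * \val l * h) x' r,
    s x' = Tq l & joins loop_gen ok tt tt x' (Tq l)].
  have [l' hl] := pentL_joinsB l.
  have [r hr] := joinsM (joinsM hh2 hl) hh1.
  have sx : s (h2 * l' * h1) = Tq l.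
    apply/esym/real_fun; have := realB (i := - 2) (j := - 2) hr erefl erefl.
    by rewrite -/h !mulrA divrr // mul1r mulrK.
  exists (h2 * l' * h1), r; split=> //.
  have [c] := qpath_loop_over (i := - 2) (j := - 2) hr erefl erefl.
  rewrite addNr walk0 invr1 mul1r mulr1 => -[y [/iota_inj -> hy]].
  by rewrite -sx -(joinsA_s hy).
have [[x [r [px sx jx]]] [y [q [py sy jy]]]] := (loopB u, loopB v).
have [t [t' [ht t1 t2]]] := arc_compatible hdb hgen gU wU rimg_pE rimg_aE rimg_bE px py.
have [[ra pa] [rb pb]] := (jx, jy).
have [z [z' [hz z1 z2]]] := qpath_compatible hdb hdbK loop_gen_compatible pa pb.
(* Both tensors go to the bracket of [iota x] and [iota y] in F ⊗ F, the left one by the loops, the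
   right one by the arcs. *)
have ez : z = t' + inner (idx (- 2)) (idx (- 2)) x r (idx (- 2)) (idx (- 2)) y q.
  by apply: (tensor_map_inj iota_inj); rewrite -z1 t2.
have ez' : z' = tensor_map s s z.
  elim: hz => [|a a' b b' {}t0 {}t0' ha hb _ IH]; first by rewrite tensor_map0.
  by rewrite tensor_mapD tensor_map_tens -IH (joinsA_s ha) (joinsA_s hb).
(* The error term of [bracket_conj] is the commutator of v with h {u, h^-1}. The latter is a loop at
   the vertex 0, and [lm] is this element of L. *)
have [u' [ru hu]] := pentL_joinsB u; have [rh hh] := hh2.
have [e [e' [he e1 _]]] := arc_compatible hdb hgen gU wU rimg_pE rimg_aE rimg_bE hu hh.
have jm := joinsM hh1 (lifts_joins he hh2).
have [lm [lmE _]] : real Tq (h * tensor_mult e) (s (h1 * tensor_mult e')).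
  case: jm => rm /(realB (i := 0) (j := 0)) /(_ erefl erefl).
  by rewrite walk0 invr1 mul1r mulr1.
have [lw [lwE lwT]] : real Tq (h * tensor_mult t * h^-1) (s (tensor_mult t')).
  have [rt jt] : joins genB genB (idx (- 2)) (idx (- 2)) (tensor_mult t) (tensor_mult t').
    by apply: lifts_joins ht _; exists r; apply: px.
  exact: (realB (i := - 2) (j := - 2) jt erefl erefl).
rewrite tensor_map_id in t1; rewrite tensor_map_id in e1.
have hc := bracket_conj hdb (\val u) (\val v) (divrr hU) (mulVr hU).
exists (lw - (lm * v - v * lm)); split.
  rewrite !(rmorphB, rmorphM) /= lwE lmE -t1 -e1.
  by rewrite -/(bracket _ _ _) -/(bracket _ _ _) hc addrK.
rewrite !(rmorphB, rmorphM) /= lwT /bracket z2 tensor_map_id ez' ez.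
rewrite tensor_mapD tensor_multD tensor_multD !tensor_mult_map !tensor_mult_inner_comm.
(* In this order: the correction on arcs, the correction on loops, the change of base vertex. *)
exists [:: (s y, s (tensor_mult (r (idx (- 2))))); (Tq v, tensor_mult (ra tt)); (Tq lm, Tq v)].
rewrite !big_cons big_nil /= !(rmorphB, rmorphM) /=.
zmod_solve.
Qed.
End Images.

Theorem reduced_pentagram_invariance (Tq : {lrmorphism L -> K}) :
  Tq LZ = 1 ->
  (forall i, Tq (LX i) = (f (LX i) + f (LY i))^-1 * f (LX i)
    * (f (LX (i + 2)) + f (LY (i + 2)))) ->
  (forall i, Tq (LY i) = (f (LX (i + 1)) + f (LY (i + 1)))^-1
    * f (LY (i + 1)) * (f (LX (i + 3)) + f (LY (i + 3)))) ->
  forall u v : L, exists w : L,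
    \val w = bracket db (\val u) (\val v) /\
    eq_mod_comm (bracket dbK (Tq u) (Tq v)) (Tq w).
Proof.
have [rp [rpE rpS]] := choose lies_over_p.
have [rA [rAE rAS]] := choose lies_over_A.
have [rE [rEE rES]] := choose lies_over_E.
have [rD [rDE rDS]] := choose lies_over_D.
move=> TZ TX TY u v.
exact: (reduced_invariance rpE rpS rAE rAS rEE rES rDE rDS TZ TX TY).
Qed.
End ReducedInvariance.

Unset Implicit Arguments.
Set Strict Implicit.
Set Printing Implicit Defensive.

Theorem theorem12 (n : nat) (n_gt0 : (0 < n)%N)
    (F : unitAlgType rat) (g : letter * 'I_n -> F)
    (db : {bilinear F -> F -> tensor F F}) :
  free_skew_field g -> double_bracket db -> pent_bracket_gens g db ->
  let L := pentL n_gt0 g in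
  (* (a) *)
  (forall (L1 : algType rat) (q : {lrmorphism L -> L1})
      (K : unitAlgType rat) (j : {lrmorphism L1 -> K})
      (dbK : {bilinear K -> K -> tensor K K}) (T : {lrmorphism L1 -> K}),
    let X i := j (q (LX n_gt0 g i)) in
    let Y i := j (q (LY n_gt0 g i)) in
    (forall x : L1, exists u : L, q u = x) ->
    (forall u : L, q u = 0 <-> in_ideal (LZ n_gt0 g - 1) u) ->
    injective j ->
    free_skew_field (fun p => j (q (LXY n_gt0 g p))) ->
    reduced_bracket n_gt0 g db (j \o q) dbK ->
    (forall i : int,
      T (q (LX n_gt0 g i)) = (X i + Y i)^-1 * X i * (X (i + 2) + Y (i + 2))) ->
    (forall i : int,
      T (q (LY n_gt0 g i)) =
        (X (i + 1) + Y (i + 1))^-1 * Y (i + 1) * (X (i + 3) + Y (i + 3))) ->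
    forall u v : L, exists w : L,
      \val w = bracket db (\val u) (\val v) /\
      eq_mod_comm (bracket dbK (T (q u)) (T (q v))) (T (q w))) /\
  (* (b) *)
  (forall S2T : {lrmorphism L -> F},
    (forall i : int, S2T (LX n_gt0 g i) = tX n_gt0 g (i - 2)) ->
    (forall i : int, S2T (LY n_gt0 g i) = tY n_gt0 g (i - 2)) ->
    S2T (LZ n_gt0 g) = pZ n_gt0 g ->
    forall u v : L, exists w : L,
      \val w = bracket db (\val u) (\val v) /\
      eq_mod_comm (bracket db (S2T u) (S2T v)) (S2T w)).
Proof.
move=> hfree hdb hgen L; split; last first.
  by move=> phi hX hY hZ; apply: shifted_pentagram_invariance.
move=> L1 q K j dbK T X Y _ hker _ hfreeK hred hTX hTY u v.
pose f : {lrmorphism L -> K} := j \o q.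
pose Tq : {lrmorphism L -> K} := T \o q.
have qZ : q (LZ n_gt0 g) = 1.
  apply/eqP; rewrite -subr_eq0 -(rmorph1 q) -rmorphB; apply/eqP/hker.
  by exists [:: (1, 1)]; rewrite big_seq1 mul1r mulr1.
have fZ : f (LZ n_gt0 g) = 1 by rewrite /= qZ rmorph1.
have TZ : Tq (LZ n_gt0 g) = 1 by rewrite /= qZ rmorph1.
have [K_skew _ _] := hfreeK.
have [_ _ /(_ K (special_values f) K_skew)] := hfree.
move=> [R [iota [s [iota_inj hR hinv]]]].
apply: (reduced_pentagram_invariance hfree hdb hgen fZ hfreeK hred iota_inj hR
  hinv (Tq := Tq)) => //.
Qed.
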